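(* Let $A=T(V)\otimes kG\otimes T(V^* )$ be an indecomposable Hopf algebra with (free) triangular decomposition of weakly separable type over a group $G$, with generators $v_1,\dots,v_n$ of $V$, $f_1,\dots,f_n$ of $V^*$, group elements $k_1,\dots,k_n,l_1,\dots,l_n$ and characters $\lambda_1,\dots,\lambda_n$ as described in the context. Then the commutator relations of $A$ are of the form $$[f_i,v_j]=f_iv_j-v_jf_i=\gamma_{ij}(k_j-l_i),\qquad \text{for all } 1\le i,j\le n,$$ where the $\gamma_{ij}$ are scalars in $k$ such that $\gamma_{ij}=0$ whenever $\lambda_i\neq\lambda_j$, in which case also $\langle f_i,v_j\rangle=0$, or if either of $l_i$ or $k_j$ is not central. Conversely, any choice of such scalars gives a pointed Hopf algebra of this form.
   Context: Let $k$ be a field, $G$ a group (not assumed finite), $H=kG$. **Free braided doubles.** Let $V$ be a finite-dimensional left $H$-module and $V^*$ its dual with pairing $\langle\ ,\ \rangle:V^*\otimes V\to k$ and right action $\langle f\triangleleft h,v\rangle=\langle f,h\triangleright v\rangle$. For a linear map $\beta:V^*\otimes V\to H$, $A_\beta(V,V^* )$ is the algebra generated by $V,H,V^*$ with relations $fh=h_{(1)}(f\triangleleft h_{(2)})$, $hv=(h_{(1)}\triangleright v)h_{(2)}$, $[f,v]=fv-vf=\beta(f\otimes v)$. It is a free braided double, written $A=T(V)\otimes H\otimes T(V^* )$, if multiplication $T(V)\otimes H\otimes T(V^* )\to A_\beta(V,V^* )$ is a linear isomorphism. The natural grading is $\deg v=1$, $\deg h=0$, $\deg f=-1$. **Triangular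 decomposition.** A bialgebra with (free) triangular decomposition over $H$ is a free braided double $A$ with a bialgebra structure such that $H$ is a subcoalgebra with its original coproduct, $T(V)\otimes H$ and $H\otimes T(V^* )$ are closed under the coproduct, and coproduct and counit are morphisms of graded algebras. It is a Hopf algebra with triangular decomposition if it also has an antipode preserving the natural grading and the subspaces $T(V)\otimes H$, $H\otimes T(V^* )$. These axioms, with the counit property, give $\Delta(V)\subseteq V\otimes H+H\otimes V$ and $\Delta(V^* )\subseteq V^*\otimes H+H\otimes V^*$. Composing $\Delta$ with the projections onto the two summands gives right and left $H$-coactions, that is, right and left $G$-gradings, on $V$ and on $V^*$, which are Yetter--Drinfeld compatible with the $G$-actions. **Weakly separable type.** The $n=\dim V$ right degrees of a homogeneous basis of $V$ are pairwise distinct group elements, and the same holds for the left degrees of $V$ and for the right and left degrees of $V^*$. The homogeneous components are then one-dimensional, and $G$ permutes the lines spanned by homogeneous basis elements; one writes $g\triangleright v_i=\lambda_i(g)v_{g(i)}$ and $f_i\triangleleft g=\mu_i(g)f_{g(i)}$, where $i\mapsto g(i)$ is an action of $G$ on $\{1,\dots,n\}$ and $\lambda_i(g),\mu_i(g)\in k$ are scalars; the functions $\lambda_i,\mu_i$ are called the characters of the actions. **Indecomposable.** For a pointed Hopf algebra $A$, let $\Gamma_A$ be the graph whose vertices are the grouplike elements, with an edge $h\to g$ if there is $x\in A$, not contained in the span of the grouplike elements, with $\Delta(x)=x\otimes g+h\otimes x$. $A$ is indecomposable if $\Gamma_A$ is connected (equivalently, $A$ is indecomposable as a coalgebra). **Form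 of the generators.** For an indecomposable $A$ of weakly separable type, the group $G$ is generated by elements $k_1,\dots,k_n,l_1,\dots,l_n$ with $k_il_j=l_jk_i$ for all $i,j$, such that there are generators $v_1,\dots,v_n$ of $V$ and $f_1,\dots,f_n$ of $V^*$ (bases, not necessarily dual to each other) with $$\Delta(v_i)=v_i\otimes k_i+1\otimes v_i,\qquad \Delta(f_i)=f_i\otimes 1+l_i\otimes f_i,$$ and the characters satisfy $\mu_j(k_i)=\lambda_i(l_j)^{-1}$ for all $i,j$.
   Formalization: The f_i are numbered so that ⟨f_i,v_i⟩≠0 (the claim fails for other numberings, e.g. after swapping f_1,f_2), and weak separability is required of rescaled generators s_i v_i, t_i f_i with s_i,t_i in G, since the normalized v_i all have left degree 1. *)

(* Defs.v *)
From HB Require Import structures.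
From mathcomp Require Import all_boot all_order all_algebra.
From mathcomp Require Import perm boolp.
From mathcomp Require Import finmap monalg.
From Stdlib Require Import Relation_Operators.

Set Implicit Arguments.
Unset Strict Implicit.
Unset Printing Implicit Defensive.

Import GRing.Theory.
Local Open Scope ring_scope.
Local Open Scope quotient_scope.

Section Span.
Variables (k : fieldType) (U : lmodType k) (S : U -> Prop).

Inductive lspan : U -> Prop :=
| lspan0 : lspan 0
| lspanZD c x y of S x & lspan y : lspan (c *: x + y).

Lemma lspan_gen x : S x -> lspan x.
Proof. by move=> Sx; rewrite -[x]scale1r -[_ *: _]addr0; apply: lspanZD lspan0. Qed.

Lemma lspanD x y : lspan x -> lspan y -> lspan (x + y).
Proof.
by elim=> [|c u v Su _ IH] sy; rewrite ?add0r // -addrA; apply: lspanZD (IH sy).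
Qed.

Lemma lspanZ c x : lspan x -> lspan (c *: x).
Proof.
elim=> [|d u v Su _ IH]; first by rewrite scaler0; apply: lspan0.
by rewrite scalerDr scalerA; apply: lspanZD.
Qed.

Lemma lspanN x : lspan x -> lspan (- x).
Proof. by rewrite -scaleN1r; apply: lspanZ. Qed.

Lemma lspanB x y : lspan x -> lspan y -> lspan (x - y).
Proof. by move=> sx /lspanN; apply: lspanD. Qed.

End Span.

Section LinearExtension.
Variables (k : fieldType) (K : choiceType) (W : lmodType k) (phi : K -> W).

Definition malg_ext (x : {malg k[K]}) : W := \sum_(i <- msupp x) x@_i *: phi i.

Lemma malg_extEw (d : {fset K}) x : (msupp x `<=` d)%fset ->
  malg_ext x = \sum_(i <- d) x@_i *: phi i.
Proof.
move=> sxd; rewrite /malg_ext (big_fset_incl _ sxd) // => i _ /mcoeff_outdom ->.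
by rewrite scale0r.
Qed.

Lemma malg_ext_is_linear : linear malg_ext.
Proof.
move=> c x y; pose d := (msupp (c *: x + y) `|` (msupp x `|` msupp y))%fset.
rewrite !(@malg_extEw d); first last.
- by rewrite /d fsubsetUl.
- by rewrite /d fsubsetU // fsubsetUl orbT.
- by rewrite /d fsubsetU // fsubsetUr orbT.
rewrite scaler_sumr -big_split /=; apply: eq_bigr => i _.
by rewrite mcoeffD mcoeffZ scalerDl scalerA.
Qed.

HB.instance Definition _ :=
  GRing.isLinear.Build k {malg k[K]} W *:%R malg_ext malg_ext_is_linear.

Lemma malg_extZ c x : malg_ext (c *: x) = c *: malg_ext x.
Proof. exact: linearZ_LR. Qed.

Lemma malg_extU i : malg_ext << i >> = phi i.
Proof.
by rewrite (malg_extEw msuppU_le) big_seq_fset1 mcoeffUU scale1r.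
Qed.

End LinearExtension.

Section GroupAlgebra.
Variables (k : fieldType) (G : groupType).

Definition grpalg := {malg k[G]}.
HB.instance Definition _ := GRing.Lmodule.on grpalg.

Definition gelt (g : G) : grpalg := << g >>.

Definition grp_mul (x y : grpalg) : grpalg :=
  malg_ext (fun g : G => malg_ext (fun h : G => gelt (g * h)%g) y) x.

Lemma grp_mulr_is_linear x : linear (grp_mul x).
Proof.
move=> c y z.
have E w : grp_mul x w = \sum_(g <- msupp x) x@_g *:
  malg_ext (fun h : G => gelt (g * h)%g) w by [].
rewrite !E scaler_sumr -big_split /=; apply: eq_bigr => g _.
by rewrite malg_ext_is_linear scalerDr !scalerA mulrC.
Qed.
HB.instance Definition _ x :=
  GRing.isLinear.Build k grpalg grpalg *:%R (grp_mul x) (grp_mulr_is_linear x).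

Lemma grp_mull_is_linear y : linear (grp_mul^~ y).
Proof. by move=> c x z; rewrite /grp_mul linearP. Qed.
Lemma grp_mul_gelt g h : grp_mul (gelt g) (gelt h) = gelt (g * h)%g.
Proof. by rewrite /grp_mul malg_extU malg_extU. Qed.

Lemma grp_mulDl : left_distributive grp_mul +%R.
Proof. by move=> x y z; rewrite -[x]scale1r grp_mull_is_linear !scale1r. Qed.

Lemma grp_mulDr : right_distributive grp_mul +%R.
Proof. by move=> x y z; apply: (raddfD (grp_mul x)). Qed.

Lemma grp_mul0l x : grp_mul 0 x = 0.
Proof. by rewrite /grp_mul raddf0. Qed.

Lemma grp_mulZl c x y : grp_mul (c *: x) y = c *: grp_mul x y.
Proof. by rewrite -[c *: x]addr0 grp_mull_is_linear grp_mul0l addr0. Qed.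

Lemma grp_mulZr c x y : grp_mul x (c *: y) = c *: grp_mul x y.
Proof. exact: (linearZ_LR (grp_mul x)). Qed.

Lemma grp_lspan (x : grpalg) : lspan (fun y => exists g, y = gelt g) x.
Proof.
rewrite [x]monalgE; elim/big_ind: _ => [|u v|h _]; first exact: lspan0.
  exact: lspanD.
have -> : << x@_h *g h >> = x@_h *: gelt h :> grpalg.
  by apply/malgP => h'; rewrite mcoeffZ !mcoeffU mulr_natr.
by apply/lspanZ/lspan_gen; exists h.
Qed.

Lemma grp_mulA : associative grp_mul.
Proof.
move=> x y z; elim: (grp_lspan x) => [|c _ u [g ->] _ IHx].
  by rewrite !grp_mul0l.
rewrite (grp_mulDl _ _ (grp_mul y z)) IHx (grp_mulDl _ _ y) (grp_mulDl _ _ z).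
rewrite (grp_mulZl _ _ (grp_mul y z)) (grp_mulZl _ _ y) (grp_mulZl _ _ z).
suff -> : grp_mul (gelt g) (grp_mul y z) = grp_mul (grp_mul (gelt g) y) z by [].
elim: (grp_lspan y) => [|d _ v [h ->] _ IHy].
  by rewrite grp_mul0l (raddf0 (grp_mul _)) grp_mul0l.
rewrite (grp_mulDl _ _ z) (grp_mulDr _ _ v) (grp_mulDl _ _ z).
rewrite (grp_mulZl _ _ z) (grp_mulZr _ _ (gelt h)) (grp_mulZl _ _ z).
rewrite (grp_mulDr _ _ (grp_mul v z)) IHy (grp_mulZr _ _ (grp_mul (gelt h) z)).
suff -> : grp_mul (gelt g) (grp_mul (gelt h) z) =
  grp_mul (grp_mul (gelt g) (gelt h)) z by [].
elim: (grp_lspan z) => [|e _ w [l ->] _ IHz]; first by rewrite !raddf0.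
rewrite (grp_mulDr (gelt h)) (grp_mulDr (gelt g)) (grp_mulDr (grp_mul _ _)) IHz.
by rewrite !grp_mulZr !grp_mul_gelt mulgA.
Qed.

Lemma grp_mul1 : left_id (gelt 1%g) grp_mul.
Proof.
move=> x; elim: (grp_lspan x) => [|c _ u [g ->] _ IHx]; first exact: raddf0.
by rewrite grp_mulDr grp_mulZr IHx grp_mul_gelt mul1g.
Qed.

Lemma grp_mulr1 : right_id (gelt 1%g) grp_mul.
Proof.
move=> x; elim: (grp_lspan x) => [|c _ u [g ->] _ IHx].
  exact: grp_mul0l.
by rewrite grp_mulDl grp_mulZl IHx grp_mul_gelt mulg1.
Qed.

Lemma grp_1neq0 : gelt 1%g != 0.
Proof. by rewrite monalgU_eq0 oner_eq0. Qed.

HB.instance Definition _ := GRing.Zmodule_isNzRing.Build grpalg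
  grp_mulA grp_mul1 grp_mulr1 grp_mulDl grp_mulDr grp_1neq0.

Lemma grp_scalerAl (c : k) (x y : grpalg) : c *: (x * y) = (c *: x) * y.
Proof. by rewrite -[RHS]/(grp_mul _ _) grp_mulZl. Qed.
HB.instance Definition _ := GRing.Lmodule_isLalgebra.Build k grpalg grp_scalerAl.

Lemma grp_scalerAr (c : k) (x y : grpalg) : c *: (x * y) = x * (c *: y).
Proof. by rewrite -[RHS]/(grp_mul _ _) grp_mulZr. Qed.
HB.instance Definition _ := GRing.Lalgebra_isAlgebra.Build k grpalg grp_scalerAr.

End GroupAlgebra.

(* The tensor product over k: the free module on A * B modulo bilinearity. *)
Section TensorProduct.
Variables (k : fieldType) (A B : lmodType k).

Local Notation F := {malg k[(A * B)%type]}.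

Inductive bilin_rel : F -> Prop :=
| BilinDl a a' b : bilin_rel (<< (a + a', b) >> - << (a, b) >> - << (a', b) >>)
| BilinDr a b b' : bilin_rel (<< (a, b + b') >> - << (a, b) >> - << (a, b') >>)
| BilinZl c a b : bilin_rel (<< (c *: a, b) >> - c *: << (a, b) >>)
| BilinZr c a b : bilin_rel (<< (a, c *: b) >> - c *: << (a, b) >>).

Definition bilin_sub : {pred F} := fun x => `[< lspan bilin_rel x >].

Lemma bilin_sub_zmod : zmod_closed bilin_sub.
Proof.
split=> [|x y]; first exact/asboolP/lspan0.
by move=> /asboolP sx /asboolP sy; apply/asboolP/lspanB.
Qed.
HB.instance Definition _ := GRing.isZmodClosed.Build F bilin_sub bilin_sub_zmod.

Definition tens := Quotient.quot bilin_sub.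
HB.instance Definition _ := GRing.Zmodule.on tens.
HB.instance Definition _ := EqQuotient.on tens.

Definition tens_pi (x : F) : tens := \pi_tens x.

Lemma tens_piB : {morph tens_pi : x y / x - y}.
Proof. exact: (raddfB (\pi_(Quotient.quot bilin_sub))). Qed.
HB.instance Definition _ :=
  GRing.isZmodMorphism.Build F tens tens_pi tens_piB.

Lemma tens_piP x y : tens_pi x = tens_pi y <-> lspan bilin_rel (x - y).
Proof.
split=> [e|/asboolP e]; first by apply/asboolP; rewrite -[asbool _]/(x - y \in bilin_sub) Quotient.idealrBE; exact/eqP.
by apply/eqP; rewrite -Quotient.idealrBE.
Qed.

Lemma tens_piK t : tens_pi (repr t) = t.
Proof. exact: reprK. Qed.

Definition tens_scale (c : k) (t : tens) : tens := tens_pi (c *: repr t).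

Lemma tens_scaleE c x : tens_scale c (tens_pi x) = tens_pi (c *: x).
Proof.
apply/tens_piP; rewrite -scalerBr; apply/lspanZ/tens_piP; exact: tens_piK.
Qed.

Lemma tens_scaleA a b t :
  tens_scale a (tens_scale b t) = tens_scale (a * b) t.
Proof. by rewrite tens_scaleE scalerA. Qed.
Lemma tens_scale1 : left_id 1 tens_scale.
Proof. by move=> t; rewrite /tens_scale scale1r tens_piK. Qed.
Lemma tens_scaleDr : right_distributive tens_scale +%R.
Proof.
move=> c t u; rewrite -[t]tens_piK -[u]tens_piK -raddfD !tens_scaleE.
by rewrite scalerDr raddfD.
Qed.
Lemma tens_scaleDl t : {morph tens_scale^~ t : a b / a + b}.
Proof. by move=> a b; rewrite /tens_scale scalerDl raddfD. Qed.
HB.instance Definition _ := GRing.Zmodule_isLmodule.Build k tens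
  tens_scaleA tens_scale1 tens_scaleDr tens_scaleDl.

Definition pure (a : A) (b : B) : tens := tens_pi << (a, b) >>.

Definition bilinear_fun (W : lmodType k) (phi : A -> B -> W) :=
  (forall b, linear (phi^~ b)) /\ (forall a, linear (phi a)).

(* The map a (x) b |-> phi a b; meaningful for bilinear phi (lemma tliftE). *)
Definition tlift (W : lmodType k) (phi : A -> B -> W) (t : tens) : W :=
  malg_ext (fun p => phi p.1 p.2) (repr t).

End TensorProduct.

Notation "a ⊗ b" := (pure a b) (at level 40, left associativity) : ring_scope.

Section TensorTheory.
Variables (k : fieldType) (A B : lmodType k).

Lemma tens_piZ c (x : {malg k[(A * B)%type]}) : tens_pi (c *: x) = c *: tens_pi x.
Proof. by rewrite -tens_scaleE. Qed.

Lemma pure_bilinear : bilinear_fun (@pure k A B).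
Proof.
split=> [b c a a'|a c b b']; rewrite /pure -tens_piZ -raddfD.
  apply: etrans (_ : tens_pi (<< (c *: a, b) >> + << (a', b) >>) = _).
    by apply/tens_piP; rewrite opprD addrA; apply/lspan_gen/BilinDl.
  apply/tens_piP; rewrite opprD addrACA subrr addr0.
  exact/lspan_gen/BilinZl.
apply: etrans (_ : tens_pi (<< (a, c *: b) >> + << (a, b') >>) = _).
  by apply/tens_piP; rewrite opprD addrA; apply/lspan_gen/BilinDr.
apply/tens_piP; rewrite opprD addrACA subrr addr0.
exact/lspan_gen/BilinZr.
Qed.

Lemma tens_lspan (t : tens A B) : lspan (fun u => exists a b, u = a ⊗ b) t.
Proof.
rewrite -[t]tens_piK [repr t]monalgE raddf_sum.
elim/big_ind: _ => [|u v|[a b] _]; first exact: lspan0.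
  exact: lspanD.
have -> : << (repr t)@_(a, b) *g (a, b) >> =
    (repr t)@_(a, b) *: << (a, b) >> :> {malg k[(A * B)%type]}.
  by apply/malgP => h'; rewrite mcoeffZ !mcoeffU mulr_natr.
by rewrite /= tens_piZ; apply/lspanZ/lspan_gen; exists a, b.
Qed.

Variables (W : lmodType k) (phi : A -> B -> W).
Hypothesis phiP : bilinear_fun phi.

Lemma linear_fun_prop (U : lmodType k) (f : U -> W) : linear f ->
  {morph f : x y / x + y} /\ (forall c, {morph f : x / c *: x}).
Proof.
move=> lf; have fD : {morph f : x y / x + y}.
  by move=> x y; rewrite -[x]scale1r lf !scale1r.
have f0 : f 0 = 0 by apply: (addrI (f 0)); rewrite -fD !addr0.
by split=> // c x; rewrite -[c *: x]addr0 lf f0 addr0.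
Qed.

Lemma malg_ext_bilin_rel x :
  lspan (@bilin_rel k A B) x -> malg_ext (fun p => phi p.1 p.2) x = 0.
Proof.
case: phiP => phil phir.
elim=> [|c u v ru _ IH]; first by rewrite /malg_ext msupp0 big_seq_fset0.
rewrite malg_ext_is_linear IH addr0.
suff -> : malg_ext (fun p => phi p.1 p.2) u = 0 by rewrite scaler0.
case: ru => [a a' b|a b b'|d a b|d a b]; rewrite !raddfB /= ?malg_extZ !malg_extU /=.
- by rewrite (linear_fun_prop (phil b)).1 addrAC addrK subrr.
- by rewrite (linear_fun_prop (phir a)).1 addrAC addrK subrr.
- by rewrite (linear_fun_prop (phil b)).2 subrr.
- by rewrite (linear_fun_prop (phir a)).2 subrr.
Qed.

Lemma tlift_pi x : tlift phi (tens_pi x) = malg_ext (fun p => phi p.1 p.2) x.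
Proof.
apply/eqP; rewrite -subr_eq0 /tlift -raddfB; apply/eqP.
by apply: malg_ext_bilin_rel; apply/tens_piP; exact: tens_piK.
Qed.

Lemma tlift_linear : linear (tlift phi).
Proof.
move=> c t u; rewrite -[t]tens_piK -[u]tens_piK -tens_piZ -raddfD !tlift_pi.
exact: linearP.
Qed.

Lemma tliftE a b : tlift phi (a ⊗ b) = phi a b.
Proof. by rewrite tlift_pi malg_extU. Qed.

End TensorTheory.

Section Hopf.
Variables (k : fieldType).

Definition tmap (A B C D : lmodType k) (f : A -> C) (g : B -> D) :
  tens A B -> tens C D := tlift (fun a b => f a ⊗ g b).

Definition tassoc (A B C : lmodType k) :
  tens (tens A B) C -> tens A (tens B C) :=
  tlift (fun s c => tlift (fun a b => a ⊗ (b ⊗ c)) s).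

Definition tmul (A B : algType k) (s t : tens A B) : tens A B :=
  tlift (fun a b => tlift (fun c d => (a * c) ⊗ (b * d)) t) s.

Variables (A : algType k) (Delta : {linear A -> tens A A}).
Variables (eps : {lrmorphism A -> k^o}) (S : {linear A -> A}).

(* eps is a morphism of algebras by its type. *)
Record is_hopf_algebra : Prop := IsHopfAlgebra {
  comult_mul : forall x y, Delta (x * y) = tmul (Delta x) (Delta y);
  comult_one : Delta 1 = 1 ⊗ 1;
  comult_coassoc : forall x,
    tassoc (tmap Delta idfun (Delta x)) = tmap idfun Delta (Delta x);
  counit_left : forall x, tlift (fun a b => (eps a : k) *: b) (Delta x) = x;
  counit_right : forall x, tlift (fun a b => (eps b : k) *: a) (Delta x) = x;
  antipode_left : forall x,
    tlift (fun a b => S a * b) (Delta x) = (eps x : k) *: 1;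
  antipode_right : forall x,
    tlift (fun a b => a * S b) (Delta x) = (eps x : k) *: 1
}.

(* The image of P (x) Q in A (x) A, for P and Q spanning subspaces of A. *)
Definition tens_sub (P Q : A -> Prop) : tens A A -> Prop :=
  lspan (fun t => exists a b, [/\ P a, Q b & t = a ⊗ b]).

Definition grouplike (x : A) : Prop := Delta x = x ⊗ x /\ eps x = 1.

Definition subcoalgebra (C : A -> Prop) : Prop :=
  (forall x, lspan C x -> C x) /\ (forall x, C x -> tens_sub C C (Delta x)).

Definition simple_subcoalgebra (C : A -> Prop) : Prop :=
  [/\ subcoalgebra C, exists2 x, C x & x != 0 &
      forall D, subcoalgebra D -> (forall x, D x -> C x) ->
        (forall x, D x -> x = 0) \/ (forall x, C x -> D x)].

Definition pointed : Prop :=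
  forall C, simple_subcoalgebra C ->
    exists c : A, forall x, C x <-> exists a : k, x = a *: c.

Definition skew_edge (h g : A) : Prop :=
  [/\ grouplike h, grouplike g &
      exists2 x, ~ lspan grouplike x & Delta x = x ⊗ g + h ⊗ x].

Definition indecomposable : Prop :=
  forall g h, grouplike g -> grouplike h ->
    clos_refl_sym_trans A skew_edge g h.

End Hopf.

Section BraidedDouble.
Variables (k : fieldType) (G : groupType) (V : vectType k).
Notation H := (grpalg k G).

Definition dual : vectType k := 'Hom(V, k^o).

(* A left kG-module structure on V, given by the action of the elements of G. *)
Definition is_rep (act : G -> 'End(V)) : Prop :=
  act 1%g = \1%VF /\ forall g h, act (g * h)%g = (act g \o act h)%VF.

Variable act : G -> 'End(V).

Definition ract (f : dual) (g : G) : dual := (f \o act g)%VF.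

Variable beta : {linear tens dual V -> H}.

(* The first two relations are linear in h and hence are imposed for h in G,
   where h_(1) (x) h_(2) = h (x) h. *)
Record double_relations (B : algType k) (jV : {linear V -> B})
    (jH : {lrmorphism H -> B}) (jF : {linear dual -> B}) : Prop := {
  rel_fh : forall f g, jF f * jH (gelt k g) = jH (gelt k g) * jF (ract f g);
  rel_hv : forall g v, jH (gelt k g) * jV v = jV (act g v) * jH (gelt k g);
  rel_fv : forall f v, jF f * jV v - jV v * jF f = jH (beta (f ⊗ v))
}.

(* (A, iV, iH, iF) is the algebra A_beta(V, V^* ) presented by these generators
   and relations. An algType is nonzero; the zero algebra is a target of
   exactly one morphism, so that leaving it out among the B is harmless. *)
Definition is_Abeta (A : algType k) (iV : {linear V -> A})
    (iH : {lrmorphism H -> A}) (iF : {linear dual -> A}) : Prop :=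
  double_relations iV iH iF /\
  forall (B : algType k) (jV : {linear V -> B}) (jH : {lrmorphism H -> B})
    (jF : {linear dual -> B}), double_relations jV jH jF ->
  let extends (phi : {lrmorphism A -> B}) :=
    [/\ forall v, phi (iV v) = jV v, forall h, phi (iH h) = jH h
      & forall f, phi (iF f) = jF f] in
  exists2 phi, extends phi & forall psi, extends psi -> psi =1 phi.

End BraidedDouble.

Section TensorAlgebra.
Variables (k : fieldType) (W : vectType k).

(* T(W), as the free algebra on the basis vbasis {:W}. *)
Definition talg := {malg k[{fmonom 'I_(\dim {:W})}]}.
HB.instance Definition _ := GRing.Lmodule.on talg.

(* The morphism of algebras T(W) -> A which extends j. *)
Definition talg_ext (A : algType k) (j : W -> A) (u : talg) : A :=
  malg_ext (fun m : {fmonom 'I_(\dim {:W})} =>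
    \prod_(i <- fmonom_val m) j (tnth (vbasis {:W}) i)) u.

End TensorAlgebra.

Section Triangular.
Variables (k : fieldType) (G : groupType) (V : vectType k).
Variables (act : G -> 'End(V)).
Variables (beta : {linear tens (dual V) V -> grpalg k G}) (A : algType k).
Variables (iV : {linear V -> A}) (iH : {lrmorphism grpalg k G -> A}).
Variables (iF : {linear dual V -> A}).

Definition triangular_mul :
  tens (tens (talg V) (grpalg k G)) (talg (dual V)) -> A :=
  tlift (fun s w =>
    tlift (fun u h => talg_ext iV u * iH h) s * talg_ext iF w).

Definition free_braided_double : Prop :=
  [/\ is_rep act, is_Abeta act beta iV iH iF & bijective triangular_mul].

Definition in_TVH : A -> Prop :=
  lspan (fun x => exists u h, x = talg_ext iV u * iH h).

Definition in_HTF : A -> Prop :=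
  lspan (fun x => exists h w, x = iH h * talg_ext iF w).

Definition homog (d : int) : A -> Prop :=
  lspan (fun x => exists (vs : seq V) (h : grpalg k G) (fs : seq (dual V)),
    d = (size vs)%:Z - (size fs)%:Z /\
    x = (\prod_(v <- vs) iV v) * iH h * (\prod_(f <- fs) iF f)).

Variables (Delta : {linear A -> tens A A}) (eps : {lrmorphism A -> k^o}).
Variable S : {linear A -> A}.

Definition homog2 (d : int) : tens A A -> Prop :=
  lspan (fun t => exists d1 d2 a b,
    [/\ d = d1 + d2, homog d1 a, homog d2 b & t = a ⊗ b]).

Record triangular_hopf : Prop := TriangularHopf {
  th_free : free_braided_double;
  th_hopf : is_hopf_algebra Delta eps S;
  th_H : forall g, Delta (iH (gelt k g)) = iH (gelt k g) ⊗ iH (gelt k g);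
  th_comult_TVH : forall x, in_TVH x -> tens_sub in_TVH in_TVH (Delta x);
  th_comult_HTF : forall x, in_HTF x -> tens_sub in_HTF in_HTF (Delta x);
  th_comult_graded : forall d x, homog d x -> homog2 d (Delta x);
  th_counit_graded : forall d x, homog d x -> d != 0 -> eps x = 0;
  th_antipode_graded : forall d x, homog d x -> homog d (S x);
  th_antipode_TVH : forall x, in_TVH x -> in_TVH (S x);
  th_antipode_HTF : forall x, in_HTF x -> in_HTF (S x)
}.

Section Degrees.
Variables (W : vectType k) (j : {linear W -> A}).

Definition in_im (a : A) : Prop := exists w, a = j w.
Definition in_H (a : A) : Prop := exists h, a = iH h.

(* For w in W = V, V^*: Delta w lies in the direct sum of W (x) H and H (x) W,
   and w has right degree g if its component in W (x) H is w (x) g. *)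
Definition right_degree (w : W) (g : G) : Prop :=
  tens_sub in_H in_im (Delta (j w) - j w ⊗ iH (gelt k g)).

Definition left_degree (w : W) (g : G) : Prop :=
  tens_sub in_im in_H (Delta (j w) - iH (gelt k g) ⊗ j w).

Definition distinct_degrees (deg : W -> G -> Prop) : Prop :=
  exists (e : (\dim {:W}).-tuple W) (d : 'I_(\dim {:W}) -> G),
    [/\ basis_of {:W} e, forall i, deg (tnth e i) (d i) & injective d].

End Degrees.

Definition weakly_separable : Prop :=
  [/\ distinct_degrees (right_degree iV), distinct_degrees (left_degree iV),
      distinct_degrees (right_degree iF) & distinct_degrees (left_degree iF)].

End Triangular.

Section Generators.
Variables (k : fieldType) (G : groupType) (V : vectType k).
Variables (act : G -> 'End(V)) (n : nat).
Variables (v : n.-tuple V) (f : n.-tuple (dual V)) (kk ll : 'I_n -> G).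
Variables (p : G -> 'I_n -> 'I_n) (lam mu : 'I_n -> G -> k).

Definition generated_by (X : G -> Prop) : Prop :=
  forall P : G -> Prop, P 1%g -> (forall x y, P x -> P y -> P (x * y)%g) ->
    (forall x, P x -> P x^-1%g) -> (forall x, X x -> P x) -> forall x, P x.

Definition central (g : G) : Prop := forall h, commute g h.

(* gd_paired fixes the numbering of the f_i relative to the v_i; some
   numbering always satisfies it, see pairing_numbering.  The index action p is
   the same for V and V^*. *)
Record generator_data : Prop := GeneratorData {
  gd_basis_v : basis_of {:V} v;
  gd_basis_f : basis_of {:dual V} f;
  gd_paired : forall i, tnth f i (tnth v i) != 0;
  gd_perm1 : forall i, p 1%g i = i;
  gd_permM : forall g h i, p (g * h)%g i = p g (p h i);
  gd_act_v : forall g i, act g (tnth v i) = lam i g *: tnth v (p g i);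
  gd_act_f : forall g i, ract act (tnth f i) g = mu i g *: tnth f (p g i);
  gd_gen : generated_by (fun g => exists i, g = kk i \/ g = ll i);
  gd_comm : forall i j, commute (kk i) (ll j);
  gd_char : forall i j, mu j (kk i) = (lam i (ll j))^-1
}.

(* Group-theoretic conditions which hold for the data of every algebra as in
   ws_hopf_algebra below: compatibility of the degrees k_i, l_i with the action
   of G; the identity (l_j |> v_i) (x) (f_j <| k_i) = v_i (x) f_j behind
   gd_char, as far as it concerns the indices; and weak separability, where the
   rescaled generators s_i v_i and t_i f_i have degrees (left, right) equal to
   (s_i, s_i k_i) and (t_i l_i, t_i). *)
Record degree_data : Prop := DegreeData {
  dd_yd_k : forall g i, (g * kk i = kk (p g i) * g)%g;
  dd_yd_l : forall g i, (ll i * g = g * ll (p g i))%g;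
  dd_fix_v : forall i j, p (ll j) i = i;
  dd_fix_f : forall i j, p (kk i) j = j;
  dd_ws : exists s t : 'I_n -> G,
    [/\ injective s, injective (fun i => (s i * kk i)%g),
        injective t, injective (fun i => (t i * ll i)%g) &
        forall i j, mu j (s i) = (lam i (t j))^-1]
}.

Variables (A : algType k) (beta : {linear tens (dual V) V -> grpalg k G}).
Variables (iV : {linear V -> A}) (iH : {lrmorphism grpalg k G -> A}).
Variables (iF : {linear dual V -> A}).
Variables (Delta : {linear A -> tens A A}) (eps : {lrmorphism A -> k^o}).
Variable S : {linear A -> A}.

(* Generators with Delta v = v (x) k + 1 (x) v all have left degree 1, so that
   for n > 1 they do not span a weakly separable V themselves: they arise from
   such a V by multiplication with group elements. Hence A is of weakly
   separable type if its decomposition over the span of some s_i v_i and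
   t_i f_i (which has the same T(V) (x) H and H (x) T(V^* )) is weakly
   separable; s = t = 1 gives back the decomposition over the v_i and f_i. *)
Definition weakly_separable_type : Prop :=
  exists (s t : 'I_n -> G) (beta0 : {linear tens (dual V) V -> grpalg k G})
    (jV : {linear V -> A}) (jF : {linear dual V -> A}),
  [/\ forall i, jV (tnth v i) = iH (gelt k (s i)) * iV (tnth v i),
      forall i, jF (tnth f i) = iH (gelt k (t i)) * iF (tnth f i),
      triangular_hopf act beta0 jV iH jF Delta eps S &
      weakly_separable jV iH jF Delta].

Record ws_hopf_algebra : Prop := WsHopfAlgebra {
  wh_hopf : triangular_hopf act beta iV iH iF Delta eps S;
  wh_indec : indecomposable Delta eps;
  wh_ws : weakly_separable_type;
  wh_gen : generator_data;
  wh_comult_v : forall i, Delta (iV (tnth v i)) =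
    iV (tnth v i) ⊗ iH (gelt k (kk i)) + 1 ⊗ iV (tnth v i);
  wh_comult_f : forall i, Delta (iF (tnth f i)) =
    iF (tnth f i) ⊗ 1 + iH (gelt k (ll i)) ⊗ iF (tnth f i)
}.

Definition commutator_relations (gamma : 'M[k]_n) : Prop :=
  forall i j : 'I_n,
    iF (tnth f i) * iV (tnth v j) - iV (tnth v j) * iF (tnth f i) =
    gamma i j *: (iH (gelt k (kk j)) - iH (gelt k (ll i))).

End Generators.

Lemma pairing_numbering (k : fieldType) (V : vectType k) (n : nat)
    (v : n.-tuple V) (f : n.-tuple (dual V)) :
  basis_of {:V} v -> basis_of {:dual V} f ->
  exists s : 'S_n, forall i, tnth f (s i) (tnth v i) != 0.
Proof.
move=> bv bf; pose M := \matrix_(i, j) (tnth f i (tnth v j) : k).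
have Mu : M \in unitmx.
  rewrite -row_free_unit; apply/inj_row_free => u uM.
  have fu0 : \sum_i u 0 i *: tnth f i = 0.
    apply/lfunP => x; rewrite (coord_basis bv (memvf x)) !linear_sum.
    apply: eq_bigr => j _; rewrite !linearZ /=; congr (_ *: _).
    rewrite lfunE /= sum_lfunE; have /matrixP/(_ 0 j) := uM.
    rewrite !mxE -(tnth_nth 0) => uMj; apply: etrans uMj.
    by apply: eq_bigr => i _; rewrite !lfunE /= mxE.
  apply/rowP => i; rewrite mxE.
  have /freeP/(_ (fun i => u 0 i)) := basis_free bf; apply.
  by rewrite -[RHS]fu0; apply: eq_bigr => j _; rewrite -tnth_nth.
have : \det M != 0 by rewrite -unitfE -unitmxE.
case: (boolP [exists s : 'S_n, [forall i, tnth f (s i) (tnth v i) != 0]]).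
  by case/existsP => s /forallP ? _; exists s.
rewrite negb_exists => /forallP no /eqP[].
rewrite -det_tr; apply: big1 => s _.
have := no s; rewrite negb_forall => /existsP[i /negPn/eqP z].
by rewrite (bigD1 i) //= !mxE z mul0r mulr0.
Qed.

(* Main.v *)
Require Import Defs.
From HB Require Import structures.
From mathcomp Require Import all_boot all_order all_algebra.
From mathcomp Require Import perm boolp.
From mathcomp Require Import finmap monalg.
From Stdlib Require Import Relation_Operators.

Set Implicit Arguments.
Unset Strict Implicit.
Unset Printing Implicit Defensive.

Import GRing.Theory.
Local Open Scope ring_scope.

(** The first half computes Delta [f_i, v_j]. The commutator lies in H = kG, so
    the part l_i v_j (x) f_i k_j - v_j l_i (x) k_j f_i of its coproduct has to
    vanish; monomials in a free double are linearly independent, hence l_i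
    fixes the index j and k_j fixes the index i ([index_fixed]). As the k_i and
    l_i generate G, the group fixes all indices. Then G is abelian
    ([G_abelian]): in Delta (g v_j) = lambda_j(g) Delta (v_j g) one sees
    g k_j = k_j g, and similarly for l_i. What is left of Delta [f_i, v_j] says
    that the commutator is a skew primitive element of kG, so it is a multiple
    of k_j - l_i ([commutator_skew]). The characters of f_i and v_i agree, since
    both describe the scalar <f_i, v_i>, which is not 0; conjugation by g then
    multiplies [f_i, v_j], and relates <f_i, v_j> to itself, by
    lambda_i(g) / lambda_j(g), so that both vanish unless the characters of v_i
    and v_j are equal.

    For the converse the compatibility conditions again make G abelian and its
    action on the indices trivial. The algebra is defined on the free module
    with basis v_m1 g f_m2, for words m1 and m2 and g in G, through the operators
    of left multiplication by v_i, g and f_j; the operator f_j is defined by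
    recursion on m1. These operators satisfy the relations of the double: the
    one point is f_j g = lambda_j(g) g f_j, which holds because gamma_ij is 0
    unless lambda_i = lambda_j ([opYK]). Conversely every space with operators
    that satisfy the relations is a module ([ev_mul]). Applied to the free module
    this is associativity, and applied to the elements of another algebra it is
    the universal property of the double ([homM]). In particular the coproduct,
    the counit and the antipode exist as soon as the relations are checked in
    A (x) A, in k and in the opposite algebra, and the axioms of a Hopf algebra
    can be tested on the generators. Freeness holds by construction.

    The algebra is pointed, and its group-like elements are those of G, because
    every nonzero subcoalgebra contains an element of G: among the terms of
    Delta (v_m1 g f_m2) the only one whose left component has full length is
    v_m1 g f_m2 (x) k_m1 g, so that contracting the coproduct with the coordinate
    of a longest monomial leaves a multiple of k_m1 g
    ([subcoalgebra_grouplike]). Weak separability refers to the decomposition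
    over the elements s_i v_i and t_j f_j; all properties of the decomposition
    are therefore proved for these elements, under the condition
    lambda_i(s_j) lambda_j(t_i) = 1 which makes their commutators elements of
    kG ([tw_triangular_hopf]). *)

(** * Linear maps, spans and tensor products *)

Section LinearToolkit.
Variable k : fieldType.
Implicit Types A B U W : lmodType k.

Section OneMap.
Variables (U W : lmodType k) (F : U -> W).
Hypothesis lF : linear F.

Lemma linD x y : F (x + y) = F x + F y.
Proof. exact: (linear_fun_prop lF).1. Qed.
Lemma linZ c x : F (c *: x) = c *: F x.
Proof. exact: (linear_fun_prop lF).2. Qed.
Lemma lin0 : F 0 = 0.
Proof. by rewrite -(scale0r 0) linZ scale0r. Qed.
Lemma linN x : F (- x) = - F x.
Proof. by rewrite -scaleN1r linZ scaleN1r. Qed.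
Lemma linB x y : F (x - y) = F x - F y.
Proof. by rewrite linD linN. Qed.

Lemma lspan_image (S : U -> Prop) (T : W -> Prop) :
  (forall x, S x -> lspan T (F x)) -> forall x, lspan S x -> lspan T (F x).
Proof.
move=> ST x; elim=> [|c y z Sy _ IH]; first by rewrite lin0; exact: lspan0.
by rewrite lF; apply: lspanD => //; apply/lspanZ/ST.
Qed.

End OneMap.

Lemma lspan_mono U (S T : U -> Prop) :
  (forall x, S x -> lspan T x) -> forall x, lspan S x -> lspan T x.
Proof. exact: (@lspan_image U U id). Qed.

Lemma lspan_eq U W (S : U -> Prop) (F F' : U -> W) : linear F -> linear F' ->
  (forall x, S x -> F x = F' x) -> forall x, lspan S x -> F x = F' x.
Proof.
move=> lF lF' e x; elim=> [|c y z Sy _ IH]; first by rewrite !lin0.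
by rewrite lF lF' e // IH.
Qed.

Lemma malgUZ (K : choiceType) (c : k) (i : K) :
  << c *g i >> = c *: << i >> :> {malg k[K]}.
Proof. by apply/malgP => j; rewrite mcoeffZ !mcoeffU mulr_natr. Qed.

Lemma malg_lspan (K : choiceType) (x : {malg k[K]}) :
  lspan (fun y => exists i, y = << i >>) x.
Proof.
rewrite [x]monalgE; elim/big_ind: _ => [|u v|i _]; first exact: lspan0.
  exact: lspanD.
by rewrite malgUZ; apply/lspanZ/lspan_gen; exists i.
Qed.

Lemma malg_eq (K : choiceType) W (F F' : {malg k[K]} -> W) :
  linear F -> linear F' -> (forall i, F << i >> = F' << i >>) -> F =1 F'.
Proof.
move=> lF lF' e x; apply: (lspan_eq lF lF' _ (malg_lspan x)) => _ [i ->].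
exact: e.
Qed.

Lemma mcoeff_linear (K : choiceType) (i : K) :
  linear (fun x : {malg k[K]} => x@_i : k^o).
Proof. by move=> c x y; rewrite mcoeffD mcoeffZ. Qed.

Fact tens_key : unit. Proof. exact: tt. Qed.

(** Pure tensors, sealed: when two of them are compared, the quotient which
    defines the tensor product must not be unfolded. *)
Definition spure A B : A -> B -> tens A B := locked_with tens_key (@pure k A B).

Lemma spureE A B (a : A) (b : B) : spure a b = a ⊗ b.
Proof. by rewrite /spure locked_withE. Qed.

Local Notation "a ⊠ b" := (spure a b) (at level 40, left associativity).

Lemma tens_eq A B W (F F' : tens A B -> W) :
  linear F -> linear F' -> (forall a b, F (a ⊠ b) = F' (a ⊠ b)) -> F =1 F'.
Proof.
move=> lF lF' e t; apply: (lspan_eq lF lF' _ (tens_lspan t)) => _ [a [b ->]].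
by rewrite -spureE.
Qed.

Lemma linear_id U : linear (@id U). Proof. by []. Qed.

Lemma linear_comp U W (X : lmodType k) (F : W -> X) (F' : U -> W) :
  linear F -> linear F' -> linear (fun x => F (F' x)).
Proof. by move=> lF lF' c x y; rewrite lF' lF. Qed.

Lemma linear_add U W (F F' : U -> W) :
  linear F -> linear F' -> linear (fun x => F x + F' x).
Proof. by move=> lF lF' c x y; rewrite lF lF' scalerDr addrACA. Qed.

Lemma linear_scale U W (F : U -> W) a :
  linear F -> linear (fun x => a *: F x).
Proof. by move=> lF c x y; rewrite lF scalerDr !scalerA mulrC. Qed.

Lemma linear_opp U W (F : U -> W) : linear F -> linear (fun x => - F x).
Proof. by move=> lF c x y; rewrite lF opprD scalerN. Qed.

Lemma linear_sub U W (F F' : U -> W) :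
  linear F -> linear F' -> linear (fun x => F x - F' x).
Proof. by move=> lF lF'; apply/linear_add/linear_opp. Qed.

Lemma linear_scaler U W (F : U -> k^o) (w : W) :
  linear F -> linear (fun x => (F x : k) *: w).
Proof. by move=> lF c x y; rewrite lF scalerDl scalerA. Qed.

Lemma linear_malg_ext (K : choiceType) W (phi : K -> W) :
  linear (malg_ext phi).
Proof. exact: malg_ext_is_linear. Qed.

Lemma linear_struct U W (F : {linear U -> W}) : linear F.
Proof. exact: linearP. Qed.

Lemma linear_puref A B U (F : U -> A) (b : B) :
  linear F -> linear (fun x => F x ⊗ b).
Proof. by move=> lF c x y; rewrite lF (pure_bilinear A B).1. Qed.

Lemma linear_purer A B U (F : U -> B) (a : A) :
  linear F -> linear (fun x => a ⊗ F x).
Proof. by move=> lF c x y; rewrite lF (pure_bilinear A B).2. Qed.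

Lemma spureDl A B (a a' : A) (b : B) : (a + a') ⊠ b = a ⊠ b + a' ⊠ b.
Proof. rewrite /spure locked_withE; exact: (linD ((pure_bilinear A B).1 b)). Qed.
Lemma spureDr A B (a : A) (b b' : B) : a ⊠ (b + b') = a ⊠ b + a ⊠ b'.
Proof. rewrite /spure locked_withE; exact: (linD ((pure_bilinear A B).2 a)). Qed.
Lemma spureZl A B c (a : A) (b : B) : (c *: a) ⊠ b = c *: (a ⊠ b).
Proof. rewrite /spure locked_withE; exact: (linZ ((pure_bilinear A B).1 b)). Qed.
Lemma spureZr A B c (a : A) (b : B) : a ⊠ (c *: b) = c *: (a ⊠ b).
Proof. rewrite /spure locked_withE; exact: (linZ ((pure_bilinear A B).2 a)). Qed.
Lemma spureNl A B (a : A) (b : B) : (- a) ⊠ b = - (a ⊠ b).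
Proof. rewrite /spure locked_withE; exact: (linN ((pure_bilinear A B).1 b)). Qed.
Lemma spureNr A B (a : A) (b : B) : a ⊠ (- b) = - (a ⊠ b).
Proof. rewrite /spure locked_withE; exact: (linN ((pure_bilinear A B).2 a)). Qed.
(** A lift is a finite sum of values of the lifted map at a representative
    which does not depend on the parameter, hence as linear in the parameter
    as these values are. *)
Lemma linear_tlift_param A B U W (phi : U -> A -> B -> W) (t : tens A B) :
  (forall a b, linear (fun u => phi u a b)) ->
  linear (fun u => tlift (phi u) t).
Proof.
move=> lphi c u u'; rewrite /tlift /malg_ext scaler_sumr -big_split /=.
by apply: eq_bigr => p _; rewrite lphi scalerDr !scalerA mulrC.
Qed.

End LinearToolkit.

Notation "a ⊠ b" := (spure a b) (at level 40, left associativity) : ring_scope.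

Lemma tliftE' (k : fieldType) (A B W : lmodType k) (phi : A -> B -> W) a b :
  bilinear_fun phi -> tlift phi (a ⊠ b) = phi a b.
Proof. by move=> bphi; rewrite spureE tliftE. Qed.

Section TensorAlgebraProduct.
Variables (k : fieldType) (A B : algType k).
Implicit Types s t u : tens A B.

Lemma mull_linear (R : algType k) (a : R) : linear (fun x : R => a * x).
Proof. by move=> c x y; rewrite mulrDr scalerAr. Qed.
Lemma mulr_linear (R : algType k) (a : R) : linear (fun x : R => x * a).
Proof. by move=> c x y; rewrite mulrDl scalerAl. Qed.

Lemma tmul_bilin_pure (a : A) (b : B) :
  bilinear_fun (fun c d => (a * c) ⊗ (b * d)).
Proof.
split=> [d|c].
  by apply: (linear_puref (F := fun c => a * c)); exact: mull_linear.
by apply: (linear_purer (F := fun d => b * d)); exact: mull_linear.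
Qed.

Lemma tmul_bilin t : bilinear_fun
  (fun (a : A) (b : B) => tlift (fun c d => (a * c) ⊗ (b * d)) t).
Proof.
split=> [b|a]; apply: linear_tlift_param => c d.
  by apply: (linear_puref (F := fun a => a * c)); exact: mulr_linear.
by apply: (linear_purer (F := fun b => b * d)); exact: mulr_linear.
Qed.

(** The product of the tensor product algebra, sealed like pure tensors. *)
Definition tprod : tens A B -> tens A B -> tens A B :=
  locked_with tens_key (@tmul k A B).

Lemma tprodE s t : tprod s t = tmul s t.
Proof. by rewrite /tprod locked_withE. Qed.

Lemma tprod_pure a b c d : tprod (a ⊠ b) (c ⊠ d) = (a * c) ⊠ (b * d).
Proof.
rewrite tprodE !spureE /tmul (tliftE (tmul_bilin _)).
by rewrite (tliftE (tmul_bilin_pure _ _)).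
Qed.

Lemma tprod_linearl t : linear (tprod^~ t).
Proof. by rewrite /tprod locked_withE; exact/tlift_linear/tmul_bilin. Qed.

Lemma tprod_linearr s : linear (tprod s).
Proof.
rewrite /tprod locked_withE.
by apply: linear_tlift_param => a b; apply/tlift_linear/tmul_bilin_pure.
Qed.

Lemma tprodA : associative tprod.
Proof.
move=> s t u; pattern s.
suff: (fun s => tprod s (tprod t u)) =1 (fun s => tprod (tprod s t) u) by apply.
apply: tens_eq => [||a b]; first exact: tprod_linearl.
  exact: linear_comp (tprod_linearl _) (tprod_linearl _).
pattern t; suff: (fun t => tprod (a ⊠ b) (tprod t u)) =1
  (fun t => tprod (tprod (a ⊠ b) t) u) by apply.
apply: tens_eq => [||a' b'].
- exact: linear_comp (tprod_linearr _) (tprod_linearl _).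
- exact: linear_comp (tprod_linearl _) (tprod_linearr _).
pattern u; suff: (fun u => tprod (a ⊠ b) (tprod (a' ⊠ b') u)) =1
  (fun u => tprod (tprod (a ⊠ b) (a' ⊠ b')) u) by apply.
apply: tens_eq => [||c d]; last by rewrite !tprod_pure !mulrA.
  exact: linear_comp (tprod_linearr _) (tprod_linearr _).
exact: tprod_linearr.
Qed.

Lemma tprod1 : left_id (1 ⊠ 1) tprod.
Proof.
apply: tens_eq => [||c d]; [exact: tprod_linearr|exact: linear_id|].
by rewrite tprod_pure !mul1r.
Qed.

Lemma tprodr1 : right_id (1 ⊠ 1) tprod.
Proof.
apply: tens_eq => [||c d]; [exact: tprod_linearl|exact: linear_id|].
by rewrite tprod_pure !mulr1.
Qed.

Lemma tprodDl : left_distributive tprod +%R.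
Proof. by move=> s t u; rewrite (linD (tprod_linearl u)). Qed.
Lemma tprodDr : right_distributive tprod +%R.
Proof. by move=> s t u; rewrite (linD (tprod_linearr s)). Qed.

End TensorAlgebraProduct.

(** * Coordinates in a free braided double *)

Section TensorAlgebraWords.
Variables (k : fieldType) (W : vectType k).
Local Notation b := (vbasis {:W}).

Definition tcons (a : 'I_(\dim {:W})) (u : talg W) : talg W :=
  malg_ext (fun m : {fmonom 'I_(\dim {:W})} =>
    << FMonom (a :: fmonom_val m) >> : talg W) u.

Definition tvmul (w : W) (u : talg W) : talg W :=
  \sum_a coord b a w *: tcons a u.

Fixpoint tword (ws : seq W) : talg W :=
  if ws is w :: ws' then tvmul w (tword ws') else << FMonom [::] >>.

Lemma tcons_linear a : linear (tcons a).
Proof. exact: linear_malg_ext. Qed.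

Lemma tconsE a m : tcons a << FMonom m >> = << FMonom (a :: m) >>.
Proof. by rewrite /tcons malg_extU. Qed.

Lemma tvmul_basis a u : tvmul (tnth b a) u = tcons a u.
Proof.
rewrite /tvmul (bigD1 a) //= (tnth_nth 0) coord_free ?eqxx; last first.
  exact: basis_free (vbasisP _).
rewrite scale1r big1 ?addr0 // => i /negPf nia.
rewrite coord_free; last exact: basis_free (vbasisP _).
by rewrite eq_sym nia scale0r.
Qed.

Lemma tvmul_linearl u : linear (tvmul^~ u).
Proof.
move=> c x y; rewrite /tvmul scaler_sumr -big_split /=; apply: eq_bigr => i _.
by rewrite linearP scalerDl scalerA.
Qed.

Lemma linear_bigsum (U X : lmodType k) (I : Type) (r : seq I) (F : I -> U -> X) :
  (forall i, linear (F i)) -> linear (fun x => \sum_(i <- r) F i x).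
Proof.
move=> lF c x y; rewrite scaler_sumr -big_split /=.
by apply: eq_bigr => i _; rewrite lF.
Qed.

Lemma talg_ext_linear (A : algType k) (j : W -> A) : linear (talg_ext j).
Proof. exact: linear_malg_ext. Qed.

Lemma talg_ext_tvmul (A : algType k) (j : {linear W -> A}) w u :
  talg_ext j (tvmul w u) = j w * talg_ext j u.
Proof.
have cE a u' : talg_ext j (tcons a u') = j (tnth b a) * talg_ext j u'.
  pattern u'; suff: (fun u => talg_ext j (tcons a u)) =1
    (fun u => j (tnth b a) * talg_ext j u) by apply.
  apply: malg_eq => [||[m]].
  - exact: linear_comp (talg_ext_linear _) (tcons_linear _).
  - exact: linear_comp (mull_linear _) (talg_ext_linear _).
  by rewrite tconsE /talg_ext !malg_extU /= big_cons.
pattern w; suff: (fun w => talg_ext j (tvmul w u)) =1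
  (fun w => j w * talg_ext j u) by apply.
move=> {}w; rewrite {2}(coord_basis (vbasisP _) (memvf w)) raddf_sum mulr_suml.
rewrite /tvmul.
rewrite (big_morph _ (linD (talg_ext_linear j)) (lin0 (talg_ext_linear j))).
apply: eq_bigr => a _; rewrite (linZ (talg_ext_linear j)) cE.
rewrite [X in _ = X * _](linZ (linear_struct j)).
by rewrite -scalerAl (tnth_nth 0).
Qed.

Lemma talg_ext_tword (A : algType k) (j : {linear W -> A}) ws :
  talg_ext j (tword ws) = \prod_(w <- ws) j w.
Proof.
elim: ws => [|w ws IH] /=; last by rewrite talg_ext_tvmul IH big_cons.
by rewrite /talg_ext malg_extU big_nil /= big_nil.
Qed.

Section Basis.
Variables (n : nat) (e : n.-tuple W).
Hypothesis be : basis_of {:W} e.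

Definition eword (m : seq 'I_n) : talg W := tword [seq tnth e i | i <- m].

(** The tensor algebra is built on the words in one chosen basis; expanding
    the letters of such a word one at a time expresses it through the words
    in e. *)
Lemma eword_span (u : talg W) : lspan (fun x => exists m, x = eword m) u.
Proof.
elim: (malg_lspan u) => [|c _ x [[s] ->] _ IH]; first exact: lspan0.
apply/lspanD/IH/lspanZ => {c x IH}.
elim: s => [|a s IH]; first by apply: lspan_gen; exists [::].
rewrite -tconsE; apply: lspan_image IH; first exact: tcons_linear.
move=> _ [m ->]; rewrite -tvmul_basis.
rewrite [tnth b a](coord_basis be (memvf _)).
rewrite (big_morph _ (linD (tvmul_linearl _)) (lin0 (tvmul_linearl _))).
elim/big_ind: _ => [|x y|i _]; [exact: lspan0|exact: lspanD|].
rewrite (linZ (tvmul_linearl _)); apply/lspanZ/lspan_gen; exists (i :: m).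
by rewrite /eword /= (tnth_nth 0).
Qed.

Definition mcons (i : 'I_n) (x : {malg k[seq 'I_n]}) : {malg k[seq 'I_n]} :=
  malg_ext (fun m => << i :: m >> : {malg k[seq 'I_n]}) x.

(** Coordinates with respect to the words in e, for a word s in the chosen
    basis. *)
Fixpoint wcoord (s : seq 'I_(\dim {:W})) : {malg k[seq 'I_n]} :=
  if s is a :: s' then \sum_i coord e i (tnth b a) *: mcons i (wcoord s')
  else << [::] >>.

Definition to_words (u : talg W) : {malg k[seq 'I_n]} :=
  malg_ext (fun m : {fmonom 'I_(\dim {:W})} => wcoord (fmonom_val m)) u.

Lemma to_words_linear : linear to_words.
Proof. exact: linear_malg_ext. Qed.

Lemma mcons_linear i : linear (mcons i).
Proof. exact: linear_malg_ext. Qed.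

Lemma to_words_tvmul w u :
  to_words (tvmul w u) = \sum_i coord e i w *: mcons i (to_words u).
Proof.
have cE a u' : to_words (tcons a u') =
    \sum_i coord e i (tnth b a) *: mcons i (to_words u').
  pattern u'; suff: (fun u => to_words (tcons a u)) =1
    (fun u => \sum_i coord e i (tnth b a) *: mcons i (to_words u)) by apply.
  apply: malg_eq => [||[m]].
  - exact: linear_comp to_words_linear (tcons_linear _).
  - apply: linear_bigsum => i; apply: linear_scale.
    exact: linear_comp (mcons_linear _) to_words_linear.
  by rewrite tconsE /to_words !malg_extU.
rewrite /tvmul (big_morph _ (linD to_words_linear) (lin0 to_words_linear)).
under eq_bigr do rewrite (linZ to_words_linear) cE scaler_sumr.
rewrite exchange_big /=; apply: eq_bigr => i _.
rewrite [in RHS](coord_basis (vbasisP _) (memvf w)) [X in _ = X *: _]raddf_sum scaler_suml.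
apply: eq_bigr => a _; rewrite scalerA [X in _ = X *: _]linearZ; congr (_ *: _).
by rewrite (tnth_nth 0).
Qed.

Lemma to_words_eword m : to_words (eword m) = << m >>.
Proof.
elim: m => [|i m IH]; first by rewrite /to_words malg_extU.
rewrite /eword /= to_words_tvmul -/(eword m) IH (bigD1 i) //= (tnth_nth 0).
rewrite coord_free ?eqxx ?(basis_free be) // scale1r /mcons malg_extU.
rewrite big1 ?addr0 // => j /negPf nji.
by rewrite coord_free ?(basis_free be) // eq_sym nji scale0r.
Qed.

End Basis.
End TensorAlgebraWords.

Section FreeCoordinates.
Variables (k : fieldType) (G : groupType) (V : vectType k) (n : nat).
Variables (v : n.-tuple V) (f : n.-tuple (dual V)).
Hypotheses (bv : basis_of {:V} v) (bf : basis_of {:dual V} f).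
Local Notation T :=
  (tens (tens (talg V) (grpalg k G)) (talg (dual V))).

Definition tri_coef (m1 : seq 'I_n) (g : G) (m2 : seq 'I_n) : T -> k^o :=
  tlift (fun s w => ((to_words f w)@_m2 : k) *:
    tlift (fun u (h : grpalg k G) =>
      ((to_words v u)@_m1 : k) *: (h@_g : k^o)) s).

Lemma tri_coef_bilin1 m g : bilinear_fun (fun u (h : grpalg k G) =>
  ((to_words v u)@_m : k) *: (h@_g : k^o)).
Proof.
split=> [h|u].
  apply: (@linear_scaler _ _ _ (fun u => (to_words v u)@_m : k^o)).
  exact: linear_comp (mcoeff_linear _) (to_words_linear _).
by apply: linear_scale; exact: mcoeff_linear.
Qed.

Lemma tri_coef_bilin2 m1 g m2 : bilinear_fun
  (fun (s : tens (talg V) (grpalg k G)) w => ((to_words f w)@_m2 : k) *: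
    tlift (fun u (h : grpalg k G) =>
      ((to_words v u)@_m1 : k) *: (h@_g : k^o)) s).
Proof.
split=> [w|s].
  by apply: linear_scale; apply/tlift_linear/tri_coef_bilin1.
apply: (@linear_scaler _ _ _ (fun u => (to_words f u)@_m2 : k^o)).
exact: linear_comp (mcoeff_linear _) (to_words_linear _).
Qed.

Lemma tri_coef_linear m1 g m2 : linear (tri_coef m1 g m2).
Proof. exact/tlift_linear/tri_coef_bilin2. Qed.

Lemma tri_coefE m1 g m2 m1' g' m2' :
  tri_coef m1 g m2 (eword v m1' ⊗ gelt k g' ⊗ eword f m2') =
  [&& m1' == m1, g' == g & m2' == m2]%:R.
Proof.
rewrite /tri_coef (tliftE (tri_coef_bilin2 _ _ _)) (tliftE (tri_coef_bilin1 _ _)).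
rewrite !to_words_eword // !mcoeffU.
by do 3!case: eqP => _; rewrite ?scale1r ?scale0r ?scaler0.
Qed.

Variables (A : algType k) (iV : {linear V -> A}).
Variables (iH : {lrmorphism grpalg k G -> A}) (iF : {linear dual V -> A}).

Definition mono (m1 : seq 'I_n) (g : G) (m2 : seq 'I_n) : A :=
  \prod_(i <- m1) iV (tnth v i) * iH (gelt k g) * \prod_(i <- m2) iF (tnth f i).

Lemma triangular_bilin1 : bilinear_fun (fun u h => talg_ext iV u * iH h).
Proof.
split=> [h|u]; first exact: linear_comp (mulr_linear _) (talg_ext_linear _).
by apply: linear_comp (mull_linear _) _ => c x y; rewrite linearP.
Qed.

Lemma triangular_bilin2 : bilinear_fun
  (fun s w => tlift (fun u h => talg_ext iV u * iH h) s * talg_ext iF w).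
Proof.
split=> [w|s].
  exact: linear_comp (mulr_linear _) (tlift_linear triangular_bilin1).
exact: linear_comp (mull_linear _) (talg_ext_linear _).
Qed.

Lemma triangular_mul_linear : linear (triangular_mul iV iH iF).
Proof. exact/tlift_linear/triangular_bilin2. Qed.

Lemma triangular_mulE u h w :
  triangular_mul iV iH iF (u ⊗ h ⊗ w) = talg_ext iV u * iH h * talg_ext iF w.
Proof.
by rewrite /triangular_mul (tliftE triangular_bilin2) (tliftE triangular_bilin1).
Qed.

Lemma triangular_mul_eword m1 g m2 :
  triangular_mul iV iH iF (eword v m1 ⊗ gelt k g ⊗ eword f m2) = mono m1 g m2.
Proof. by rewrite triangular_mulE !talg_ext_tword !big_map. Qed.

Lemma triangular_span (t : T) : lspan (fun x => exists m1 g m2,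
  x = eword v m1 ⊗ gelt k g ⊗ eword f m2) t.
Proof.
apply: lspan_mono (tens_lspan t) => _ [s [w ->]].
apply: (lspan_image (F := fun w => s ⊗ w) _ _ (eword_span bf w)).
  exact: (@linear_purer k _ _ _ id s (@linear_id _ _)).
move=> _ [m2 ->].
apply: (lspan_image (F := fun s => s ⊗ eword f m2) _ _ (tens_lspan s)).
  exact: (@linear_puref k _ _ _ id _ (@linear_id _ _)).
move=> _ [u [h ->]].
apply: (lspan_image (F := fun u => u ⊗ h ⊗ eword f m2) _ _ (eword_span bv u)).
  apply: (@linear_puref k _ _ _ (fun u => u ⊗ h)).
  exact: (@linear_puref k _ _ _ id _ (@linear_id _ _)).
move=> _ [m1 ->].
apply: (lspan_image (F := fun h => eword v m1 ⊗ h ⊗ eword f m2) _ _ (grp_lspan h)).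
  apply: (@linear_puref k _ _ _ (fun h => eword v m1 ⊗ h)).
  exact: (@linear_purer k _ _ _ id _ (@linear_id _ _)).
by move=> _ [g ->]; apply: lspan_gen; exists m1, g, m2.
Qed.

(** Bijectivity of the multiplication makes the monomials v_m1 g f_m2 a basis
    of the double; it is used through the coordinate functionals. *)
Lemma free_coef m1 g m2 : bijective (triangular_mul iV iH iF) ->
  exists2 F : A -> k^o, linear F & forall m1' g' m2',
    F (mono m1' g' m2') = [&& m1' == m1, g' == g & m2' == m2]%:R.
Proof.
case=> T' TK KT; exists (fun x => tri_coef m1 g m2 (T' x)).
  apply: linear_comp (tri_coef_linear _ _ _) _ => c x y.
  by rewrite -{1}[x]KT -{1}[y]KT -triangular_mul_linear TK.
by move=> m1' g' m2'; rewrite -triangular_mul_eword TK tri_coefE.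
Qed.

End FreeCoordinates.

(** * The commutators of a given Hopf algebra *)

Section GeneratorFacts.
Variables (k : fieldType) (G : groupType) (V : vectType k).
Variables (act : G -> 'End(V)) (n : nat).
Variables (v : n.-tuple V) (f : n.-tuple (dual V)) (kk ll : 'I_n -> G).
Variables (p : G -> 'I_n -> 'I_n) (lam mu : 'I_n -> G -> k).
Hypothesis rep : is_rep act.
Hypothesis gd : generator_data act v f kk ll p lam mu.

Lemma tnth_basis_neq0 (W : vectType k) (e : n.-tuple W) i :
  basis_of {:W} e -> tnth e i != 0.
Proof.
by move=> /basis_free fe; exact: (free_not0 fe (mem_tnth i e)).
Qed.

Lemma act_mulV g x : act g^-1%g (act g x) = x.
Proof. by case: rep => a1 aM; rewrite -comp_lfunE -aM mulVg a1 id_lfunE. Qed.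

Lemma lam_neq0 g i : lam i g != 0.
Proof.
apply/eqP => l0; have := gd_act_v gd g i; rewrite l0 scale0r => ag0.
have := act_mulV g (tnth v i); rewrite ag0 linear0 => /esym/eqP.
by apply/negP/tnth_basis_neq0/(gd_basis_v gd).
Qed.

Lemma ractM (x : dual V) g h : ract act x (g * h)%g = ract act (ract act x g) h.
Proof. by case: rep => _ aM; rewrite /ract aM comp_lfunA. Qed.
Lemma ract1 (x : dual V) : ract act x 1%g = x.
Proof. by case: rep => a1 _; rewrite /ract a1 comp_lfun1r. Qed.

Lemma mu_neq0 g i : mu i g != 0.
Proof.
apply/eqP => m0; have := gd_act_f gd g i; rewrite m0 scale0r => ag0.
have := ract1 (tnth f i); rewrite -(mulgV g) ractM ag0 /ract comp_lfun0l.
move=> /esym/eqP; by apply/negP/tnth_basis_neq0/(gd_basis_f gd).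
Qed.

Lemma index_trivial : (forall i j, p (ll j) i = i) ->
  (forall i j, p (kk i) j = j) -> forall g i, p g i = i.
Proof.
move=> pl pk; apply: (gd_gen gd).
- exact: gd_perm1 gd.
- by move=> x y px py i; rewrite (gd_permM gd) py px.
- by move=> x px i; rewrite -{1}[i]px -(gd_permM gd) mulVg (gd_perm1 gd).
- by move=> _ [i [] ->] j.
Qed.

Lemma abelian_of_generators : (forall g i, commute g (kk i)) ->
  (forall g i, commute g (ll i)) -> forall g h : G, commute g h.
Proof.
move=> ck cl g h; move: h g; apply: (gd_gen gd).
- by move=> g; exact: commute1.
- by move=> x y cx cy g; apply: commuteM.
- by move=> x cx g; apply: commuteV.
- by move=> _ [i [] ->] g.
Qed.

(** Both characters describe how <f_i <| g, v_j> = <f_i, g |> v_j> depends on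
    g, once the indices are fixed. *)
Lemma pairing_char (ptriv : forall g i, p g i = i) i j g :
  tnth f i (tnth v j) != 0 -> mu i g = lam j g.
Proof.
move=> fv0; have := gd_act_f gd g i; rewrite ptriv.
move=> /(congr1 (fun h : dual V => h (tnth v j))).
rewrite /ract comp_lfunE (gd_act_v gd) ptriv linearZ scale_lfunE /=.
by move/esym/mulIf; apply.
Qed.

Lemma mu_lam (ptriv : forall g i, p g i = i) i g : mu i g = lam i g.
Proof. exact: pairing_char (gd_paired gd i). Qed.

End GeneratorFacts.

Section TensorFunctional.
Variables (k : fieldType) (A B : lmodType k) (F1 : A -> k^o) (F2 : B -> k^o).
Hypotheses (lF1 : linear F1) (lF2 : linear F2).

Definition tfun : tens A B -> k^o := tlift (fun a b => (F1 a : k) *: F2 b).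

Lemma tfun_bilin : bilinear_fun (fun a b => (F1 a : k) *: F2 b).
Proof. by split=> [b|a]; [exact: linear_scaler|exact: linear_scale]. Qed.

Lemma tfun_linear : linear tfun. Proof. exact/tlift_linear/tfun_bilin. Qed.
Lemma tfunE a b : tfun (a ⊠ b) = (F1 a : k) * F2 b.
Proof. by rewrite /tfun (tliftE' _ _ tfun_bilin). Qed.
End TensorFunctional.

Section Forward.
Variables (k : fieldType) (G : groupType) (V : vectType k).
Variables (act : G -> 'End(V)) (n : nat).
Variables (v : n.-tuple V) (f : n.-tuple (dual V)) (kk ll : 'I_n -> G).
Variables (p : G -> 'I_n -> 'I_n) (lam mu : 'I_n -> G -> k).
Variables (A : algType k) (beta : {linear tens (dual V) V -> grpalg k G}).
Variables (iV : {linear V -> A}) (iH : {lrmorphism grpalg k G -> A}).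
Variables (iF : {linear dual V -> A}).
Variables (Delta : {linear A -> tens A A}) (eps : {lrmorphism A -> k^o}).
Variable S : {linear A -> A}.
Hypothesis wh : ws_hopf_algebra act v f kk ll p lam mu beta iV iH iF Delta eps S.

Let gd := wh_gen wh.
Let free := th_free (wh_hopf wh).
Let rep : is_rep act. Proof. by case: free. Qed.
Let rels : double_relations act beta iV iH iF. Proof. by case: free => _ []. Qed.
Let bij : bijective (triangular_mul iV iH iF). Proof. by case: free. Qed.

Local Notation "'x_ i" := (iV (tnth v i)) (at level 8, i at level 2).
Local Notation "'y_ i" := (iF (tnth f i)) (at level 8, i at level 2).
Local Notation gr g := (iH (gelt k g)).

Lemma gr_mul g h : gr (g * h)%g = gr g * gr h.
Proof. by rewrite -grp_mul_gelt -rmorphM. Qed.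

Lemma gr_x g i : gr g * 'x_i = lam i g *: ('x_(p g i) * gr g).
Proof.
by rewrite (rel_hv rels) (gd_act_v gd) (linZ (linear_struct iV)) scalerAl.
Qed.

Lemma y_gr g i : 'y_i * gr g = mu i g *: (gr g * 'y_(p g i)).
Proof.
by rewrite (rel_fh rels) (gd_act_f gd) (linZ (linear_struct iF)) scalerAr.
Qed.

Lemma coord_x j g : exists F : A -> k^o, [/\ linear F,
  forall i h, F ('x_i * gr h) = ((i == j) && (h == g))%:R & forall h, F (iH h) = 0].
Proof.
have [F lF FE] := free_coef (gd_basis_v gd) (gd_basis_f gd) [:: j] g [::] bij.
exists F; split=> // [i h|h].
  have := FE [:: i] h [::]; rewrite /mono big_seq1 big_nil mulr1 => ->.
  by rewrite eqxx andbT eqseq_cons eqxx andbT.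
elim: (grp_lspan h) => [|c _ u [g' ->] _ IH]; first by rewrite linear0 (lin0 lF).
rewrite linearP lF IH addr0.
have := FE [::] g' [::]; rewrite /mono !big_nil mulr1 mul1r => ->.
exact: mulr0.
Qed.

Lemma coord_y j g : exists F : A -> k^o, [/\ linear F,
  forall i h, F (gr h * 'y_i) = ((i == j) && (h == g))%:R & forall h, F (iH h) = 0].
Proof.
have [F lF FE] := free_coef (gd_basis_v gd) (gd_basis_f gd) [::] g [:: j] bij.
exists F; split=> // [i h|h].
  have := FE [::] h [:: i]; rewrite /mono big_seq1 big_nil mul1r => ->.
  by rewrite eqxx /= eqseq_cons eqxx andbT andbC.
elim: (grp_lspan h) => [|c _ u [g' ->] _ IH]; first by rewrite linear0 (lin0 lF).
rewrite linearP lF IH addr0.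
have := FE [::] g' [::]; rewrite /mono !big_nil mulr1 mul1r => ->.
by rewrite andbF; exact: mulr0.
Qed.

Lemma coord_gr g : exists F : A -> k^o, [/\ linear F,
  forall h, F (iH h) = h@_g, forall i h, F ('x_i * gr h) = 0 &
  forall i h, F (gr h * 'y_i) = 0].
Proof.
have [F lF FE] := free_coef (gd_basis_v gd) (gd_basis_f gd) [::] g [::] bij.
exists F; split=> // [h|i h|i h].
- elim: (grp_lspan h) => [|c _ u [g' ->] _ IH].
    by rewrite linear0 (lin0 lF) mcoeff0.
  rewrite linearP lF IH mcoeffD mcoeffZ.
  have := FE [::] g' [::]; rewrite /mono !big_nil mulr1 mul1r => ->.
  by rewrite andbT mcoeffU.
- by have := FE [:: i] h [::]; rewrite /mono big_seq1 big_nil mulr1 => ->.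
- have := FE [::] h [:: i]; rewrite /mono big_seq1 big_nil mul1r => ->.
  by rewrite andbF.
Qed.

Lemma DeltaM x y : Delta (x * y) = tprod (Delta x) (Delta y).
Proof. by rewrite (comult_mul (th_hopf (wh_hopf wh))) tprodE. Qed.

Lemma Delta_gr g : Delta (gr g) = gr g ⊠ gr g.
Proof. by rewrite (th_H (wh_hopf wh)) spureE. Qed.

Lemma Delta_x i : Delta 'x_i = 'x_i ⊠ gr (kk i) + 1 ⊠ 'x_i.
Proof. by rewrite (wh_comult_v wh) !spureE. Qed.

Lemma Delta_y i : Delta 'y_i = 'y_i ⊠ 1 + gr (ll i) ⊠ 'y_i.
Proof. by rewrite (wh_comult_f wh) !spureE. Qed.

Lemma Delta_commutator i j :
  let b := iH (beta (tnth f i ⊗ tnth v j)) in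
  Delta b = b ⊠ gr (kk j) + gr (ll i) ⊠ b +
    ((gr (ll i) * 'x_j) ⊠ ('y_i * gr (kk j)) -
     ('x_j * gr (ll i)) ⊠ (gr (kk j) * 'y_i)).
Proof.
move=> b; have bE : 'y_i * 'x_j - 'x_j * 'y_i = b := rel_fv rels _ _.
rewrite -{1}bE raddfB /= !DeltaM Delta_x Delta_y.
rewrite !tprodDl !tprodDr !tprod_pure !mul1r !mulr1.
have -> : 'y_i * 'x_j = b + 'x_j * 'y_i by rewrite -bE subrK.
rewrite spureDl spureDr.
set t1 := b ⊠ _; set t2 := gr _ ⊠ b; set t3 := _ ⊠ gr _; set t4 := gr _ ⊠ _.
set t5 := _ ⊠ 'x_j; set t6 := (gr _ * _) ⊠ _; set t7 := _ ⊠ (gr _ * _).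
rewrite !opprD !addrA.
rewrite (ACl (1 * 5 * 4 * 8 * (2 * 7) * (3 * 9) * (6 * 10))) /=.
by rewrite !subrr !addr0.
Qed.

Lemma tfun_Delta_iH (F1 F2 : A -> k^o) h : linear F1 -> linear F2 ->
  (forall h, F1 (iH h) = 0) -> tfun F1 F2 (Delta (iH h)) = 0.
Proof.
move=> lF1 lF2 F10; elim: (grp_lspan h) => [|c _ u [g ->] _ IH].
  by rewrite !linear0 (lin0 (tfun_linear lF1 lF2)).
rewrite !linearP (tfun_linear lF1 lF2) IH Delta_gr.
by rewrite tfunE // F10 mul0r scaler0 addr0.
Qed.

(** The part of Delta [f_i, v_j] outside H (x) H is
    l_i v_j (x) f_i k_j - v_j l_i (x) k_j f_i; it has to vanish, and comparing
    the monomials shows that l_i fixes the index j and k_j the index i. *)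
Lemma index_fixed i j : p (ll i) j = j /\ p (kk j) i = i.
Proof.
have [F1 [lF1 F1x F1H]] := coord_x j (ll i).
have [F2 [lF2 F2y F2H]] := coord_y i (kk j).
have := tfun_Delta_iH (beta (tnth f i ⊗ tnth v j)) lF1 lF2 F1H.
rewrite Delta_commutator (linD (tfun_linear lF1 lF2)).
rewrite (linB (tfun_linear lF1 lF2)) (linD (tfun_linear lF1 lF2)).
rewrite !tfunE // !F1H !mul0r !add0r gr_x y_gr.
rewrite (linZ lF1) (linZ lF2) !F1x !F2y !eqxx mulr1 !andbT.
move=> /eqP; rewrite subr_eq0 => /eqP.
case: eqP => [->|_]; last first.
  by rewrite scaler0 mul0r => /esym/eqP; rewrite oner_eq0.
case: eqP => [->|_] //.
by rewrite scaler0 mulr0 => /esym/eqP; rewrite oner_eq0.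
Qed.

Lemma index_triv g i : p g i = i.
Proof.
by apply: (index_trivial gd) => i' j; [case: (index_fixed j i')|case: (index_fixed j i')].
Qed.

(** The components in V (x) H of Delta (g v_j) = lambda_j(g) Delta (v_j g)
    are multiples of v_j g (x) g k_j and of v_j g (x) k_j g. *)
Lemma kk_central g j : commute g (kk j).
Proof.
have [F1 [lF1 F1x F1H]] := coord_x j g.
have [F2 [lF2 F2g _ _]] := coord_gr (g * kk j)%g.
have := congr1 (fun z => tfun F1 F2 (Delta z)) (gr_x g j).
rewrite /= index_triv (linZ (linear_struct Delta)) !DeltaM Delta_x.
rewrite Delta_gr tprodDr tprodDl !tprod_pure mul1r mulr1 gr_x index_triv -!gr_mul.
rewrite (linZ (tfun_linear lF1 lF2)) !(linD (tfun_linear lF1 lF2)) !tfunE //.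
rewrite (linZ lF1) !F1x !F1H !F2g !mul0r !addr0 !eqxx !mcoeffU eqxx mul1r.
rewrite [X in X * _]mulr1 mulr1 => /esym/eqP.
rewrite -[X in _ == X]mulr1 => /eqP/(mulfI (lam_neq0 rep gd g j)).
by case: eqP => // _ /esym/eqP; rewrite oner_eq0.
Qed.

Lemma ll_central g i : commute g (ll i).
Proof.
have [F1 [lF1 F1g _ _]] := coord_gr (ll i * g)%g.
have [F2 [lF2 F2y F2H]] := coord_y i g.
have := congr1 (fun z => tfun F1 F2 (Delta z)) (y_gr g i).
rewrite /= index_triv (linZ (linear_struct Delta)) !DeltaM Delta_y.
rewrite Delta_gr tprodDr tprodDl !tprod_pure mul1r mulr1 y_gr index_triv -!gr_mul.
rewrite (linZ (tfun_linear lF1 lF2)) !(linD (tfun_linear lF1 lF2)) !tfunE //.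
rewrite (linZ lF2) !F2y !F2H !F1g !mulr0 !add0r !eqxx !mcoeffU eqxx mul1r.
rewrite [X in X = _]mulr1 mulr1 => /esym/eqP.
rewrite -[X in _ == X]mulr1 => /eqP/(mulfI (mu_neq0 rep gd g i)).
by case: eqP => // _ /esym/eqP; rewrite oner_eq0.
Qed.

Lemma G_abelian (g h : G) : commute g h.
Proof. exact: (abelian_of_generators gd kk_central ll_central). Qed.

(** What is left of Delta [f_i, v_j] makes [f_i, v_j] a skew primitive element
    of kG, hence a multiple of k_j - l_i. *)
Lemma commutator_skew i j : exists c : k, (kk j = ll i -> c = 0) /\
  beta (tnth f i ⊗ tnth v j) = c *: (gelt k (kk j) - gelt k (ll i)).
Proof.
set b := beta _.
have bE g h : b@_g * (g == h)%:R = b@_g * (kk j == h)%:R + (ll i == g)%:R * b@_h.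
  have [F1 [lF1 F1g F1x F1y]] := coord_gr g.
  have [F2 [lF2 F2g F2x F2y]] := coord_gr h.
  have -> : b@_g * (g == h)%:R = tfun F1 F2 (Delta (iH b)).
    elim: (grp_lspan b) => [|c _ u [x ->] _ IH].
      by rewrite mcoeff0 mul0r !linear0 (lin0 (tfun_linear lF1 lF2)).
    rewrite !linearP (tfun_linear lF1 lF2) -IH Delta_gr tfunE //.
    rewrite F1g F2g mcoeffD mcoeffZ mulrDl !mcoeffU; congr (_ + _).
    rewrite -mulrA; congr (_ * _); case: (x =P g) => [->//|_].
    by rewrite !mul0r.
  rewrite Delta_commutator !(linD (tfun_linear lF1 lF2)) (linN (tfun_linear lF1 lF2)).
  rewrite !tfunE // gr_x (linZ lF1) !F1x [_ *: 0]mulr0 !mul0r subrr addr0.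
  by rewrite !F1g !F2g !mcoeffU.
(* If k_j = l_i then the commutator is 0 whatever the scalar is; the value 0
   is the one compatible with unequal characters. *)
exists (if kk j == ll i then 0 else b@_(kk j)); split=> [->|]; first by rewrite eqxx.
case: eqP => [e|/eqP ne]; apply/malgP => g.
  rewrite scale0r mcoeff0; have := bE g g; rewrite eqxx e mulr1.
  case: eqP => _; last by rewrite mulr0 mul0r addr0.
  by rewrite mulr1 mul1r -{1}[b@_g]addr0 => /addrI.
rewrite mcoeffZ mcoeffB !mcoeffU.
have := bE g g; rewrite eqxx mulr1.
case: (kk j =P g) => [<-|nk].
  by rewrite [ll i == _]eq_sym (negPf ne) subr0 mulr1.
case: (ll i =P g) => [<- _|nl ->]; last by rewrite mulr0 mul0r addr0 subrr mulr0.
have := bE (ll i) (kk j); rewrite !eqxx eq_sym (negPf ne) mulr0 mulr1 mul1r sub0r mulrN1.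
by move=> /eqP; rewrite eq_sym addr_eq0 => /eqP.
Qed.

(** Moving g past f_i and v_j multiplies [f_i, v_j] by mu_i(g) / lambda_j(g),
    that is by lambda_i(g) / lambda_j(g); but [f_i, v_j] lies in the abelian
    group algebra kG and commutes with g. *)
Lemma commutator_char i j c g :
  beta (tnth f i ⊗ tnth v j) = c *: (gelt k (kk j) - gelt k (ll i)) ->
  (kk j = ll i -> c = 0) -> c != 0 -> lam i g = lam j g.
Proof.
move=> bE c0 cn0; have nkl : kk j != ll i by apply: contraNneq cn0 => /c0 ->.
have ml : mu i g = lam i g := mu_lam gd index_triv i g.
have gx : gr g * 'x_j = lam j g *: ('x_j * gr g) by rewrite gr_x index_triv.
have yg : 'y_i * gr g = mu i g *: (gr g * 'y_i) by rewrite y_gr index_triv.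
have com : lam j g *: (iH (beta (tnth f i ⊗ tnth v j)) * gr g) =
           mu i g *: (gr g * iH (beta (tnth f i ⊗ tnth v j))).
  rewrite -(rel_fv rels) mulrBl mulrBr !scalerBr; congr (_ - _).
    by rewrite -mulrA scalerAr -gx mulrA yg -scalerAl mulrA.
  by rewrite -mulrA yg -scalerAr scalerA mulrC -scalerA mulrA scalerAl -gx !mulrA.
have [F [lF Fg _ _]] := coord_gr (kk j * g)%g.
have bH : iH (beta (tnth f i ⊗ tnth v j)) = c *: (gr (kk j) - gr (ll i)).
  by rewrite bE (linZ (linear_struct iH)) raddfB.
have := congr1 F com; rewrite bH -scalerAl -scalerAr mulrBl mulrBr -!gr_mul.
rewrite !(linZ lF) !(linB lF) !Fg !mcoeffU eqxx.
rewrite (G_abelian g (kk j)) eqxx (G_abelian g (ll i)).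
have -> : (ll i * g == kk j * g)%g = false.
  by apply/negbTE; apply: contraNneq nkl => /mulIg ->.
rewrite subr0 ml -[X in X = _]/(lam j g * (c * 1)) -[X in _ = X]/(lam i g * (c * 1)).
by rewrite mulr1 => /(mulIf cn0).
Qed.

Lemma forward_direction : exists gamma : 'M[k]_n,
  commutator_relations v f kk ll iV iH iF gamma /\
  (forall i j : 'I_n, ~ (lam i =1 lam j) ->
     gamma i j = 0 /\ tnth f i (tnth v j) = 0) /\
  (forall i j : 'I_n, ~ central (ll i) \/ ~ central (kk j) -> gamma i j = 0).
Proof.
have [c cP] := choice (fun ij : 'I_n * 'I_n => commutator_skew ij.1 ij.2).
exists (\matrix_(i, j) c (i, j)); split; [|split].
- move=> i j; rewrite mxE (rel_fv rels); have [_ ->] := cP (i, j).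
  by rewrite (linZ (linear_struct iH)) raddfB.
- move=> i j ne; rewrite mxE; split.
    apply: contra_notP ne => /eqP cn0 g; have [c0 bE] := cP (i, j).
    exact: commutator_char bE c0 cn0.
  apply: contra_notP ne => /eqP fv0 g.
  by rewrite -(mu_lam gd index_triv) (pairing_char gd index_triv g fv0).
- by move=> i j [] []; move=> g; apply/commute_sym/G_abelian.
Qed.

End Forward.

(** * The double as an algebra *)

(** The data of a double in which G fixes all indices. Since <f_i, v_i> is not
    zero, f_i then has the same character as v_i. *)
Record double_data (k : fieldType) (G : groupType) (n : nat) := DoubleData {
  dlam : 'I_n -> G -> k;
  dkk : 'I_n -> G;
  dll : 'I_n -> G;
  dgam : 'M[k]_n;
  dlam1 : forall i, dlam i 1%g = 1;
  dlamM : forall i g h, dlam i (g * h)%g = dlam i g * dlam i h;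
  dabel : forall g h : G, (g * h = h * g)%g;
  dchar : forall i j, dlam j (dkk i) * dlam i (dll j) = 1;
  dgamP : forall i j g, dgam i j * dlam i g = dgam i j * dlam j g
}.

Fact dbl_key : unit. Proof. exact: tt. Qed.

(** The free module on the monomials v_m1 g f_m2. Its operations are copies of
    those of finitely supported functions, sealed so that comparing two
    elements does not unfold them. *)
Definition dbl (k : fieldType) (G : groupType) (n : nat)
  (D : double_data k G n) := {malg k[(seq 'I_n * G * seq 'I_n)%type]}.
HB.instance Definition _ k G n D := Choice.on (@dbl k G n D).

Section DoubleModule.
Variables (k : fieldType) (G : groupType) (n : nat) (D : double_data k G n).
Local Notation M := {malg k[(seq 'I_n * G * seq 'I_n)%type]}.
Local Notation A := (dbl D).

Definition dadd : A -> A -> A := locked_with dbl_key (fun x y : M => x + y).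
Definition dzero : A := locked_with dbl_key (0 : M).
Definition dopp : A -> A := locked_with dbl_key (fun x : M => - x).
Definition dscale : k -> A -> A := locked_with dbl_key (fun c (x : M) => c *: x).

Lemma daddE : dadd = fun x y : M => x + y. Proof. exact: locked_withE. Qed.
Lemma dzeroE : dzero = (0 : M). Proof. exact: locked_withE. Qed.
Lemma doppE : dopp = fun x : M => - x. Proof. exact: locked_withE. Qed.
Lemma dscaleE : dscale = fun c (x : M) => c *: x. Proof. exact: locked_withE. Qed.

Lemma daddA : associative dadd. Proof. by rewrite daddE; exact: addrA. Qed.
Lemma daddC : commutative dadd. Proof. by rewrite daddE; exact: addrC. Qed.
Lemma dadd0 : left_id dzero dadd.
Proof. by rewrite daddE dzeroE; exact: add0r. Qed.
Lemma daddN : left_inverse dzero dopp dadd.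
Proof. by rewrite daddE dzeroE doppE; exact: addNr. Qed.
HB.instance Definition _ := GRing.isZmodule.Build A daddA daddC dadd0 daddN.

Lemma dscaleA a b (x : A) : dscale a (dscale b x) = dscale (a * b) x.
Proof. by rewrite dscaleE scalerA. Qed.
Lemma dscale1 : left_id 1 dscale.
Proof. by rewrite dscaleE; exact: scale1r. Qed.
Lemma dscaleDr : right_distributive dscale +%R.
Proof.
by move=> c x y; rewrite -[RHS]/(dadd _ _) -[x + y]/(dadd x y) daddE dscaleE scalerDr.
Qed.
Lemma dscaleDl (x : A) : {morph dscale^~ x : a b / a + b}.
Proof. by move=> a b; rewrite -[RHS]/(dadd _ _) daddE dscaleE scalerDl. Qed.
HB.instance Definition _ := GRing.Zmodule_isLmodule.Build k A
  dscaleA dscale1 dscaleDr dscaleDl.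

Definition dext (W : lmodType k) (phi : seq 'I_n -> G -> seq 'I_n -> W) :
  A -> W := malg_ext (fun m => phi m.1.1 m.1.2 m.2).

Definition bas : seq 'I_n -> G -> seq 'I_n -> A :=
  locked_with dbl_key (fun m1 g m2 => << (m1, g, m2) >>).

Lemma basU m1 g m2 : bas m1 g m2 = << (m1, g, m2) >> :> M.
Proof. by rewrite /bas locked_withE. Qed.

Lemma dext_linear (W : lmodType k) phi : linear (@dext W phi).
Proof.
move=> c x y; have -> : c *: x + y = ((c *: (x : M) + (y : M)) : A).
  by rewrite -[LHS]/(dadd (dscale c x) y) daddE dscaleE.
exact: (linear_malg_ext (fun m => phi m.1.1 m.1.2 m.2)).
Qed.

Lemma dextE (W : lmodType k) phi m1 g m2 :
  @dext W phi (bas m1 g m2) = phi m1 g m2.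
Proof. by rewrite /dext basU malg_extU. Qed.

Lemma dbl_lspan (x : A) : lspan (fun y => exists m1 g m2, y = bas m1 g m2) x.
Proof.
elim: (malg_lspan (x : M)) => [|c _ y [[[m1 g] m2] ->] _ IH].
  by rewrite -dzeroE; exact: lspan0.
have -> : (c *: << (m1, g, m2) >> + y)%R = c *: bas m1 g m2 + (y : A).
  by rewrite -[RHS]/(dadd (dscale c _) y) daddE dscaleE basU.
by apply: lspanZD IH; exists m1, g, m2.
Qed.

Lemma dbl_eq (W : lmodType k) (F F' : A -> W) : linear F -> linear F' ->
  (forall m1 g m2, F (bas m1 g m2) = F' (bas m1 g m2)) -> F =1 F'.
Proof.
move=> lF lF' e x; apply: (lspan_eq lF lF' _ (dbl_lspan x)).
by move=> _ [m1 [g [m2 ->]]]; exact: e.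
Qed.

End DoubleModule.
Arguments bas {k G n D}.

Section DoubleAlgebra.
Variables (k : fieldType) (G : groupType) (n : nat) (D : double_data k G n).
Local Notation lam := (dlam D).
Local Notation kk := (dkk D).
Local Notation ll := (dll D).
Local Notation gam := (dgam D).
Local Notation A := (dbl D).

(** Operators on W for v_i, g and f_j which satisfy the relations of the
    double. *)
Record is_action (W : lmodType k) (X : 'I_n -> W -> W) (K : G -> W -> W)
    (Y : 'I_n -> W -> W) : Prop := IsAction {
  actX_lin : forall i, linear (X i);
  actK_lin : forall g, linear (K g);
  actY_lin : forall i, linear (Y i);
  actKM : forall g h w, K (g * h)%g w = K g (K h w);
  actKX : forall g i w, K g (X i w) = lam i g *: X i (K g w);
  actYK : forall g i w, Y i (K g w) = lam i g *: K g (Y i w);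
  actYX : forall i j w, Y i (X j w) =
    X j (Y i w) + gam i j *: (K (kk j) w - K (ll i) w)
}.

Definition lamw (m : seq 'I_n) (g : G) : k := \prod_(i <- m) lam i g.

Definition opX : 'I_n -> A -> A := locked_with dbl_key
  (fun i => dext (fun m1 g m2 => bas (i :: m1) g m2)).

Definition opK : G -> A -> A := locked_with dbl_key
  (fun h => dext (fun m1 g m2 => lamw m1 h *: bas m1 (h * g)%g m2)).

(** Left multiplication of a monomial by f_j, with the monomial read from the
    left: f_j passes v_i at the cost of the commutator, and passes g at the
    cost of its character. *)
Fixpoint opYw (j : 'I_n) (m1 : seq 'I_n) (g : G) (m2 : seq 'I_n) : A :=
  if m1 is i :: m1' then
    opX i (opYw j m1' g m2) +
    gam j i *: (opK (kk i) (bas m1' g m2) - opK (ll j) (bas m1' g m2))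
  else lam j g *: bas [::] g (j :: m2).

Definition opY : 'I_n -> A -> A := locked_with dbl_key
  (fun j => dext (opYw j)).

Lemma opX_linear i : linear (opX i).
Proof. by rewrite /opX locked_withE; exact: dext_linear. Qed.
Lemma opK_linear g : linear (opK g).
Proof. by rewrite /opK locked_withE; exact: dext_linear. Qed.
Lemma opY_linear j : linear (opY j).
Proof. by rewrite /opY locked_withE; exact: dext_linear. Qed.

Lemma opXE i m1 g m2 : opX i (bas m1 g m2) = bas (i :: m1) g m2.
Proof. by rewrite /opX locked_withE dextE. Qed.
Lemma opKE h m1 g m2 : opK h (bas m1 g m2) = lamw m1 h *: bas m1 (h * g)%g m2.
Proof. by rewrite /opK locked_withE dextE. Qed.
Lemma opYE j m1 g m2 : opY j (bas m1 g m2) = opYw j m1 g m2.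
Proof. by rewrite /opY locked_withE dextE. Qed.

Lemma lamw_nil g : lamw [::] g = 1. Proof. by rewrite /lamw big_nil. Qed.
Lemma lamw_cons i m g : lamw (i :: m) g = lam i g * lamw m g.
Proof. by rewrite /lamw big_cons. Qed.
Lemma lamw1 m : lamw m 1%g = 1.
Proof. by rewrite /lamw big1 // => i _; rewrite dlam1. Qed.
Lemma lamwM m g h : lamw m (g * h)%g = lamw m g * lamw m h.
Proof. by rewrite /lamw -big_split; apply: eq_bigr => i _; rewrite dlamM. Qed.

Lemma opK1 w : opK 1%g w = w.
Proof.
move: w; apply: dbl_eq => [||m1 g m2]; [exact: opK_linear|exact: linear_id|].
by rewrite opKE lamw1 scale1r mul1g.
Qed.

Lemma opKM g h w : opK (g * h)%g w = opK g (opK h w).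
Proof.
move: w; apply: dbl_eq => [||m1 g' m2]; first exact: opK_linear.
  exact: linear_comp (opK_linear _) (opK_linear _).
by rewrite !opKE (linZ (opK_linear _)) opKE scalerA lamwM mulgA mulrC.
Qed.

Lemma opKX g i w : opK g (opX i w) = lam i g *: opX i (opK g w).
Proof.
move: w; apply: dbl_eq => [||m1 h m2].
- exact: linear_comp (opK_linear _) (opX_linear _).
- by apply: linear_scale; exact: linear_comp (opX_linear _) (opK_linear _).
by rewrite opXE !opKE (linZ (opX_linear _)) opXE lamw_cons scalerA.
Qed.

Lemma opYX i j w : opY i (opX j w) =
  opX j (opY i w) + gam i j *: (opK (kk j) w - opK (ll i) w).
Proof.
move: w; apply: dbl_eq => [||m1 h m2].
- exact: linear_comp (opY_linear _) (opX_linear _).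
- apply: linear_add; first exact: linear_comp (opX_linear _) (opY_linear _).
  by apply/linear_scale/linear_sub; exact: opK_linear.
by rewrite opXE !opYE.
Qed.

(** By induction along the word in the v_i; the terms from the commutators
    match because gamma_ij is zero unless lambda_i = lambda_j. *)
Lemma opYK g i w : opY i (opK g w) = lam i g *: opK g (opY i w).
Proof.
move: w; apply: dbl_eq => [||m1 h m2].
- exact: linear_comp (opY_linear _) (opK_linear _).
- by apply: linear_scale; exact: linear_comp (opK_linear _) (opY_linear _).
elim: m1 => [|j m1 IH].
  rewrite opKE lamw_nil scale1r !opYE /= (linZ (opK_linear _)) opKE lamw_nil.
  by rewrite scale1r scalerA dlamM.
rewrite -opXE opKX (linZ (opY_linear _)) !opYX IH.
rewrite (linZ (opX_linear _)) (linD (opK_linear _)) opKX.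
rewrite (linZ (opK_linear _)) (linB (opK_linear _)) -!opKM.
rewrite (dabel D g (kk j)) (dabel D g (ll i)).
move: (opX j _) (opK _ _ - opK _ _) => P Q.
by rewrite !scalerDr !scalerA mulrC -!(mulrC (gam i j)) dgamP.
Qed.

Lemma reg_action : is_action opX opK opY.
Proof.
split; [exact: opX_linear|exact: opK_linear|exact: opY_linear|
  exact: opKM|exact: opKX|exact: opYK|exact: opYX].
Qed.

(** The action of an element of the double on a space with such operators. *)
Definition ev_def (W : lmodType k) (X : 'I_n -> W -> W) (K : G -> W -> W)
    (Y : 'I_n -> W -> W) (x : A) (w : W) : W :=
  dext (fun m1 g m2 => foldr X (K g (foldr Y w m2)) m1) x.
Definition ev := locked_with dbl_key ev_def.

Section Evaluation.
Variables (W : lmodType k) (X : 'I_n -> W -> W) (K : G -> W -> W).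
Variable Y : 'I_n -> W -> W.
Hypothesis act : is_action X K Y.
Local Notation ev := (ev X K Y).

Lemma evE m1 g m2 w : ev (bas m1 g m2) w = foldr X (K g (foldr Y w m2)) m1.
Proof. by rewrite /ev locked_withE /ev_def dextE. Qed.

Lemma ev_linearl w : linear (ev^~ w).
Proof.
by rewrite /ev locked_withE;
  exact: (dext_linear (fun m1 g m2 => foldr X (K g (foldr Y w m2)) m1)).
Qed.

Lemma foldr_linear (F : 'I_n -> W -> W) m :
  (forall i, linear (F i)) -> linear (fun w => foldr F w m).
Proof.
by move=> lF; elim: m => [|i m IH]; [exact: linear_id|exact: linear_comp IH].
Qed.

Lemma ev_linearr x : linear (ev x).
Proof.
move=> c w w'; move: x; apply: dbl_eq => [||m1 g m2].
- exact: ev_linearl.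
- by apply: linear_add; [apply: linear_scale|]; exact: ev_linearl.
rewrite !evE (foldr_linear m2 (actY_lin act)) (actK_lin act g).
exact: (foldr_linear m1 (actX_lin act)).
Qed.

Lemma actK_foldr g m w : K g (foldr X w m) = lamw m g *: foldr X (K g w) m.
Proof.
elim: m => [|i m IH]; first by rewrite lamw_nil scale1r.
rewrite /= (actKX act) IH (linZ (actX_lin act i)) scalerA.
by rewrite lamw_cons.
Qed.

Lemma ev_opX i x w : ev (opX i x) w = X i (ev x w).
Proof.
move: x; apply: dbl_eq => [||m1 g m2].
- exact: linear_comp (ev_linearl _) (opX_linear _).
- exact: linear_comp (actX_lin act i) (ev_linearl _).
by rewrite opXE !evE.
Qed.

Lemma ev_opK g x w : ev (opK g x) w = K g (ev x w).
Proof.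
move: x; apply: dbl_eq => [||m1 h m2].
- exact: linear_comp (ev_linearl _) (opK_linear _).
- exact: linear_comp (actK_lin act g) (ev_linearl _).
by rewrite opKE (linZ (ev_linearl _)) !evE actK_foldr (actKM act).
Qed.

(** The induction follows the recursion that defines left multiplication by
    f_j, because the operators on W satisfy the same relations. *)
Lemma ev_opY j x w : ev (opY j x) w = Y j (ev x w).
Proof.
move: x; apply: dbl_eq => [||m1 g m2].
- exact: linear_comp (ev_linearl _) (opY_linear _).
- exact: linear_comp (actY_lin act j) (ev_linearl _).
elim: m1 => [|i m1 IH].
  by rewrite opYE /= (linZ (ev_linearl _)) !evE /= (actYK act).
rewrite -opXE opYX (linD (ev_linearl _)) !ev_opX IH (linZ (ev_linearl _)).
by rewrite (linB (ev_linearl _)) !ev_opK (actYX act).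
Qed.

End Evaluation.

Definition dbl_mul (x y : A) : A := ev opX opK opY x y.

(** For the left multiplications on the double itself this is associativity;
    for operators on another algebra it yields the universal property. *)
Lemma ev_mul (W : lmodType k) X K Y (act : @is_action W X K Y) x y w :
  ev X K Y (dbl_mul x y) w = ev X K Y x (ev X K Y y w).
Proof.
move: x; apply: dbl_eq => [||m1 g m2].
- exact: linear_comp (ev_linearl _ _ _ _)
    (ev_linearl opX opK opY y).
- exact: ev_linearl.
rewrite /dbl_mul evE evE; elim: m1 => [|i m1 IH] /=; last first.
  by rewrite (ev_opX act) IH.
rewrite (ev_opK act); congr (K g _).
by elim: m2 => [|j m2 IH] //=; rewrite (ev_opY act) IH.
Qed.

Definition dbl_one : A := bas [::] 1%g [::].

Lemma dbl_mulA : associative dbl_mul.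
Proof. by move=> x y z; apply/esym; exact: (ev_mul reg_action). Qed.

Lemma dbl_mul1 : left_id dbl_one dbl_mul.
Proof. by move=> x; rewrite /dbl_mul evE /= opK1. Qed.

Lemma dbl_mulr1 : right_id dbl_one dbl_mul.
Proof.
move=> x; rewrite /dbl_mul; move: x; apply: dbl_eq => [||m1 g m2].
- exact: ev_linearl.
- exact: linear_id.
rewrite evE; elim: m1 => [|i m1 IH] /=; last by rewrite IH opXE.
have -> : foldr opY dbl_one m2 = bas [::] 1%g m2.
  by elim: m2 => [|j m2 IH] //=; rewrite IH opYE /= dlam1 scale1r.
by rewrite opKE lamw_nil scale1r mulg1.
Qed.

Lemma dbl_mulDl : left_distributive dbl_mul +%R.
Proof. by move=> x y z; rewrite /dbl_mul (linD (ev_linearl _ _ _ _)). Qed.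
Lemma dbl_mulDr : right_distributive dbl_mul +%R.
Proof. by move=> x y z; rewrite /dbl_mul (linD (ev_linearr reg_action _)). Qed.
Lemma dbl_1neq0 : dbl_one != 0.
Proof.
apply/eqP => /(congr1 (dext (fun _ _ _ => 1 : k^o))).
by rewrite dextE (lin0 (dext_linear _)) => /eqP; rewrite oner_eq0.
Qed.

HB.instance Definition _ := GRing.Zmodule_isNzRing.Build A
  dbl_mulA dbl_mul1 dbl_mulr1 dbl_mulDl dbl_mulDr dbl_1neq0.

Lemma dbl_scalerAl (c : k) (x y : A) : c *: (x * y) = (c *: x) * y.
Proof. by rewrite -[RHS]/(dbl_mul _ _) /dbl_mul (linZ (ev_linearl _ _ _ _)). Qed.
HB.instance Definition _ := GRing.Lmodule_isLalgebra.Build k A dbl_scalerAl.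

Lemma dbl_scalerAr (c : k) (x y : A) : c *: (x * y) = x * (c *: y).
Proof.
by rewrite -[RHS]/(dbl_mul _ _) /dbl_mul (linZ (ev_linearr reg_action _)).
Qed.
HB.instance Definition _ := GRing.Lalgebra_isAlgebra.Build k A dbl_scalerAr.

Definition gx (i : 'I_n) : A := bas [:: i] 1%g [::].
Definition gg (g : G) : A := bas [::] g [::].
Definition gy (j : 'I_n) : A := bas [::] 1%g [:: j].

Lemma gxM i x : gx i * x = opX i x.
Proof. by rewrite -[LHS]/(dbl_mul _ _) /dbl_mul evE /= opK1. Qed.
Lemma ggM g x : gg g * x = opK g x.
Proof. by rewrite -[LHS]/(dbl_mul _ _) /dbl_mul evE. Qed.
Lemma gyM j x : gy j * x = opY j x.
Proof. by rewrite -[LHS]/(dbl_mul _ _) /dbl_mul evE /= opK1. Qed.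

Lemma gg1 : gg 1%g = 1. Proof. by []. Qed.
Lemma ggMg g h : gg g * gg h = gg (g * h)%g.
Proof. by rewrite ggM opKE lamw_nil scale1r. Qed.
Lemma gg_gx g i : gg g * gx i = lam i g *: (gx i * gg g).
Proof.
by rewrite ggM gxM opKE opXE lamw_cons lamw_nil !mulr1 mulg1.
Qed.
Lemma gy_gg j g : gy j * gg g = lam j g *: (gg g * gy j).
Proof. by rewrite gyM ggM opYE opKE /= lamw_nil scale1r mulg1. Qed.
Lemma gy_gx j i : gy j * gx i = gx i * gy j + gam j i *: (gg (kk i) - gg (ll j)).
Proof.
rewrite -[gx i in LHS]mulr1 gxM gyM opYX -gxM -gyM -!ggM.
by rewrite !mulr1.
Qed.

Lemma basE m1 g m2 :
  bas m1 g m2 = \prod_(i <- m1) gx i * gg g * \prod_(j <- m2) gy j.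
Proof.
rewrite -mulrA; elim: m1 => [|i m1 IH]; last first.
  by rewrite big_cons -mulrA -IH gxM opXE.
rewrite big_nil mul1r ggM.
have -> : \prod_(j <- m2) gy j = bas [::] 1%g m2.
  elim: m2 => [|j m2 IH]; first by rewrite big_nil.
  by rewrite big_cons IH gyM opYE /= dlam1 scale1r.
by rewrite opKE lamw_nil scale1r mulg1.
Qed.

(** Every monomial arises from 1 by left multiplications by generators. *)
Lemma dbl_ind (P : A -> Prop) : P 0 -> (forall c x y, P x -> P y -> P (c *: x + y)) ->
  P 1 -> (forall i x, P x -> P (gx i * x)) -> (forall g x, P x -> P (gg g * x)) ->
  (forall j x, P x -> P (gy j * x)) -> forall x, P x.
Proof.
move=> P0 PZD P1 Px Pg Py x.
elim: (dbl_lspan x) => // c _ y [m1 [g [m2 ->]]] _ IH; apply: PZD IH.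
rewrite basE -mulrA; elim: m1 => [|i m1 IH]; last by rewrite big_cons -mulrA; exact: Px.
rewrite big_nil mul1r; apply: Pg.
by elim: m2 => [|j m2 IH]; rewrite ?big_nil ?big_cons //; exact: Py.
Qed.

End DoubleAlgebra.

(** * Coproduct, antipode and counit *)

Section DoubleHom.
Variables (k : fieldType) (G : groupType) (n : nat) (D : double_data k G n).
Local Notation lam := (dlam D).
Local Notation kk := (dkk D).
Local Notation ll := (dll D).
Local Notation gam := (dgam D).
Local Notation A := (dbl D).

(** The product is an explicit operation so that W can be a tensor product, or
    an algebra with the opposite product. *)
Record algebra_op (W : lmodType k) (m : W -> W -> W) (e : W) : Prop := AlgebraOp {
  opl : forall w, linear (m^~ w);
  opr : forall w, linear (m w);
  opA : forall x y z, m x (m y z) = m (m x y) z;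
  op1 : forall x, m e x = x;
  opr1 : forall x, m x e = x
}.

Record generator_relations (W : lmodType k) (m : W -> W -> W) (e : W)
    (jx : 'I_n -> W) (jg : G -> W) (jy : 'I_n -> W) : Prop := GeneratorRelations {
  gen_K1 : jg 1%g = e;
  gen_KM : forall g h, jg (g * h)%g = m (jg g) (jg h);
  gen_KX : forall g i, m (jg g) (jx i) = lam i g *: m (jx i) (jg g);
  gen_YK : forall g i, m (jy i) (jg g) = lam i g *: m (jg g) (jy i);
  gen_YX : forall i j, m (jy i) (jx j) =
    m (jx j) (jy i) + gam i j *: (jg (kk j) - jg (ll i))
}.

Section Target.
Variables (W : lmodType k) (m : W -> W -> W) (e : W).
Variables (jx : 'I_n -> W) (jg : G -> W) (jy : 'I_n -> W).
Hypotheses (am : algebra_op m e) (gr : generator_relations m e jx jg jy).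

Lemma hom_action : is_action D (fun i => m (jx i)) (fun g => m (jg g))
  (fun j => m (jy j)).
Proof.
split=> [i|g|j|g h w|g i w|g j w|i j w]; try exact: opr am _.
- by rewrite (gen_KM gr) (opA am).
- by rewrite (opA am) (gen_KX gr) (linZ (opl am _)) (opA am).
- by rewrite (opA am) (gen_YK gr) (linZ (opl am _)) (opA am).
- rewrite (opA am) (gen_YX gr) (linD (opl am _)) (linZ (opl am _)) (opA am).
  by rewrite (linB (opl am _)).
Qed.

Definition hom (x : A) : W :=
  ev (fun i => m (jx i)) (fun g => m (jg g)) (fun j => m (jy j)) x e.

Lemma hom_linear : linear hom. Proof. exact: ev_linearl. Qed.

Lemma hom_ev x w : ev (fun i => m (jx i)) (fun g => m (jg g))
  (fun j => m (jy j)) x w = m (hom x) w.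
Proof.
rewrite /hom; move: x; apply: dbl_eq => [||m1 g m2].
- exact: ev_linearl.
- exact: linear_comp (opl am w) (ev_linearl _ _ _ _).
rewrite !evE; elim: m1 => [|i m1 IH] /=; last by rewrite IH (opA am).
rewrite -(opA am); congr (m _ _).
by elim: m2 => [|j m2 IH] /=; rewrite ?(op1 am) // IH (opA am).
Qed.

Lemma homM x y : hom (x * y) = m (hom x) (hom y).
Proof. by rewrite -hom_ev {1}/hom (ev_mul hom_action). Qed.

Lemma hom_gx i : hom (gx D i) = jx i.
Proof. by rewrite /hom evE /= (gen_K1 gr) (op1 am) (opr1 am). Qed.
Lemma hom_gg g : hom (gg D g) = jg g.
Proof. by rewrite /hom evE /= (opr1 am). Qed.
Lemma hom_gy j : hom (gy D j) = jy j.
Proof. by rewrite /hom evE /= (gen_K1 gr) (op1 am) (opr1 am). Qed.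
Lemma hom1 : hom 1 = e.
Proof. by rewrite -(gen_K1 gr) -hom_gg. Qed.

End Target.

Lemma mul_algebra_op (B : algType k) : algebra_op (@GRing.mul B) 1.
Proof.
split; [exact: mulr_linear|exact: mull_linear|exact: mulrA|exact: mul1r|
  exact: mulr1].
Qed.

Lemma tens_algebra_op (B C : algType k) :
  algebra_op (@tprod k B C) (1 ⊠ 1).
Proof.
split; [exact: tprod_linearl|exact: tprod_linearr|exact: tprodA|exact: tprod1|
  exact: tprodr1].
Qed.

Lemma opp_algebra_op (B : algType k) : algebra_op (fun x y : B => y * x) 1.
Proof.
split; [exact: mull_linear|exact: mulr_linear| |exact: mulr1|exact: mul1r].
by move=> x y z; rewrite mulrA.
Qed.

Lemma lam_inv i g : lam i g * lam i g^-1%g = 1.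
Proof. by rewrite -dlamM mulgV dlam1. Qed.

Definition coprod_x i : tens A A := gx D i ⊠ gg D (kk i) + 1 ⊠ gx D i.
Definition coprod_g g : tens A A := gg D g ⊠ gg D g.
Definition coprod_y j : tens A A := gy D j ⊠ 1 + gg D (ll j) ⊠ gy D j.

Lemma ggC g h : gg D g * gg D h = gg D h * gg D g.
Proof. by rewrite !ggMg (dabel D). Qed.

(** In [Delta f_j, Delta v_i] the terms f_j (x) v_i cancel outright, and those
    in H V (x) H V^* cancel because lambda_j(k_i) lambda_i(l_j) = 1. *)
Lemma coprod_relations : generator_relations
  (@tprod k A A) (1 ⊠ 1) coprod_x coprod_g coprod_y.
Proof.
split=> [//|g h|g i|g j|j i].
- by rewrite /coprod_g tprod_pure !ggMg.
- rewrite /coprod_g /coprod_x tprodDl tprodDr !tprod_pure !gg_gx ggC mulr1 mul1r.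
  by rewrite spureZl spureZr scalerDr.
- rewrite /coprod_g /coprod_y tprodDl tprodDr !tprod_pure !gy_gg mulr1 mul1r.
  by rewrite spureZl spureZr scalerDr ggC.
rewrite /coprod_x /coprod_y /coprod_g !tprodDl !tprodDr !tprod_pure !mul1r !mulr1.
rewrite gg_gx gy_gg gy_gx.
rewrite spureDl spureDr !spureZl !spureZr scalerA mulrC dchar.
rewrite scale1r.
have -> : gg D (kk i) ⊠ gg D (kk i) - gg D (ll j) ⊠ gg D (ll j) =
    (gg D (kk i) - gg D (ll j)) ⊠ gg D (kk i) +
    gg D (ll j) ⊠ (gg D (kk i) - gg D (ll j)).
  by rewrite spureDl spureDr spureNl spureNr addrA subrK.
rewrite [in RHS]scalerDr.
move: (_ ⊠ _) (gam j i *: _) (gy D j ⊠ _) (_ ⊠ (gg D _ * _)) (_ ⊠ _) (gam j i *: _).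
by move=> t1 t2 t3 t4 t5 t6; rewrite !addrA (ACl (1*4*3*5*2*6)).
Qed.

Definition S_x i : A := - (gx D i * gg D (kk i)^-1%g).
Definition S_g g : A := gg D g^-1%g.
Definition S_y j : A := - (gg D (ll j)^-1%g * gy D j).

(** The antipode is a morphism to the opposite algebra. Commuting l_j^-1 with
    v_i and f_j with k_i^-1 gives inverse scalars, so that S(v_i) S(f_j) is
    again a commutator away from S(f_j) S(v_i). *)
Lemma S_relations :
  generator_relations (fun x y : A => y * x) 1 S_x S_g S_y.
Proof.
split=> [|g h|g i|g j|j i].
- by rewrite /S_g invg1.
- by rewrite /S_g invgM ggMg.
- rewrite /S_g /S_x mulNr mulrN scalerN mulrA gg_gx scalerAl scalerA lam_inv.
  by rewrite scale1r -!mulrA ggC.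
- rewrite /S_g /S_y mulNr mulrN scalerN -mulrA gy_gg -scalerAr scalerA lam_inv.
  by rewrite scale1r !mulrA ggC.
rewrite /S_x /S_y /S_g !mulNr !mulrN !opprK.
have e1 : gg D (ll j)^-1%g * gy D j * (gx D i * gg D (kk i)^-1%g) =
    gg D (ll j)^-1%g * gx D i * (gy D j * gg D (kk i)^-1%g) +
    gam j i *: (gg D (ll j)^-1%g - gg D (kk i)^-1%g).
  rewrite -!mulrA [gy D j * _]mulrA gy_gx mulrDl mulrDr !mulrA; congr (_ + _).
  rewrite -scalerAr -scalerAl -mulrA mulrBl mulrBr !ggMg mulgV mulg1.
  by rewrite mulKg.
rewrite e1 gg_gx gy_gg -scalerAl -scalerAr scalerA.
have -> : lam i (ll j)^-1%g * lam j (kk i)^-1%g = 1.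
  have := congr2 *%R (lam_inv i (ll j)) (lam_inv j (kk i)).
  by rewrite mulrACA [X in X * _]mulrC dchar !mul1r.
rewrite scale1r -addrA -scalerDr addrC -[X in gam j i *: X]addrA addKr subrr.
by rewrite scaler0 add0r -!mulrA [gg D _ * (gg D _ * _)]mulrA ggC -mulrA.
Qed.

Lemma eps_relations : generator_relations (@GRing.mul k^o) 1
  (fun _ => 0) (fun _ => 1) (fun _ => 0).
Proof.
split=> [//|g h|g i|g j|j i]; first by rewrite mulr1.
- by rewrite mulr0 mul0r scaler0.
- by rewrite mul0r mulr0 scaler0.
- by rewrite !mul0r subrr scaler0 addr0.
Qed.

Definition dDelta : A -> tens A A :=
  hom (@tprod k A A) (1 ⊠ 1) coprod_x coprod_g coprod_y.
Definition dS : A -> A := hom (fun x y : A => y * x) 1 S_x S_g S_y.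
Definition deps : A -> k^o :=
  hom (@GRing.mul k^o) 1 (fun _ => 0) (fun _ => 1) (fun _ => 0).

HB.instance Definition _ := GRing.isLinear.Build k A (tens A A) *:%R dDelta
  (hom_linear _ _ _ _ _).
HB.instance Definition _ := GRing.isLinear.Build k A A *:%R dS
  (hom_linear _ _ _ _ _).
HB.instance Definition _ := GRing.isLinear.Build k A k^o *:%R deps
  (hom_linear _ _ _ _ _).

Let opT := tens_algebra_op A A.
Let opS := opp_algebra_op A.
Let opE := mul_algebra_op k^o.

Lemma dDeltaM x y : dDelta (x * y) = tprod (dDelta x) (dDelta y).
Proof. exact: homM opT coprod_relations x y. Qed.
Lemma dDelta1 : dDelta 1 = 1 ⊠ 1.
Proof. exact: hom1 opT coprod_relations. Qed.
Lemma dDelta_gx i : dDelta (gx D i) = gx D i ⊠ gg D (kk i) + 1 ⊠ gx D i.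
Proof. exact: hom_gx opT coprod_relations i. Qed.
Lemma dDelta_gg g : dDelta (gg D g) = gg D g ⊠ gg D g.
Proof. exact: (hom_gg _ _ _ opT g). Qed.
Lemma dDelta_gy j : dDelta (gy D j) = gy D j ⊠ 1 + gg D (ll j) ⊠ gy D j.
Proof. exact: hom_gy opT coprod_relations j. Qed.

Lemma dSM x y : dS (x * y) = dS y * dS x.
Proof. exact: homM opS S_relations x y. Qed.
Lemma dS1 : dS 1 = 1. Proof. exact: hom1 opS S_relations. Qed.
Lemma dS_gx i : dS (gx D i) = - (gx D i * gg D (kk i)^-1%g).
Proof. exact: hom_gx opS S_relations i. Qed.
Lemma dS_gg g : dS (gg D g) = gg D g^-1%g.
Proof. exact: (hom_gg _ _ _ opS g). Qed.
Lemma dS_gy j : dS (gy D j) = - (gg D (ll j)^-1%g * gy D j).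
Proof. exact: hom_gy opS S_relations j. Qed.

Lemma depsM x y : deps (x * y) = deps x * deps y.
Proof. exact: homM opE eps_relations x y. Qed.
Lemma deps1 : deps 1 = 1. Proof. exact: hom1 opE eps_relations. Qed.
HB.instance Definition _ := GRing.isMonoidMorphism.Build A k^o deps
  (deps1, depsM).
Lemma deps_gx i : deps (gx D i) = 0.
Proof. exact: hom_gx opE eps_relations i. Qed.
Lemma deps_gg g : deps (gg D g) = 1.
Proof. exact: (hom_gg _ _ _ opE g). Qed.
Lemma deps_gy j : deps (gy D j) = 0.
Proof. exact: hom_gy opE eps_relations j. Qed.

Let lD : linear dDelta := hom_linear _ _ _ _ _.

Lemma dbl_gen (W : lmodType k) (F F' : A -> W) : linear F -> linear F' ->
  (forall x y, F x = F' x -> F y = F' y -> F (x * y) = F' (x * y)) ->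
  F 1 = F' 1 -> (forall i, F (gx D i) = F' (gx D i)) ->
  (forall g, F (gg D g) = F' (gg D g)) ->
  (forall j, F (gy D j) = F' (gy D j)) -> F =1 F'.
Proof.
move=> lF lF' FM F1 Fx Fg Fy; apply: dbl_ind => //.
- by rewrite (lin0 lF) (lin0 lF').
- by move=> c x y ex ey; rewrite lF lF' ex ey.
- by move=> i x ex; apply: FM.
- by move=> g x ex; apply: FM.
- by move=> j x ex; apply: FM.
Qed.

Section Coassociativity.
Local Notation A2 := (tens A A).
Local Notation A3 := (tens A A2).

(** The product of A (x) (A (x) A): both sides of coassociativity are
    multiplicative for it, so that they only have to be compared on the
    generators. *)
Definition mul3_pure (a : A) (u : A2) (t : A3) : A3 :=
  tlift (fun c w => (a * c) ⊠ (tprod u w)) t.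

Lemma spure_linearl (U X : lmodType k) (b : X) : linear (fun a : U => a ⊠ b).
Proof. by rewrite /spure locked_withE; exact: (pure_bilinear U X).1. Qed.
Lemma spure_linearr (U X : lmodType k) (a : U) : linear (fun b : X => a ⊠ b).
Proof. by rewrite /spure locked_withE; exact: (pure_bilinear U X).2. Qed.

Lemma mul3_bilin0 a u : bilinear_fun (fun (c : A) (w : A2) => (a * c) ⊠ (tprod u w)).
Proof.
split=> [w|c].
  exact: linear_comp (spure_linearl _) (mull_linear _).
exact: linear_comp (spure_linearr _) (tprod_linearr _).
Qed.

Lemma mul3_bilin t : bilinear_fun (fun a u => mul3_pure a u t).
Proof.
split=> [u|a]; apply: linear_tlift_param => c w.
  exact: linear_comp (spure_linearl _) (mulr_linear _).
exact: linear_comp (spure_linearr _) (tprod_linearl _).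
Qed.

Definition mul3 (s t : A3) : A3 := tlift (fun a u => mul3_pure a u t) s.

Lemma mul3E a u c w : mul3 (a ⊠ u) (c ⊠ w) = (a * c) ⊠ (tprod u w).
Proof.
by rewrite /mul3 (tliftE' _ _ (mul3_bilin _)) /mul3_pure (tliftE' _ _ (mul3_bilin0 _ _)).
Qed.

Lemma mul3_linearl t : linear (mul3^~ t).
Proof. exact/tlift_linear/mul3_bilin. Qed.
Lemma mul3_linearr s : linear (mul3 s).
Proof. by apply: linear_tlift_param => a u; exact/tlift_linear/mul3_bilin0. Qed.

Lemma tassoc_bilin0 (c : A) :
  bilinear_fun (fun a b : A => (a ⊗ (b ⊗ c) : A3)).
Proof.
split=> [b|a]; first exact: (pure_bilinear _ _).1.
by apply: linear_comp ((pure_bilinear _ _).2 a) _; exact: (pure_bilinear _ _).1.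
Qed.

Lemma tassoc_bilin :
  bilinear_fun (fun (s : A2) (c : A) => tlift (fun a b => a ⊗ (b ⊗ c)) s : A3).
Proof.
split=> [c|s]; first exact/tlift_linear/tassoc_bilin0.
apply: linear_tlift_param => a b.
by apply: linear_comp ((pure_bilinear _ _).2 a) _; exact: (pure_bilinear _ _).2.
Qed.

Lemma tassoc_linear : linear (@tassoc k A A A).
Proof. exact/tlift_linear/tassoc_bilin. Qed.

Lemma tassocE (a b c : A) : tassoc ((a ⊠ b) ⊠ c) = a ⊠ (b ⊠ c).
Proof.
rewrite /tassoc (tliftE' _ _ tassoc_bilin) (tliftE' _ _ (tassoc_bilin0 _)).
by rewrite !spureE.
Qed.

Lemma tmap_bilin (B C E E' : lmodType k) (f : B -> E) (g : C -> E') :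
  linear f -> linear g -> bilinear_fun (fun a b => f a ⊗ g b).
Proof.
by move=> lf lg; split=> [b|a]; [exact: linear_puref|exact: linear_purer].
Qed.

Lemma tmap_linear (B C E E' : lmodType k) (f : B -> E) (g : C -> E') :
  linear f -> linear g -> linear (tmap f g).
Proof. by move=> lf lg; exact/tlift_linear/tmap_bilin. Qed.

Lemma tmapE (B C E E' : lmodType k) (f : B -> E) (g : C -> E') a b :
  linear f -> linear g -> tmap f g (a ⊠ b) = f a ⊠ g b.
Proof. by move=> lf lg; rewrite /tmap (tliftE' _ _ (tmap_bilin lf lg)) spureE. Qed.

Definition coL (t : A2) : A3 := tassoc (tmap dDelta idfun t).
Definition coR (t : A2) : A3 := tmap idfun dDelta t.

Let lid : linear (@idfun A). Proof. by []. Qed.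

Lemma coL_linear : linear coL.
Proof. exact: linear_comp tassoc_linear (tmap_linear lD lid). Qed.
Lemma coR_linear : linear coR.
Proof. exact: tmap_linear lid lD. Qed.
Lemma coLE a b : coL (a ⊠ b) = tassoc (dDelta a ⊠ b).
Proof. by rewrite /coL tmapE. Qed.
Lemma coRE a b : coR (a ⊠ b) = a ⊠ dDelta b.
Proof. by rewrite /coR tmapE. Qed.

Lemma tassocM (s t : A2) (b d : A) : tassoc (tprod s t ⊠ (b * d)) =
  mul3 (tassoc (s ⊠ b)) (tassoc (t ⊠ d)).
Proof.
pattern s; suff: (fun s => tassoc (tprod s t ⊠ (b * d))) =1
  (fun s => mul3 (tassoc (s ⊠ b)) (tassoc (t ⊠ d))) by apply.
apply: tens_eq => [||a1 a2].
- exact: linear_comp tassoc_linear (linear_comp (spure_linearl _) (tprod_linearl _)).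
- exact: linear_comp (mul3_linearl _) (linear_comp tassoc_linear (spure_linearl _)).
pattern t; suff: (fun t => tassoc (tprod (a1 ⊠ a2) t ⊠ (b * d))) =1
  (fun t => mul3 (tassoc (a1 ⊠ a2 ⊠ b)) (tassoc (t ⊠ d))) by apply.
apply: tens_eq => [||c1 c2].
- exact: linear_comp tassoc_linear (linear_comp (spure_linearl _) (tprod_linearr _)).
- exact: linear_comp (mul3_linearr _) (linear_comp tassoc_linear (spure_linearl _)).
by rewrite tprod_pure !tassocE mul3E tprod_pure.
Qed.

Lemma coLM s t : coL (tprod s t) = mul3 (coL s) (coL t).
Proof.
pattern s; suff: (fun s => coL (tprod s t)) =1
  (fun s => mul3 (coL s) (coL t)) by apply.
apply: tens_eq => [||a b].
- exact: linear_comp coL_linear (tprod_linearl _).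
- exact: linear_comp (mul3_linearl _) coL_linear.
pattern t; suff: (fun t => coL (tprod (a ⊠ b) t)) =1
  (fun t => mul3 (coL (a ⊠ b)) (coL t)) by apply.
apply: tens_eq => [||c d].
- exact: linear_comp coL_linear (tprod_linearr _).
- exact: linear_comp (mul3_linearr _) coL_linear.
by rewrite tprod_pure !coLE dDeltaM tassocM.
Qed.

Lemma coRM s t : coR (tprod s t) = mul3 (coR s) (coR t).
Proof.
pattern s; suff: (fun s => coR (tprod s t)) =1
  (fun s => mul3 (coR s) (coR t)) by apply.
apply: tens_eq => [||a b].
- exact: linear_comp coR_linear (tprod_linearl _).
- exact: linear_comp (mul3_linearl _) coR_linear.
pattern t; suff: (fun t => coR (tprod (a ⊠ b) t)) =1
  (fun t => mul3 (coR (a ⊠ b)) (coR t)) by apply.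
apply: tens_eq => [||c d].
- exact: linear_comp coR_linear (tprod_linearr _).
- exact: linear_comp (mul3_linearr _) coR_linear.
by rewrite tprod_pure !coRE dDeltaM mul3E.
Qed.

Lemma dDelta_coassoc x : coL (dDelta x) = coR (dDelta x).
Proof.
move: x; apply: dbl_gen => [||x y ex ey||i|g|j].
- exact: linear_comp coL_linear lD.
- exact: linear_comp coR_linear lD.
- by rewrite dDeltaM coLM coRM ex ey.
- by rewrite dDelta1 coLE coRE dDelta1 tassocE.
- rewrite dDelta_gx (linD coL_linear) (linD coR_linear) !coLE !coRE.
  rewrite dDelta1 dDelta_gx dDelta_gg spureDl spureDr (linD tassoc_linear).
  by rewrite !tassocE addrA.
- by rewrite dDelta_gg coLE coRE dDelta_gg tassocE.
- rewrite dDelta_gy (linD coL_linear) (linD coR_linear) !coLE !coRE.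
  rewrite dDelta1 dDelta_gy dDelta_gg spureDl spureDr (linD tassoc_linear).
  by rewrite !tassocE addrA.
Qed.

End Coassociativity.
End DoubleHom.

(** * The axioms of a Hopf algebra *)

Section DoubleHopf.
Variables (k : fieldType) (G : groupType) (n : nat) (D : double_data k G n).
Local Notation lam := (dlam D).
Local Notation kk := (dkk D).
Local Notation ll := (dll D).
Local Notation A := (dbl D).
Local Notation Delta := (@dDelta k G n D).
Local Notation eps := (@deps k G n D).
Local Notation S := (@dS k G n D).

Lemma dDelta_linear : linear Delta. Proof. exact: hom_linear. Qed.
Lemma dS_linear : linear S. Proof. exact: hom_linear. Qed.
Lemma deps_linear : linear eps. Proof. exact: hom_linear. Qed.

Lemma tens_eq2 (B C E F W : lmodType k) (f g : tens B C -> tens E F -> W) :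
  (forall t, linear (f^~ t)) -> (forall s, linear (f s)) ->
  (forall t, linear (g^~ t)) -> (forall s, linear (g s)) ->
  (forall a b c d, f (a ⊠ b) (c ⊠ d) = g (a ⊠ b) (c ⊠ d)) ->
  forall s t, f s t = g s t.
Proof.
move=> fl fr gl gr e s t; move: s; apply: tens_eq => // a b.
by move: t; apply: tens_eq => // c d.
Qed.

Definition co_left (t : tens A A) : A := tlift (fun a b => (eps a : k) *: b) t.
Definition co_right (t : tens A A) : A := tlift (fun a b => (eps b : k) *: a) t.
Definition anti_left (t : tens A A) : A := tlift (fun a b => S a * b) t.
Definition anti_right (t : tens A A) : A := tlift (fun a b => a * S b) t.

Lemma co_left_bilin : bilinear_fun (fun a b : A => (eps a : k) *: b).
Proof.
split=> [b|a]; first exact: linear_scaler deps_linear.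
by apply: linear_scale; exact: linear_id.
Qed.
Lemma co_right_bilin : bilinear_fun (fun a b : A => (eps b : k) *: a).
Proof.
split=> [b|a]; last exact: linear_scaler deps_linear.
by apply: linear_scale; exact: linear_id.
Qed.
Lemma anti_left_bilin : bilinear_fun (fun a b : A => S a * b).
Proof.
split=> [b|a]; last exact: mull_linear.
exact: linear_comp (mulr_linear _) dS_linear.
Qed.
Lemma anti_right_bilin : bilinear_fun (fun a b : A => a * S b).
Proof.
split=> [b|a]; first exact: mulr_linear.
exact: linear_comp (mull_linear _) dS_linear.
Qed.

Lemma co_left_linear : linear co_left. Proof. exact/tlift_linear/co_left_bilin. Qed.
Lemma co_right_linear : linear co_right. Proof. exact/tlift_linear/co_right_bilin. Qed.
Lemma anti_left_linear : linear anti_left. Proof. exact/tlift_linear/anti_left_bilin. Qed.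
Lemma anti_right_linear : linear anti_right. Proof. exact/tlift_linear/anti_right_bilin. Qed.

Lemma co_leftE a b : co_left (a ⊠ b) = (eps a : k) *: b.
Proof. exact: tliftE' co_left_bilin. Qed.
Lemma co_rightE a b : co_right (a ⊠ b) = (eps b : k) *: a.
Proof. exact: tliftE' co_right_bilin. Qed.
Lemma anti_leftE a b : anti_left (a ⊠ b) = S a * b.
Proof. exact: tliftE' anti_left_bilin. Qed.
Lemma anti_rightE a b : anti_right (a ⊠ b) = a * S b.
Proof. exact: tliftE' anti_right_bilin. Qed.

Lemma co_leftM s t : co_left (tprod s t) = co_left s * co_left t.
Proof.
move: s t; apply: tens_eq2 => [t|s|t|s|a b c d].
- exact: linear_comp co_left_linear (tprod_linearl _).
- exact: linear_comp co_left_linear (tprod_linearr _).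
- exact: linear_comp (mulr_linear _) co_left_linear.
- exact: linear_comp (mull_linear _) co_left_linear.
by rewrite tprod_pure !co_leftE depsM -scalerAl -scalerAr scalerA.
Qed.

Lemma co_rightM s t : co_right (tprod s t) = co_right s * co_right t.
Proof.
move: s t; apply: tens_eq2 => [t|s|t|s|a b c d].
- exact: linear_comp co_right_linear (tprod_linearl _).
- exact: linear_comp co_right_linear (tprod_linearr _).
- exact: linear_comp (mulr_linear _) co_right_linear.
- exact: linear_comp (mull_linear _) co_right_linear.
by rewrite tprod_pure !co_rightE depsM -scalerAl -scalerAr scalerA.
Qed.

Lemma dcounit_left x : co_left (Delta x) = x.
Proof.
move: x; apply: dbl_gen => [||x y ex ey||i|g|j].
- exact: linear_comp co_left_linear dDelta_linear.
- exact: linear_id.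
- by rewrite dDeltaM co_leftM ex ey.
- by rewrite dDelta1 co_leftE deps1 scale1r.
- rewrite dDelta_gx (linD co_left_linear) !co_leftE deps_gx deps1.
  by rewrite scale0r add0r scale1r.
- by rewrite dDelta_gg co_leftE deps_gg scale1r.
- rewrite dDelta_gy (linD co_left_linear) !co_leftE deps_gy deps_gg.
  by rewrite scale0r add0r scale1r.
Qed.

Lemma dcounit_right x : co_right (Delta x) = x.
Proof.
move: x; apply: dbl_gen => [||x y ex ey||i|g|j].
- exact: linear_comp co_right_linear dDelta_linear.
- exact: linear_id.
- by rewrite dDeltaM co_rightM ex ey.
- by rewrite dDelta1 co_rightE deps1 scale1r.
- rewrite dDelta_gx (linD co_right_linear) !co_rightE deps_gx deps_gg.
  by rewrite scale0r addr0 scale1r.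
- by rewrite dDelta_gg co_rightE deps_gg scale1r.
- rewrite dDelta_gy (linD co_right_linear) !co_rightE deps_gy deps1.
  by rewrite scale0r addr0 scale1r.
Qed.

(** Since S reverses products, S(g_1 x_1) g_2 x_2 = S(x_1) S(g_1) g_2 x_2:
    if the inner factor is a scalar then it can be pulled out. *)
Lemma anti_leftM c s t : anti_left s = c *: 1 ->
  anti_left (tprod s t) = c *: anti_left t.
Proof.
move=> es; move: t; apply: tens_eq => [||a b].
- exact: linear_comp anti_left_linear (tprod_linearr _).
- exact: linear_scale anti_left_linear.
have -> : anti_left (tprod s (a ⊠ b)) = S a * anti_left s * b.
  move: s {es}; apply: tens_eq => [||a' b'].
  - exact: linear_comp anti_left_linear (tprod_linearl _).
  - apply: linear_comp (mulr_linear _) _.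
    exact: linear_comp (mull_linear _) anti_left_linear.
  by rewrite tprod_pure !anti_leftE dSM !mulrA.
by rewrite es anti_leftE -scalerAr mulr1 -scalerAl.
Qed.

Lemma anti_rightM c s t : anti_right t = c *: 1 ->
  anti_right (tprod s t) = c *: anti_right s.
Proof.
move=> et; move: s; apply: tens_eq => [||a b].
- exact: linear_comp anti_right_linear (tprod_linearl _).
- exact: linear_scale anti_right_linear.
have -> : anti_right (tprod (a ⊠ b) t) = a * anti_right t * S b.
  move: t {et}; apply: tens_eq => [||a' b'].
  - exact: linear_comp anti_right_linear (tprod_linearr _).
  - apply: linear_comp (mulr_linear _) _.
    exact: linear_comp (mull_linear _) anti_right_linear.
  by rewrite tprod_pure !anti_rightE dSM !mulrA.
by rewrite et anti_rightE -scalerAr mulr1 -scalerAl.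
Qed.

Lemma dantipode_left x : anti_left (Delta x) = (eps x : k) *: 1.
Proof.
move: x; apply: dbl_gen => [||x y ex ey||i|g|j].
- exact: linear_comp anti_left_linear dDelta_linear.
- exact: linear_scaler deps_linear.
- by rewrite dDeltaM (anti_leftM _ ex) ey depsM scalerA.
- by rewrite dDelta1 anti_leftE dS1 mulr1 deps1 scale1r.
- rewrite dDelta_gx (linD anti_left_linear) !anti_leftE dS_gx dS1 mul1r.
  by rewrite mulNr -mulrA ggMg mulVg gg1 mulr1 addNr deps_gx scale0r.
- by rewrite dDelta_gg anti_leftE dS_gg ggMg mulVg gg1 deps_gg scale1r.
- rewrite dDelta_gy (linD anti_left_linear) !anti_leftE dS_gy dS_gg mulr1.
  by rewrite addNr deps_gy scale0r.
Qed.

Lemma dantipode_right x : anti_right (Delta x) = (eps x : k) *: 1.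
Proof.
move: x; apply: dbl_gen => [||x y ex ey||i|g|j].
- exact: linear_comp anti_right_linear dDelta_linear.
- exact: linear_scaler deps_linear.
- by rewrite dDeltaM (anti_rightM _ ey) ex depsM scalerA mulrC.
- by rewrite dDelta1 anti_rightE dS1 mulr1 deps1 scale1r.
- rewrite dDelta_gx (linD anti_right_linear) !anti_rightE dS_gx dS_gg mul1r.
  by rewrite subrr deps_gx scale0r.
- by rewrite dDelta_gg anti_rightE dS_gg ggMg mulgV gg1 deps_gg scale1r.
- rewrite dDelta_gy (linD anti_right_linear) !anti_rightE dS_gy dS1 mulr1.
  by rewrite mulrN mulrA ggMg mulgV gg1 mul1r subrr deps_gy scale0r.
Qed.

Lemma dbl_hopf : is_hopf_algebra Delta eps S.
Proof.
split.
- by move=> x y; rewrite -tprodE; exact: dDeltaM.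
- by rewrite -spureE; exact: dDelta1.
- exact: dDelta_coassoc.
- exact: dcounit_left.
- exact: dcounit_right.
- exact: dantipode_left.
- exact: dantipode_right.
Qed.

End DoubleHopf.

(** * Grading and triangular decomposition *)

Section DoubleFiltration.
Variables (k : fieldType) (G : groupType) (n : nat) (D : double_data k G n).
Local Notation lam := (dlam D).
Local Notation kk := (dkk D).
Local Notation ll := (dll D).
Local Notation A := (dbl D).
Local Notation Delta := (@dDelta k G n D).
Local Notation eps := (@deps k G n D).
Local Notation S := (@dS k G n D).

Definition bspan (Q : seq 'I_n -> G -> seq 'I_n -> Prop) : A -> Prop :=
  lspan (fun x => exists m1 g m2, Q m1 g m2 /\ x = bas m1 g m2).

Lemma bspan_bas (Q : seq 'I_n -> G -> seq 'I_n -> Prop) m1 g m2 :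
  Q m1 g m2 -> bspan Q (bas m1 g m2).
Proof. by move=> q; apply: lspan_gen; exists m1, g, m2. Qed.

Lemma bspan_image (W : lmodType k) (Q : seq 'I_n -> G -> seq 'I_n -> Prop)
    (T : W -> Prop) (F : A -> W) : linear F ->
  (forall m1 g m2, Q m1 g m2 -> lspan T (F (bas m1 g m2))) ->
  forall x, bspan Q x -> lspan T (F x).
Proof.
by move=> lF QT; apply: lspan_image => // _ [m1 [g [m2 [q ->]]]]; exact: QT.
Qed.

Lemma opX_bspan (Q Q' : seq 'I_n -> G -> seq 'I_n -> Prop) i :
  (forall m1 g m2, Q m1 g m2 -> Q' (i :: m1) g m2) ->
  forall x, bspan Q x -> bspan Q' (opX i x).
Proof.
move=> QQ; apply: bspan_image => [|m1 g m2 q]; first exact: opX_linear.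
by rewrite opXE; apply/bspan_bas/QQ.
Qed.

Lemma opK_bspan (Q Q' : seq 'I_n -> G -> seq 'I_n -> Prop) h :
  (forall m1 g m2, Q m1 g m2 -> Q' m1 (h * g)%g m2) ->
  forall x, bspan Q x -> bspan Q' (opK h x).
Proof.
move=> QQ; apply: bspan_image => [|m1 g m2 q]; first exact: opK_linear.
by rewrite opKE; apply/lspanZ/bspan_bas/QQ.
Qed.

(** Moving f_j into its place in a monomial either keeps all the v_i or
    trades f_j and one v_i for a group element. *)
Lemma opYw_bspan j m1 g m2 : bspan (fun m1' _ m2' =>
    size m1' = size m1 /\ size m2' = (size m2).+1 \/
    (size m1').+1 = size m1 /\ size m2' = size m2) (opYw D j m1 g m2).
Proof.
elim: m1 => [|i m1 IH] /=; first by apply/lspanZ/bspan_bas; left.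
apply: lspanD.
  apply: opX_bspan IH => m1' g' m2' /= [[-> ->]|[<- ->]]; by [left|right].
by apply/lspanZ/lspanB; rewrite opKE; apply/lspanZ/bspan_bas; right.
Qed.

Lemma opY_bspan (Q Q' : seq 'I_n -> G -> seq 'I_n -> Prop) j :
  (forall m1 g m2 m1' g' m2', Q m1 g m2 ->
     size m1' = size m1 /\ size m2' = (size m2).+1 \/
     (size m1').+1 = size m1 /\ size m2' = size m2 -> Q' m1' g' m2') ->
  forall x, bspan Q x -> bspan Q' (opY j x).
Proof.
move=> QQ; apply: bspan_image => [|m1 g m2 q]; first exact: opY_linear.
rewrite opYE; apply: lspan_mono (opYw_bspan j m1 g m2).
by move=> _ [m1' [g' [m2' [q' ->]]]]; apply: bspan_bas; apply: QQ q q'.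
Qed.

(** The natural grading of the double. *)
Definition homb (d : int) : A -> Prop :=
  bspan (fun m1 _ m2 => d = (size m1)%:Z - (size m2)%:Z).

Lemma homb_gx i d x : homb d x -> homb (1 + d) (gx D i * x).
Proof.
rewrite gxM; apply: opX_bspan => m1 _ m2 -> /=.
by rewrite -[(size m1).+1]add1n PoszD addrA.
Qed.

Lemma homb_gg g d x : homb d x -> homb d (gg D g * x).
Proof. by rewrite ggM; apply: opK_bspan. Qed.

Lemma homb_gy j d x : homb d x -> homb (- 1 + d) (gy D j * x).
Proof.
rewrite gyM; apply: opY_bspan => m1 _ m2 m1' _ m2' -> [[-> ->]|[<- ->]].
  by rewrite -[(size m2).+1]add1n PoszD opprD addrCA.
by rewrite -[(size m1').+1]add1n PoszD -addrA addKr.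
Qed.

Lemma graded_bas_ind (P : int -> A -> Prop) : P 0 1 ->
  (forall i d x, P d x -> P (1 + d) (gx D i * x)) ->
  (forall g d x, P d x -> P d (gg D g * x)) ->
  (forall j d x, P d x -> P (- 1 + d) (gy D j * x)) ->
  forall m1 g m2, P ((size m1)%:Z - (size m2)%:Z) (bas m1 g m2).
Proof.
move=> P1 Px Pg Py m1 g m2; rewrite basE -mulrA.
elim: m1 => [|i m1 IH]; last first.
  by rewrite big_cons -mulrA /= -add1n PoszD -addrA; apply: Px.
rewrite big_nil mul1r sub0r; apply: Pg.
elim: m2 => [|j m2 IH]; first by rewrite big_nil oppr0.
by rewrite big_cons /= -add1n PoszD opprD; apply: Py.
Qed.

Lemma homb1 : homb 0 1. Proof. by apply: bspan_bas; rewrite subrr. Qed.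

Lemma hombM d1 d2 x y : homb d1 x -> homb d2 y -> homb (d1 + d2) (x * y).
Proof.
move=> hx hy; apply: (bspan_image (mulr_linear y) _ hx) => m1 g m2 ->.
apply: (@graded_bas_ind (fun d x => homb (d + d2) (x * y))).
- by rewrite add0r mul1r.
- by move=> i d z hz; rewrite -mulrA -addrA; apply: homb_gx.
- by move=> h d z hz; rewrite -mulrA; apply: homb_gg.
- by move=> j d z hz; rewrite -mulrA -addrA; apply: homb_gy.
Qed.

Definition homb2 (d : int) : tens A A -> Prop :=
  lspan (fun t => exists d1 d2 a b,
    [/\ d = d1 + d2, homb d1 a, homb d2 b & t = a ⊗ b]).

Lemma homb2_pure d1 d2 a b : homb d1 a -> homb d2 b -> homb2 (d1 + d2) (a ⊠ b).
Proof.
by move=> ha hb; apply: lspan_gen; exists d1, d2, a, b; rewrite spureE.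
Qed.

Lemma homb2M d1 d2 s t : homb2 d1 s -> homb2 d2 t -> homb2 (d1 + d2) (tprod s t).
Proof.
move=> hs ht; apply: (lspan_image (tprod_linearl t) _ hs).
move=> _ [e1 [e2 [a [b [-> ha hb ->]]]]].
apply: (lspan_image (tprod_linearr _) _ ht).
move=> _ [e1' [e2' [a' [b' [-> ha' hb' ->]]]]].
rewrite -!spureE tprod_pure addrACA.
by apply: homb2_pure; apply: hombM.
Qed.

Lemma homb_gen_x i : homb 1 (gx D i).
Proof. by apply: bspan_bas; rewrite subr0. Qed.
Lemma homb_gen_g g : homb 0 (gg D g).
Proof. by apply: bspan_bas; rewrite subr0. Qed.
Lemma homb_gen_y j : homb (- 1) (gy D j).
Proof. by apply: bspan_bas; rewrite sub0r. Qed.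

Lemma dDelta_graded d x : homb d x -> homb2 d (Delta x).
Proof.
apply: bspan_image => [|m1 g m2 ->]; first exact: dDelta_linear.
apply: (@graded_bas_ind (fun d x => homb2 d (Delta x))).
- by rewrite dDelta1 -(addr0 0); apply: homb2_pure homb1 homb1.
- move=> i e z hz; rewrite dDeltaM; apply: homb2M hz; rewrite dDelta_gx.
  apply: lspanD.
    by rewrite -(addr0 1); apply: homb2_pure (homb_gen_x _) (homb_gen_g _).
  by rewrite -(add0r 1); apply: homb2_pure homb1 (homb_gen_x _).
- move=> h e z hz; rewrite dDeltaM -(add0r e); apply: homb2M hz.
  by rewrite dDelta_gg -(addr0 0); apply: homb2_pure; exact: homb_gen_g.
- move=> j e z hz; rewrite dDeltaM; apply: homb2M hz; rewrite dDelta_gy.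
  apply: lspanD.
    by rewrite -(addr0 (- 1)); apply: homb2_pure (homb_gen_y _) homb1.
  by rewrite -(add0r (- 1)); apply: homb2_pure (homb_gen_g _) (homb_gen_y _).
Qed.

Lemma dS_graded d x : homb d x -> homb d (S x).
Proof.
apply: bspan_image => [|m1 g m2 ->]; first exact: dS_linear.
apply: (@graded_bas_ind (fun d x => homb d (S x))).
- by rewrite dS1; exact: homb1.
- move=> i e z hz; rewrite dSM addrC; apply: hombM hz _; rewrite dS_gx.
  by apply: lspanN; rewrite -(addr0 1); apply: hombM (homb_gen_x _) (homb_gen_g _).
- move=> h e z hz; rewrite dSM -(addr0 e); apply: hombM hz _.
  by rewrite dS_gg; exact: homb_gen_g.
- move=> j e z hz; rewrite dSM addrC; apply: hombM hz _; rewrite dS_gy.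
  apply: lspanN; rewrite -(add0r (- 1)).
  exact: hombM (homb_gen_g _) (homb_gen_y _).
Qed.

Lemma deps_graded d x : homb d x -> d != 0 -> eps x = 0.
Proof.
move=> hx dn0; elim: hx => [|c _ y [m1 [g [m2 [ed ->]]]] _ IH].
  exact: (lin0 (@deps_linear _ _ _ D)).
rewrite (@deps_linear _ _ _ D) IH addr0 basE.
case: m1 ed => [|i m1] ed; last by rewrite big_cons !depsM deps_gx !mul0r scaler0.
case: m2 ed => [|j m2] ed; first by rewrite ed subrr eqxx in dn0.
by rewrite big_cons !depsM deps_gy !(mul0r, mulr0) scaler0.
Qed.

(** The subalgebras T(V)H and HT(V^* ). *)
Definition tvh : A -> Prop := bspan (fun _ _ m2 => m2 = [::]).
Definition htf : A -> Prop := bspan (fun m1 _ _ => m1 = [::]).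

Lemma tvh_ind (P : A -> Prop) : P 1 ->
  (forall i x, P x -> P (gx D i * x)) -> (forall g x, P x -> P (gg D g * x)) ->
  forall m1 g, P (bas m1 g [::]).
Proof.
move=> P1 Px Pg m1 g; rewrite basE big_nil mulr1.
elim: m1 => [|i m1 IH]; last by rewrite big_cons -mulrA; apply: Px.
by rewrite big_nil mul1r -[gg D g]mulr1; apply: Pg.
Qed.

Lemma htf_ind (P : A -> Prop) : P 1 ->
  (forall g x, P x -> P (gg D g * x)) -> (forall j x, P x -> P (gy D j * x)) ->
  forall g m2, P (bas [::] g m2).
Proof.
move=> P1 Pg Py g m2; rewrite basE big_nil mul1r; apply: Pg.
by elim: m2 => [|j m2 IH]; rewrite ?big_nil ?big_cons //; apply: Py.
Qed.

Lemma tvhM x y : tvh x -> tvh y -> tvh (x * y).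
Proof.
move=> hx hy; apply: (bspan_image (mulr_linear y) _ hx) => m1 g m2 -> {m2}.
move: m1 g; apply: (tvh_ind (P := fun x => tvh (x * y))).
- by rewrite mul1r.
- by move=> i z hz; rewrite -mulrA gxM; apply: opX_bspan hz.
- by move=> g z hz; rewrite -mulrA ggM; apply: opK_bspan hz.
Qed.

Lemma htfM x y : htf x -> htf y -> htf (x * y).
Proof.
move=> hx hy; apply: (bspan_image (mulr_linear y) _ hx) => m1 g m2 -> {m1}.
move: g m2; apply: (htf_ind (P := fun x => htf (x * y))).
- by rewrite mul1r.
- by move=> g z hz; rewrite -mulrA ggM; apply: opK_bspan hz.
- move=> j z hz; rewrite -mulrA gyM; apply: opY_bspan hz.
  by move=> m1 g m2 m1' g' m2' -> [[/size0nil]|[]].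
Qed.

Lemma tvh_x i : tvh (gx D i). Proof. exact: bspan_bas. Qed.
Lemma tvh_g g : tvh (gg D g). Proof. exact: bspan_bas. Qed.
Lemma htf_y j : htf (gy D j). Proof. exact: bspan_bas. Qed.
Lemma htf_g g : htf (gg D g). Proof. exact: bspan_bas. Qed.

Lemma tens_sub_pure (P Q : A -> Prop) a b : P a -> Q b -> tens_sub P Q (a ⊠ b).
Proof. by move=> pa qb; apply: lspan_gen; exists a, b; rewrite spureE. Qed.

Lemma tens_subM (P : A -> Prop) (PM : forall x y, P x -> P y -> P (x * y)) s t :
  tens_sub P P s -> tens_sub P P t -> tens_sub P P (tprod s t).
Proof.
move=> hs ht; apply: (lspan_image (tprod_linearl t) _ hs).
move=> _ [a [b [pa pb ->]]]; apply: (lspan_image (tprod_linearr _) _ ht).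
move=> _ [a' [b' [pa' pb' ->]]]; rewrite -!spureE tprod_pure.
by apply: tens_sub_pure; apply: PM.
Qed.

Lemma dDelta_tvh x : tvh x -> tens_sub tvh tvh (Delta x).
Proof.
apply: bspan_image => [|m1 g m2 -> {m2}]; first exact: dDelta_linear.
move: m1 g; apply: (tvh_ind (P := fun x => tens_sub tvh tvh (Delta x))).
- by rewrite dDelta1; apply: tens_sub_pure; exact: (tvh_g 1%g).
- move=> i z hz; rewrite dDeltaM dDelta_gx; apply: tens_subM hz => //.
    exact: tvhM.
  by apply: lspanD; apply: tens_sub_pure; try exact: tvh_x; exact: tvh_g.
- move=> g z hz; rewrite dDeltaM dDelta_gg; apply: tens_subM hz.
    exact: tvhM.
  by apply: tens_sub_pure; exact: tvh_g.
Qed.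

Lemma dDelta_htf x : htf x -> tens_sub htf htf (Delta x).
Proof.
apply: bspan_image => [|m1 g m2 -> {m1}]; first exact: dDelta_linear.
move: g m2; apply: (htf_ind (P := fun x => tens_sub htf htf (Delta x))).
- by rewrite dDelta1; apply: tens_sub_pure; exact: (htf_g 1%g).
- move=> g z hz; rewrite dDeltaM dDelta_gg; apply: tens_subM hz.
    exact: htfM.
  by apply: tens_sub_pure; exact: htf_g.
- move=> j z hz; rewrite dDeltaM dDelta_gy; apply: tens_subM hz.
    exact: htfM.
  by apply: lspanD; apply: tens_sub_pure; try exact: htf_y; exact: htf_g.
Qed.

Lemma dS_tvh x : tvh x -> tvh (S x).
Proof.
apply: bspan_image => [|m1 g m2 -> {m2}]; first exact: dS_linear.
move: m1 g; apply: (tvh_ind (P := fun x => tvh (S x))).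
- by rewrite dS1; exact: (tvh_g 1%g).
- move=> i z hz; rewrite dSM dS_gx; apply: tvhM hz _; apply: lspanN.
  exact: tvhM (tvh_x _) (tvh_g _).
- by move=> g z hz; rewrite dSM dS_gg; apply: tvhM hz (tvh_g _).
Qed.

Lemma dS_htf x : htf x -> htf (S x).
Proof.
apply: bspan_image => [|m1 g m2 -> {m1}]; first exact: dS_linear.
move: g m2; apply: (htf_ind (P := fun x => htf (S x))).
- by rewrite dS1; exact: (htf_g 1%g).
- by move=> g z hz; rewrite dSM dS_gg; apply: htfM hz (htf_g _).
- move=> j z hz; rewrite dSM dS_gy; apply: htfM hz _; apply: lspanN.
  exact: htfM (htf_g _) (htf_y _).
Qed.

End DoubleFiltration.

(** * Subcoalgebras and group-like elements *)

Section DoubleCoradical.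
Variables (k : fieldType) (G : groupType) (n : nat) (D : double_data k G n).
Local Notation lam := (dlam D).
Local Notation kk := (dkk D).
Local Notation ll := (dll D).
Local Notation A := (dbl D).
Local Notation Delta := (@dDelta k G n D).
Local Notation eps := (@deps k G n D).
Local Notation S := (@dS k G n D).

(** Monomials of length less than N, so that flt 0 is zero. *)
Definition flt (N : nat) : A -> Prop :=
  bspan (fun m1 _ m2 => size m1 + size m2 < N)%N.

Lemma flt_gx i N x : flt N x -> flt N.+1 (gx D i * x).
Proof. by rewrite gxM; apply: opX_bspan. Qed.
Lemma flt_gg g N x : flt N x -> flt N (gg D g * x).
Proof. by rewrite ggM; apply: opK_bspan. Qed.
Lemma flt_gy j N x : flt N x -> flt N.+1 (gy D j * x).
Proof.
rewrite gyM; apply: opY_bspan => m1 _ m2 m1' _ m2' h [[-> ->]|[e ->]].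
  by rewrite addnS.
by apply: leqW; apply: ltnW; rewrite -addSn e.
Qed.
Lemma flt_mono N N' x : (N <= N')%N -> flt N x -> flt N' x.
Proof.
move=> NN; apply: lspan_mono => _ [m1 [g [m2 [h ->]]]].
by apply: bspan_bas; exact: leq_trans NN.
Qed.

Definition low (N : nat) : tens A A -> Prop :=
  lspan (fun t => exists a b, flt N a /\ t = a ⊠ b).

Lemma low_pure N a b : flt N a -> low N (a ⊠ b).
Proof. by move=> ha; apply: lspan_gen; exists a, b. Qed.

Lemma low_mul N N' c d t : (forall a, flt N a -> flt N' (c * a)) ->
  low N t -> low N' (tprod (c ⊠ d) t).
Proof.
move=> cN; apply: lspan_image => [|_ [a [b [ha ->]]]]; first exact: tprod_linearr.
by rewrite tprod_pure; apply/low_pure/cN.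
Qed.

Lemma low_mono N N' t : (N <= N')%N -> low N t -> low N' t.
Proof.
move=> NN; apply: lspan_mono => _ [a [b [ha ->]]].
by apply: low_pure; exact: flt_mono NN ha.
Qed.

Definition kword (m1 : seq 'I_n) (g : G) : G :=
  foldr (fun i h => kk i * h)%g g m1.

(** The term y (x) c of Delta y is the only one whose left component has the
    full length N. *)
Definition leading (N : nat) (y c : A) : Prop :=
  flt N.+1 y /\ low N (Delta y - y ⊠ c).

Lemma leading_step N N' u a (q : tens A A) y c : (N <= N')%N ->
  Delta u = u ⊠ a + q ->
  (forall M z, flt M z -> flt (N' - N + M) (u * z)) ->
  (forall t, low N.+1 t -> low N' (tprod q t)) ->
  leading N y c -> leading N' (u * y) (a * c).
Proof.
move=> NN uE fu lq [fy ly]; split.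
  by have := fu _ _ fy; rewrite addnS subnK.
rewrite dDeltaM uE tprodDl -{1}[Delta y](subrK (y ⊠ c)) tprodDr tprod_pure.
rewrite addrAC addrK; apply: lspanD.
  apply: low_mul ly => z fz; by have := fu _ _ fz; rewrite subnK.
apply: lq; rewrite -[Delta y](subrK (y ⊠ c)); apply: lspanD.
  exact: low_mono ly.
exact: low_pure.
Qed.

(** Taking v_i (x) k_i and f_j (x) 1 out of every factor of Delta gives the
    term with the longest left component; the left components of the other
    terms are shorter. *)
Lemma Delta_leading m1 g m2 :
  low (size m1 + size m2) (Delta (bas m1 g m2) - bas m1 g m2 ⊠ gg D (kword m1 g)).
Proof.
suff [] : leading (size m1 + size m2) (bas m1 g m2) (gg D (kword m1 g)) by [].
rewrite basE -mulrA; elim: m1 => [|i m1 IH]; last first.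
  rewrite big_cons -mulrA /= -ggMg.
  apply: leading_step (dDelta_gx D i) _ _ IH; rewrite ?leqnSn //.
    by move=> M z; rewrite addSn subSnn; exact: flt_gx.
  by move=> t; apply: low_mul => z; rewrite mul1r.
rewrite big_nil mul1r /= -[gg D g in X in leading _ _ X]mulr1.
apply: (@leading_step (size m2) _ _ _ 0); rewrite ?dDelta_gg ?addr0 //.
- by move=> M z; rewrite subnn; exact: flt_gg.
- by move=> t _; rewrite (lin0 (tprod_linearl t)); exact: lspan0.
elim: m2 => [|j m2 IH].
  split; first by rewrite big_nil; exact: bspan_bas.
  by rewrite big_nil dDelta1 subrr; exact: lspan0.
rewrite big_cons -[X in leading _ _ X]mulr1.
apply: (leading_step (N := size m2) _ (dDelta_gy D j) _ _ IH); rewrite ?leqnSn //.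
  by move=> M z; rewrite subSnn; exact: flt_gy.
by move=> t; apply: low_mul => z; exact: flt_gg.
Qed.

Definition coef (m : seq 'I_n * G * seq 'I_n) : A -> k^o :=
  dext (fun m1 g m2 => ((m1, g, m2) == m)%:R : k^o).

Lemma coef_linear m : linear (coef m). Proof. exact: dext_linear. Qed.
Lemma coefE m m1 g m2 : coef m (bas m1 g m2) = ((m1, g, m2) == m)%:R.
Proof. by rewrite /coef dextE. Qed.

Definition klen (m : seq 'I_n * G * seq 'I_n) : nat := (size m.1.1 + size m.2)%N.

Lemma coef_flt m N x : (N <= klen m)%N -> flt N x -> coef m x = 0.
Proof.
move=> Nm; elim=> [|c _ y [m1 [g [m2 [h ->]]]] _ IH]; first exact: lin0 (coef_linear m).
rewrite coef_linear IH addr0 coefE; case: eqP => [e|_]; last by rewrite scaler0.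
by move: h; rewrite ltnNge (leq_trans Nm) // -e.
Qed.

Local Notation M := {malg k[(seq 'I_n * G * seq 'I_n)%type]}.

(** Spans do not depend on whether the module operations are sealed. *)
Lemma lspan_unseal (T : M -> Prop) (x : M) :
  lspan T x -> @lspan k A (T : A -> Prop) (x : A).
Proof.
elim=> [|c y z Ty _ IH]; first by rewrite -(dzeroE D); exact: lspan0.
have -> : (c *: y + z)%R = c *: (y : A) + (z : A) :> A.
  by rewrite -[RHS]/(dadd (dscale c (y : A)) (z : A)) daddE dscaleE.
exact: lspanZD IH.
Qed.

Lemma mcoef_coef (x : A) m : (x : M)@_m = coef m x.
Proof.
pattern x; suff: (fun x : A => (x : M)@_m : k^o) =1 coef m by apply.
apply: dbl_eq => [||m1' g' m2'].
- move=> c {}x y; have -> : c *: x + y = ((c *: (x : M) + (y : M)) : A).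
    by rewrite -[LHS]/(dadd (dscale c x) y) daddE dscaleE.
  by rewrite mcoeffD mcoeffZ.
- exact: coef_linear.
- by rewrite coefE basU mcoeffU.
Qed.

Lemma max_klen (s : seq (seq 'I_n * G * seq 'I_n)) : s != [::] ->
  exists2 m, m \in s & forall m', m' \in s -> (klen m' <= klen m)%N.
Proof.
elim: s => // m [|m0 s] IH _.
  by exists m; rewrite ?mem_head // => m'; rewrite inE => /eqP ->.
have [//|m' m's mmax] := IH; case: (leqP (klen m) (klen m')) => h.
  exists m'; first by rewrite inE m's orbT.
  by move=> m1; rewrite inE => /orP[/eqP -> //|/mmax].
exists m; rewrite ?mem_head // => m1; rewrite inE => /orP[/eqP -> //|/mmax h1].
exact: leq_trans h1 (ltnW h).
Qed.

(** One of the longest monomials in the finite support of x. *)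
Lemma top_monomial (x : A) : x != 0 ->
  exists m, coef m x != 0 /\ flt (klen m).+1 x.
Proof.
move=> xn0; have sn0 : (msupp (x : M) : seq _) != [::].
  apply: contra_neq xn0 => s0; rewrite -[RHS]/(dzero D) dzeroE.
  apply/malgP => m; rewrite mcoeff0 mcoeff_outdom //.
  by rewrite -[_ \in _]/(m \in (msupp (x : M) : seq _)) s0.
have [m ms mmax] := max_klen sn0.
exists m; rewrite -mcoef_coef mcoeff_neq0; split=> //.
apply: (@lspan_mono k A (fun y : A => exists m1 g m2,
  (size m1 + size m2 < (klen m).+1)%N /\ y = << (m1, g, m2) >>)).
  by move=> _ [m1 [g [m2 [h ->]]]]; rewrite -(basU D); exact: bspan_bas.
apply: lspan_unseal; rewrite [x in lspan _ x]monalgE big_seq.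
elim/big_ind: _ => [|u w|[[m1 g] m2] mx]; first exact: lspan0; first exact: lspanD.
rewrite malgUZ; apply/lspanZ/lspan_gen; exists m1, g, m2; split=> //.
by rewrite ltnS; exact: (mmax (m1, g, m2)).
Qed.

(** Every nonzero subcoalgebra contains an element of G: contract the
    coproduct of a nonzero element with the coordinate of one of its longest
    monomials. *)
Lemma subcoalgebra_grouplike (C : A -> Prop) x :
  subcoalgebra (Delta : {linear A -> tens A A}) C -> C x -> x != 0 ->
  exists g, C (gg D g).
Proof.
move=> [Clin CD] Cx xn0; have [m [cm fm]] := top_monomial xn0.
pose F (t : tens A A) : A := tlift (fun a b => (coef m a : k) *: b) t.
have bF : bilinear_fun (fun a b : A => (coef m a : k) *: b).
  split=> [b|a]; first exact: linear_scaler (coef_linear m).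
  by apply: linear_scale; exact: linear_id.
have lF : linear F := tlift_linear bF.
have FE a b : F (a ⊠ b) = (coef m a : k) *: b := tliftE' _ _ bF.
have FD : F (Delta x) = (coef m x : k) *: gg D (kword m.1.1 m.1.2).
  move: fm; apply: (lspan_eq (F := fun x => F (Delta x))
    (F' := fun x => (coef m x : k) *: gg D (kword m.1.1 m.1.2))).
  - exact: linear_comp lF (@dDelta_linear _ _ _ D).
  - exact: linear_scaler (coef_linear m).
  move=> _ [m1 [g [m2 [h ->]]]].
  rewrite -[Delta _](subrK (bas m1 g m2 ⊠ gg D (kword m1 g))) (linD lF) FE.
  have -> : F (Delta (bas m1 g m2) - bas m1 g m2 ⊠ gg D (kword m1 g)) = 0.
    elim: (Delta_leading m1 g m2) => [|c _ y [a [b [ha ->]]] _ IH].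
      exact: lin0 lF.
    by rewrite lF IH FE (coef_flt _ ha) ?scale0r ?scaler0 ?addr0.
  rewrite add0r coefE; case: eqP => [<- //|_]; by rewrite !scale0r.
have CF : C (F (Delta x)).
  apply: Clin; apply: (lspan_image lF _ (CD _ Cx)) => _ [a [b [Ca Cb ->]]].
  by rewrite -spureE FE; apply/lspanZ/lspan_gen.
exists (kword m.1.1 m.1.2); apply: Clin.
rewrite -[gg D _]scale1r -(mulVf cm) -scalerA -FD.
exact/lspanZ/lspan_gen.
Qed.

Lemma line_subcoalgebra (x : A) : Delta x = x ⊠ x ->
  subcoalgebra (Delta : {linear A -> tens A A}) (fun y => exists a : k, y = a *: x).
Proof.
move=> xx; split=> [y|y [a ->]].
  elim=> [|c _ z [a ->] _ [b ->]]; first by exists 0; rewrite scale0r.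
  by exists (c * a + b); rewrite scalerDl scalerA.
set L := fun y => _; suff: tens_sub L L (Delta (a *: x)) by [].
rewrite (linZ (@dDelta_linear _ _ _ D)) xx.
by apply: lspanZ; apply: tens_sub_pure; exists 1; rewrite scale1r.
Qed.

Lemma gg_neq0 g : gg D g != 0.
Proof.
apply/eqP => /(congr1 (@deps k G n D)); rewrite deps_gg (lin0 (@deps_linear _ _ _ D)).
by move/eqP; rewrite oner_eq0.
Qed.

(** A simple subcoalgebra contains some g in G, and is equal to its
    subcoalgebra kg. *)
Lemma dbl_pointed : pointed (Delta : {linear A -> tens A A}).
Proof.
move=> C [CS [x Cx xn0] Csimple].
have [g Cg] := subcoalgebra_grouplike CS Cx xn0.
have [Clin _] := CS.
have CL y : (exists a : k, y = a *: gg D g) -> C y.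
  by case=> a ->; apply: Clin; exact/lspanZ/lspan_gen.
exists (gg D g) => y; split; last exact: CL.
have [z|] := Csimple _ (line_subcoalgebra (dDelta_gg D g)) CL; last exact.
have /z/eqP : exists a : k, gg D g = a *: gg D g by exists 1; rewrite scale1r.
by rewrite (negPf (gg_neq0 g)).
Qed.

Local Notation grouplike := (grouplike (Delta : {linear A -> tens A A}) eps).

Lemma gg_grouplike g : grouplike (gg D g).
Proof.
split; first by rewrite -spureE; exact: dDelta_gg.
exact: deps_gg.
Qed.

Lemma grouplikeP x : grouplike x -> exists g, x = gg D g.
Proof.
move=> [xx ex]; have xn0 : x != 0.
  apply/eqP => x0; move: ex; rewrite x0 -[LHS]/(@deps k G n D 0).
  rewrite (lin0 (@deps_linear _ _ _ D)) => /esym/eqP; by rewrite oner_eq0.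
rewrite -spureE in xx.
have Cx : exists a : k, x = a *: x by exists 1; rewrite scale1r.
have [g [a ga]] := subcoalgebra_grouplike (line_subcoalgebra xx) Cx xn0.
exists g; rewrite ga; have := deps_gg D g.
rewrite ga (linZ (@deps_linear _ _ _ D)) -[@deps _ _ _ _ x]/(eps x) ex.
by rewrite -[a *: 1]/(a * 1) mulr1 => ->; rewrite scale1r.
Qed.

Lemma lam_n0 i g : lam i g != 0.
Proof. by apply/eqP => l0; have /eqP := lam_inv D i g; rewrite l0 mul0r eq_sym oner_eq0. Qed.

Lemma coef_not_grouplike m x : (0 < klen m)%N -> coef m x != 0 ->
  ~ lspan grouplike x.
Proof.
move=> mp /eqP cx gx; apply: cx; elim: gx => [|c y z /grouplikeP [g ->] _ IH].
  exact: lin0 (coef_linear m).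
rewrite coef_linear IH addr0 coefE; case: eqP => [e|_]; last exact: scaler0.
by rewrite -e in mp.
Qed.

Lemma edge_k g i : skew_edge (Delta : {linear A -> tens A A}) eps
  (gg D g) (gg D (g * kk i)%g).
Proof.
split; [exact: gg_grouplike|exact: gg_grouplike|exists (gg D g * gx D i)].
  apply: (@coef_not_grouplike ([:: i], g, [::])) => //.
  rewrite ggM opKE (linZ (coef_linear _)) coefE mulg1 eqxx lamw_cons lamw_nil mulr1.
  by rewrite -[_ *: 1]/(_ * 1) mulr1 lam_n0.
rewrite -!spureE -[LHS]/(Delta _) dDeltaM dDelta_gg dDelta_gx tprodDr !tprod_pure.
by rewrite mulr1 ggMg.
Qed.

Lemma edge_l g j : skew_edge (Delta : {linear A -> tens A A}) eps
  (gg D (g * ll j)%g) (gg D g).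
Proof.
split; [exact: gg_grouplike|exact: gg_grouplike|exists (gg D g * gy D j)].
  apply: (@coef_not_grouplike ([::], g, [:: j])) => //.
  by rewrite ggM opKE (linZ (coef_linear _)) coefE mulg1 eqxx lamw_nil scale1r oner_eq0.
rewrite -!spureE -[LHS]/(Delta _) dDeltaM dDelta_gg dDelta_gy tprodDr !tprod_pure.
by rewrite mulr1 ggMg.
Qed.

(** The edges given by g v_i and g f_j connect g with g k_i and with g l_j. *)
Lemma dbl_indecomposable :
  generated_by (fun g => exists i, g = kk i \/ g = ll i) ->
  indecomposable (Delta : {linear A -> tens A A}) eps.
Proof.
move=> gen _ _ /grouplikeP [g ->] /grouplikeP [h ->].
set R := clos_refl_sym_trans _ _.
suff conn : forall x y, R (gg D y) (gg D (y * x)%g).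
  by have := conn (g^-1 * h)%g g; rewrite mulVKg.
apply: gen => [y|x x' cx cx' y|x cx y|_ [i [] ->] y].
- by rewrite mulg1; exact: rst_refl.
- by rewrite mulgA; exact: rst_trans (cx y) (cx' _).
- by apply: rst_sym; have := cx (y * x^-1)%g; rewrite mulgVK.
- by apply: rst_step; exact: edge_k.
- by apply/rst_sym/rst_step; exact: edge_l.
Qed.

End DoubleCoradical.

(** * The double over rescaled generators *)

Section BasisEq.
Variables (k : fieldType) (W : vectType k) (n : nat) (e : n.-tuple W).
Hypothesis be : basis_of {:W} e.

Lemma basis_lspan (w : W) : lspan (fun u => exists i, u = tnth e i) w.
Proof.
rewrite (coord_basis be (memvf w)); elim/big_ind: _ => [|x y|i _].
- exact: lspan0.
- exact: lspanD.
by apply/lspanZ/lspan_gen; exists i; rewrite (tnth_nth 0).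
Qed.

Lemma basis_eq (U : lmodType k) (F F' : W -> U) : linear F -> linear F' ->
  (forall i, F (tnth e i) = F' (tnth e i)) -> F =1 F'.
Proof.
by move=> lF lF' E w; apply: (lspan_eq lF lF' _ (basis_lspan w)) => _ [i ->].
Qed.

Definition basis_ext (U : lmodType k) (phi : 'I_n -> U) (w : W) : U :=
  \sum_i coord e i w *: phi i.

Lemma basis_ext_linear (U : lmodType k) (phi : 'I_n -> U) :
  linear (basis_ext phi).
Proof.
move=> c x y; rewrite /basis_ext scaler_sumr -big_split; apply: eq_bigr => i _.
by rewrite /= linearP scalerDl scalerA.
Qed.

Lemma basis_extE (U : lmodType k) (phi : 'I_n -> U) i :
  basis_ext phi (tnth e i) = phi i.
Proof.
rewrite /basis_ext (bigD1 i) //= (tnth_nth 0) coord_free ?(basis_free be) //.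
rewrite eqxx scale1r big1 ?addr0 // => j /negPf nji.
by rewrite coord_free ?(basis_free be) // eq_sym nji scale0r.
Qed.

End BasisEq.

Section TwistedGenerators.
Variables (k : fieldType) (G : groupType) (V : vectType k) (n : nat).
Variables (v : n.-tuple V) (f : n.-tuple (dual V)) (D : double_data k G n).
Variables (s t : 'I_n -> G).
Local Notation lam := (dlam D).
Local Notation kk := (dkk D).
Local Notation ll := (dll D).
Local Notation gam := (dgam D).
Local Notation A := (dbl D).

(** The decomposition of the double over s_i v_i and t_j f_j. With s = t = 1
    it is the decomposition over the generators themselves; for n > 1 weak
    separability needs other s and t. *)
Definition tw_V (w : V) : A := basis_ext v (fun i => gg D (s i) * gx D i) w.
Definition tw_F (w : dual V) : A := basis_ext f (fun j => gg D (t j) * gy D j) w.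
Definition tw_H (h : grpalg k G) : A := malg_ext (fun g : G => gg D g) h.

HB.instance Definition _ := GRing.isLinear.Build k V A *:%R tw_V
  (basis_ext_linear v (fun i => gg D (s i) * gx D i)).
HB.instance Definition _ := GRing.isLinear.Build k (dual V) A *:%R tw_F
  (basis_ext_linear f (fun j => gg D (t j) * gy D j)).

Lemma tw_H_linear : linear tw_H. Proof. exact: linear_malg_ext. Qed.
Lemma tw_HE g : tw_H (gelt k g) = gg D g.
Proof. by rewrite /tw_H /gelt malg_extU. Qed.
HB.instance Definition _ := GRing.isLinear.Build k (grpalg k G) A *:%R tw_H
  tw_H_linear.

Lemma tw_H_monoid : monoid_morphism tw_H.
Proof.
split; first exact: tw_HE.
move=> x y; rewrite -[x * y]/(grp_mul x y).
elim: (grp_lspan x) => [|c _ u [g ->] _ IH].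
  by rewrite grp_mul0l (lin0 tw_H_linear) mul0r.
rewrite grp_mulDl grp_mulZl tw_H_linear IH (tw_H_linear c) mulrDl -scalerAl.
congr (_ *: _ + _); elim: (grp_lspan y) => [|d _ w [h ->] _ IHy].
  by rewrite -[grp_mul _ 0]/(gelt k g * 0) mulr0 (lin0 tw_H_linear) mulr0.
rewrite grp_mulDr grp_mulZr grp_mul_gelt !tw_H_linear IHy mulrDr -scalerAr.
by rewrite !tw_HE ggMg.
Qed.
HB.instance Definition _ := GRing.isMonoidMorphism.Build (grpalg k G) A tw_H
  tw_H_monoid.

(** The commutator of t_i f_i and s_j v_j. *)
Definition tw_bb (i j : 'I_n) : grpalg k G := (lam i (s j) * gam i j) *:
  (gelt k (s j * t i * kk j)%g - gelt k (s j * t i * ll i)%g).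

Lemma tw_beta_bilin : bilinear_fun (fun (y : dual V) (x : V) =>
  basis_ext f (fun i => basis_ext v (fun j => tw_bb i j) x) y).
Proof.
split=> [x|y]; first exact: basis_ext_linear.
apply: (@linear_bigsum k V (grpalg k G)) => i.
exact: linear_scale (basis_ext_linear _ _).
Qed.

Definition tw_beta : tens (dual V) V -> grpalg k G :=
  tlift (fun (y : dual V) (x : V) =>
    basis_ext f (fun i => basis_ext v (fun j => tw_bb i j) x) y).
HB.instance Definition _ := GRing.isLinear.Build k (tens (dual V) V)
  (grpalg k G) *:%R tw_beta (tlift_linear tw_beta_bilin).

Hypotheses (bv : basis_of {:V} v) (bf : basis_of {:dual V} f).

Lemma tw_V_linear : linear tw_V. Proof. exact: basis_ext_linear. Qed.
Lemma tw_F_linear : linear tw_F. Proof. exact: basis_ext_linear. Qed.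
Lemma tw_VE i : tw_V (tnth v i) = gg D (s i) * gx D i.
Proof. exact: basis_extE. Qed.
Lemma tw_FE j : tw_F (tnth f j) = gg D (t j) * gy D j.
Proof. exact: basis_extE. Qed.
Lemma tw_beta_linear : linear tw_beta.
Proof. exact/tlift_linear/tw_beta_bilin. Qed.
Lemma tw_betaE i j : tw_beta (tnth f i ⊗ tnth v j) = tw_bb i j.
Proof. by rewrite /tw_beta (tliftE tw_beta_bilin) !basis_extE. Qed.

Variable act : G -> 'End(V).
Hypotheses (rep : is_rep act).
Hypothesis act_v : forall g i, act g (tnth v i) = lam i g *: tnth v i.
Hypothesis act_f : forall g i, ract act (tnth f i) g = lam i g *: tnth f i.
Hypothesis st : forall i j, lam i (s j) * lam j (t i) = 1.

Lemma ract_linear g : linear (fun y : dual V => ract act y g).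
Proof.
move=> c x y; rewrite /ract; apply/lfunP => w.
by rewrite !(comp_lfunE, add_lfunE, scale_lfunE).
Qed.

Lemma pure2_eq (E F W : lmodType k) (P : E -> F -> W) (Q : E -> F -> W) 
  (SE : E -> Prop) (SF : F -> Prop) :
  (forall y, linear (P^~ y)) -> (forall x, linear (P x)) ->
  (forall y, linear (Q^~ y)) -> (forall x, linear (Q x)) ->
  (forall x y, SE x -> SF y -> P x y = Q x y) ->
  forall x y, lspan SE x -> lspan SF y -> P x y = Q x y.
Proof.
move=> Pl Pr Ql Qr e x y sx sy.
apply: (lspan_eq (Pl y) (Ql y) _ sx) => x' sx'.
by apply: (lspan_eq (Pr x') (Qr x') _ sy) => y'; exact: e.
Qed.

Lemma gx_gg i g : gx D i * gg D g = lam i g^-1%g *: (gg D g * gx D i).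
Proof. by rewrite gg_gx scalerA mulrC lam_inv scale1r. Qed.

Lemma st_inv i j : lam j (t i)^-1%g = lam i (s j).
Proof.
have := congr1 ( *%R (lam i (s j))) (lam_inv D j (t i)).
by rewrite mulrA st mul1r mulr1.
Qed.

Lemma tw_commutator i j : gg D (t i) * gy D i * (gg D (s j) * gx D j) -
    gg D (s j) * gx D j * (gg D (t i) * gy D i) = tw_H (tw_bb i j).
Proof.
have -> : gg D (t i) * gy D i * (gg D (s j) * gx D j) =
    lam i (s j) *: (gg D (s j * t i)%g * (gy D i * gx D j)).
  rewrite -[LHS]mulrA [gy D i * _]mulrA gy_gg -scalerAl -scalerAr; congr (_ *: _).
  by rewrite !mulrA ggMg (dabel D).
have -> : gg D (s j) * gx D j * (gg D (t i) * gy D i) =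
    lam i (s j) *: (gg D (s j * t i)%g * (gx D j * gy D i)).
  rewrite -[LHS]mulrA [gx D j * _]mulrA gx_gg st_inv -scalerAl -scalerAr.
  by congr (_ *: _); rewrite !mulrA ggMg.
rewrite -scalerBr -mulrBr gy_gx [gx D j * _ + _]addrC addrK -scalerAr scalerA.
by rewrite mulrBr !ggMg (linZ tw_H_linear) (linB tw_H_linear) !tw_HE.
Qed.

Lemma tw_fh y g : tw_F y * tw_H (gelt k g) = tw_H (gelt k g) * tw_F (ract act y g).
Proof.
move: y; apply: (basis_eq bf) => [||i].
- exact: linear_comp (mulr_linear _) tw_F_linear.
- apply: linear_comp (mull_linear _) _.
  exact: linear_comp tw_F_linear (ract_linear g).
rewrite act_f (linZ tw_F_linear) tw_FE tw_HE -mulrA gy_gg -scalerAr.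
by rewrite -scalerAr !mulrA ggC.
Qed.

Lemma tw_hv g x : tw_H (gelt k g) * tw_V x = tw_V (act g x) * tw_H (gelt k g).
Proof.
move: x; apply: (basis_eq bv) => [||i].
- exact: linear_comp (mull_linear _) tw_V_linear.
- apply: linear_comp (mulr_linear _) _.
  by apply: linear_comp tw_V_linear _ => c x y; rewrite linearP.
rewrite act_v (linZ tw_V_linear) tw_VE tw_HE mulrA ggC -mulrA gg_gx -scalerAr.
by rewrite -scalerAl mulrA.
Qed.

Lemma tw_fv y x : tw_F y * tw_V x - tw_V x * tw_F y = tw_H (tw_beta (y ⊗ x)).
Proof.
move: (basis_lspan bf y) (basis_lspan bv x).
apply: (pure2_eq (P := fun y x => tw_F y * tw_V x - tw_V x * tw_F y)
  (Q := fun y x => tw_H (tw_beta (y ⊗ x)))) => {x y} [x|y|x|y|_ _ [i ->] [j ->]].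
- apply: linear_sub.
    exact: linear_comp (mulr_linear _) tw_F_linear.
  exact: linear_comp (mull_linear _) tw_F_linear.
- apply: linear_sub.
    exact: linear_comp (mull_linear _) tw_V_linear.
  exact: linear_comp (mulr_linear _) tw_V_linear.
- apply: linear_comp tw_H_linear (linear_comp tw_beta_linear _).
  exact: (pure_bilinear _ _).1.
- apply: linear_comp tw_H_linear (linear_comp tw_beta_linear _).
  exact: (pure_bilinear _ _).2.
by rewrite tw_FE tw_VE tw_commutator tw_betaE.
Qed.

Lemma tw_relations : double_relations act tw_beta tw_V tw_H tw_F.
Proof. by split; [exact: tw_fh|exact: tw_hv|exact: tw_fv]. Qed.

Section Universal.
Variables (B : algType k) (jV : {linear V -> B}).
Variables (jH : {lrmorphism grpalg k G -> B}) (jF : {linear dual V -> B}).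
Hypothesis jrel : double_relations act tw_beta jV jH jF.
Local Notation K g := (jH (gelt k g)).
Local Notation X i := (jV (tnth v i)).
Local Notation Y i := (jF (tnth f i)).

Lemma univ_KM g h : K (g * h)%g = K g * K h.
Proof. by rewrite -grp_mul_gelt -rmorphM. Qed.
Lemma univ_KX g i : K g * X i = lam i g *: (X i * K g).
Proof. by rewrite (rel_hv jrel) act_v (linZ (linear_struct jV)) scalerAl. Qed.
Lemma univ_YK g i : Y i * K g = lam i g *: (K g * Y i).
Proof. by rewrite (rel_fh jrel) act_f (linZ (linear_struct jF)) scalerAr. Qed.
Lemma univ_XK g i : X i * K g = lam i g^-1%g *: (K g * X i).
Proof. by rewrite univ_KX scalerA mulrC lam_inv scale1r. Qed.
Lemma univ_YX i j : Y i * X j - X j * Y i = (lam i (s j) * gam i j) *: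
  (K (s j * t i * kk j)%g - K (s j * t i * ll i)%g).
Proof.
have -> : Y i * X j - X j * Y i = jH (tw_beta (tnth f i ⊗ tnth v j)) :=
  rel_fv jrel _ _.
by rewrite tw_betaE (linZ (linear_struct jH)) (linB (linear_struct jH)).
Qed.

Definition univ_x i : B := K (s i)^-1%g * X i.
Definition univ_g g : B := K g.
Definition univ_y i : B := K (t i)^-1%g * Y i.

Lemma univ_KC g h : K g * K h = K h * K g.
Proof. by rewrite -!univ_KM (dabel D). Qed.

(** A morphism to B which maps s_i v_i to X_i and t_j f_j to Y_j has to map v_i
    to s_i^-1 X_i and f_j to t_j^-1 Y_j. *)
Lemma univ_relations : generator_relations D *%R 1 univ_x univ_g univ_y.
Proof.
split=> [|g h|g i|g j|i j].
- exact: (rmorph1 jH).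
- exact: univ_KM.
- by rewrite /univ_g /univ_x mulrA univ_KC -mulrA (univ_KX g) -scalerAr mulrA.
- by rewrite /univ_g /univ_y -mulrA (univ_YK g) -scalerAr !mulrA univ_KC.
rewrite /univ_x /univ_y /univ_g.
have cE : lam i (s j)^-1%g = lam j (t i).
  have := congr1 ( *%R (lam i (s j)^-1%g)) (st i j).
  by rewrite mulrA [Z in Z * _]mulrC lam_inv mul1r mulr1.
have -> : K (t i)^-1%g * Y i * (K (s j)^-1%g * X j) =
    lam j (t i) *: (K ((t i)^-1 * (s j)^-1)%g * (Y i * X j)).
  rewrite -[LHS]mulrA [Y i * _]mulrA univ_YK cE -scalerAl -scalerAr; congr (_ *: _).
  by rewrite !mulrA univ_KM.
have -> : K (s j)^-1%g * X j * (K (t i)^-1%g * Y i) =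
    lam j (t i) *: (K ((t i)^-1 * (s j)^-1)%g * (X j * Y i)).
  rewrite -[LHS]mulrA [X j * _]mulrA univ_XK invgK -scalerAl -scalerAr; congr (_ *: _).
  by rewrite !mulrA -univ_KM (dabel D).
rewrite -[Y i * X j](subrK (X j * Y i)) univ_YX mulrDr scalerDr addrC; congr (_ + _).
rewrite -scalerAr scalerA mulrA [lam j _ * _]mulrC st mul1r mulrBr -!univ_KM.
by rewrite -!mulgA !mulKg.
Qed.

Definition univ : A -> B := hom *%R 1 univ_x univ_g univ_y.

Let opB := mul_algebra_op B.

Lemma univM x y : univ (x * y) = univ x * univ y.
Proof. exact: homM opB univ_relations x y. Qed.
Lemma univ1 : univ 1 = 1. Proof. exact: hom1 opB univ_relations. Qed.
Lemma univ_linear : linear univ. Proof. exact: hom_linear. Qed.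
Lemma univ_gx i : univ (gx D i) = univ_x i.
Proof. exact: hom_gx opB univ_relations i. Qed.
Lemma univ_gg g : univ (gg D g) = univ_g g.
Proof. exact: (@hom_gg k G n D B *%R 1 univ_x univ_g univ_y opB g). Qed.
Lemma univ_gy i : univ (gy D i) = univ_y i.
Proof. exact: hom_gy opB univ_relations i. Qed.

Lemma univ_KVK g b : K g * (K g^-1%g * b) = b.
Proof. by rewrite mulrA -univ_KM mulgV (rmorph1 jH) mul1r. Qed.

Lemma univ_ext : [/\ forall x, univ (tw_V x) = jV x,
  forall h, univ (tw_H h) = jH h & forall y, univ (tw_F y) = jF y].
Proof.
split.
- apply: (basis_eq bv) => [||i]; first exact: linear_comp univ_linear tw_V_linear.
    exact: linear_struct.
  by rewrite tw_VE univM univ_gg univ_gx /univ_g /univ_x univ_KVK.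
- move=> h; apply: (lspan_eq (F := fun h => univ (tw_H h)) (F' := jH) _ _ _ (grp_lspan h)).
  + exact: linear_comp univ_linear tw_H_linear.
  + exact: linear_struct.
  by move=> _ [g ->]; rewrite tw_HE univ_gg.
- apply: (basis_eq bf) => [||i]; first exact: linear_comp univ_linear tw_F_linear.
    exact: linear_struct.
  by rewrite tw_FE univM univ_gg univ_gy /univ_g /univ_y univ_KVK.
Qed.

Lemma univ_uniq (psi : {lrmorphism A -> B}) :
  [/\ forall x, psi (tw_V x) = jV x, forall h, psi (tw_H h) = jH h &
      forall y, psi (tw_F y) = jF y] -> psi =1 univ.
Proof.
move=> [pV pH pF]; have pg g : psi (gg D g) = K g by rewrite -tw_HE pH.
have pM x y : psi (x * y) = psi x * psi y := rmorphM psi x y.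
have ggVK g (x : A) : x = gg D g^-1%g * (gg D g * x).
  by rewrite mulrA ggMg mulVg gg1 mul1r.
apply: dbl_gen => [||x y ex ey||i|g|j].
- exact: linear_struct.
- exact: univ_linear.
- by rewrite univM -ex -ey pM.
- by rewrite univ1 rmorph1.
- by rewrite univ_gx [in LHS](ggVK (s i) (gx D i)) pM pg -tw_VE pV.
- by rewrite univ_gg pg.
- by rewrite univ_gy [in LHS](ggVK (t j) (gy D j)) pM pg -tw_FE pF.
Qed.

End Universal.

Lemma tw_Abeta : is_Abeta act tw_beta tw_V tw_H tw_F.
Proof.
split=> [|B jV jH jF jrel]; first exact: tw_relations.
pose uL := GRing.isLinear.Build k A B *:%R (univ jV jH jF) (univ_linear jV jH jF).
pose uM := GRing.isMonoidMorphism.Build A B (univ jV jH jF)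
  (univ1 jrel, univM jrel).
pose u : {lrmorphism A -> B} := HB.pack (univ jV jH jF) uL uM.
by exists u; [exact: univ_ext jrel|exact: univ_uniq jrel].
Qed.

(** The monomial in the s_i v_i, g and the t_j f_j with words m1 and m2 is a
    nonzero multiple of the basis monomial with the same words, in which g is
    translated by the product of the s_i and t_j. *)
Definition word_prod (u : 'I_n -> G) (m : seq 'I_n) : G :=
  foldr (fun i g => u i * g)%g 1%g m.
Fixpoint x_factor (m : seq 'I_n) : k :=
  if m is i :: m' then lamw D m (s i) * x_factor m' else 1.
Fixpoint y_factor (m : seq 'I_n) : k :=
  if m is j :: m' then lam j (word_prod t m') * y_factor m' else 1.

Lemma lamw_neq0 m g : lamw D m g != 0.
Proof.
elim: m => [|i m IH]; first by rewrite lamw_nil oner_eq0.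
by rewrite lamw_cons mulf_neq0 // lam_n0.
Qed.

Lemma x_factor_neq0 m : x_factor m != 0.
Proof.
by elim: m => [|i m IH] /=; [exact: oner_neq0|rewrite mulf_neq0 ?lamw_neq0].
Qed.
Lemma y_factor_neq0 m : y_factor m != 0.
Proof. by elim: m => [|i m IH] /=; [exact: oner_neq0|rewrite mulf_neq0 ?lam_n0]. Qed.

Lemma prod_tw_x m1 g m2 : \prod_(i <- m1) (gg D (s i) * gx D i) * bas [::] g m2 =
  x_factor m1 *: bas m1 (word_prod s m1 * g)%g m2.
Proof.
elim: m1 => [|i m1 IH]; first by rewrite big_nil mul1r scale1r mul1g.
rewrite big_cons -mulrA IH -scalerAr -mulrA gxM opXE ggM opKE scalerA mulrC.
by rewrite /= mulgA.
Qed.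

Lemma prod_tw_y m : \prod_(j <- m) (gg D (t j) * gy D j) =
  y_factor m *: bas [::] (word_prod t m) m.
Proof.
elim: m => [|j m IH]; first by rewrite big_nil scale1r.
rewrite big_cons IH -scalerAr -mulrA gyM opYE /= -scalerAr ggM opKE lamw_nil.
by rewrite scale1r scalerA mulrC.
Qed.

Local Notation tmono := (mono v f tw_V tw_H tw_F).

Lemma tw_mono m1 g m2 : tmono m1 g m2 = (x_factor m1 * y_factor m2) *:
  bas m1 (word_prod s m1 * (g * word_prod t m2))%g m2.
Proof.
have -> : tmono m1 g m2 = \prod_(i <- m1) tw_V (tnth v i) *
  tw_H (gelt k g) * \prod_(j <- m2) tw_F (tnth f j) by [].
under eq_bigr do rewrite tw_VE; under [X in _ * X]eq_bigr do rewrite tw_FE.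
rewrite tw_HE prod_tw_y -scalerAr -mulrA [gg D g * _]ggM opKE lamw_nil scale1r.
by rewrite prod_tw_x scalerA mulrC.
Qed.

Lemma bas_tw_mono m1 g m2 : bas m1 g m2 = (x_factor m1 * y_factor m2)^-1 *:
  tmono m1 ((word_prod s m1)^-1 * (g * (word_prod t m2)^-1))%g m2.
Proof.
rewrite tw_mono scalerA mulVf ?scale1r; last first.
  by rewrite mulf_neq0 ?x_factor_neq0 ?y_factor_neq0.
by rewrite -mulgA mulVKg mulgVK.
Qed.

Lemma tw_triangular : bijective (triangular_mul tw_V tw_H tw_F).
Proof.
pose W := tens (tens (talg V) (grpalg k G)) (talg (dual V)).
pose E m1 g m2 : W := eword v m1 ⊗ gelt k g ⊗ eword f m2.
pose inv : A -> W := dext (fun m1 g m2 => (x_factor m1 * y_factor m2)^-1 *: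
  E m1 ((word_prod s m1)^-1 * (g * (word_prod t m2)^-1))%g m2).
have linv : linear inv by exact: dext_linear.
have lT := triangular_mul_linear tw_V tw_H tw_F.
have TE m1 g m2 : triangular_mul tw_V tw_H tw_F (E m1 g m2) = tmono m1 g m2.
  exact: triangular_mul_eword.
exists inv => [w|].
  apply: (lspan_eq (F := fun w => inv (triangular_mul tw_V tw_H tw_F w))
    (F' := id) _ _ _ (triangular_span bv bf w)) => [||_ [m1 [g [m2 ->]]]].
  - exact: linear_comp linv lT.
  - exact: linear_id.
  rewrite -/(E m1 g m2) TE tw_mono (linZ linv) /inv dextE scalerA divff.
    by rewrite scale1r -!mulgA mulKg mulgV mulg1.
  by rewrite mulf_neq0 ?x_factor_neq0 ?y_factor_neq0.
apply: dbl_eq => [||m1 g m2]; first exact: linear_comp lT linv.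
  exact: linear_id.
by rewrite /inv dextE (linZ lT) TE -bas_tw_mono.
Qed.

Lemma tw_free : free_braided_double act tw_beta tw_V tw_H tw_F.
Proof. by split; [exact: rep|exact: tw_Abeta|exact: tw_triangular]. Qed.

Lemma tw_V_homb x : homb 1 (tw_V x).
Proof.
elim: (basis_lspan bv x) => [|c _ y [i ->] _ IH].
  by rewrite (lin0 tw_V_linear); exact: lspan0.
rewrite tw_V_linear tw_VE; apply/lspanD/IH/lspanZ.
by apply: homb_gg; exact: homb_gen_x.
Qed.
Lemma tw_F_homb x : homb (- 1) (tw_F x).
Proof.
elim: (basis_lspan bf x) => [|c _ y [i ->] _ IH].
  by rewrite (lin0 tw_F_linear); exact: lspan0.
rewrite tw_F_linear tw_FE; apply/lspanD/IH/lspanZ.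
by apply: homb_gg; exact: homb_gen_y.
Qed.
Lemma tw_H_bspan (Q : seq 'I_n -> G -> seq 'I_n -> Prop) h :
  (forall g, Q [::] g [::]) -> bspan Q (tw_H h).
Proof.
move=> q; elim: (grp_lspan h) => [|c _ y [g ->] _ IH].
  by rewrite (lin0 tw_H_linear); exact: lspan0.
rewrite tw_H_linear tw_HE; apply/lspanD/IH/lspanZ.
exact: bspan_bas.
Qed.
Lemma tw_V_tvh x : tvh (tw_V x).
Proof.
elim: (basis_lspan bv x) => [|c _ y [i ->] _ IH].
  by rewrite (lin0 tw_V_linear); exact: lspan0.
rewrite tw_V_linear tw_VE; apply/lspanD/IH/lspanZ.
exact: tvhM (tvh_g _ _) (tvh_x _ _).
Qed.
Lemma tw_F_htf x : htf (tw_F x).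
Proof.
elim: (basis_lspan bf x) => [|c _ y [i ->] _ IH].
  by rewrite (lin0 tw_F_linear); exact: lspan0.
rewrite tw_F_linear tw_FE; apply/lspanD/IH/lspanZ.
exact: htfM (htf_g _ _) (htf_y _ _).
Qed.

Lemma tw_homogP d x : homog tw_V tw_H tw_F d x <-> homb d x.
Proof.
split; last first.
  apply: lspan_mono => _ [m1 [g [m2 [-> ->]]]]; rewrite bas_tw_mono.
  apply/lspanZ/lspan_gen.
  exists [seq tnth v i | i <- m1], (gelt k ((word_prod s m1)^-1 * (g * (word_prod t m2)^-1))%g).
  exists [seq tnth f i | i <- m2]; rewrite !size_map; split=> //.
  by rewrite /mono !big_map.
apply: lspan_mono => _ [vs [h [fs [-> ->]]]].
rewrite -[(size vs)%:Z]addr0; apply: hombM; first apply: hombM.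
- elim: vs => [|x' vs IH]; first by rewrite big_nil; exact: homb1.
  by rewrite big_cons /= -add1n PoszD; apply: hombM IH; exact: tw_V_homb.
- by apply: tw_H_bspan => g; rewrite subrr.
elim: fs => [|x' fs IH]; first by rewrite big_nil oppr0; exact: homb1.
by rewrite big_cons /= -add1n PoszD opprD; apply: hombM IH; exact: tw_F_homb.
Qed.

Lemma tw_TVHP x : in_TVH tw_V tw_H x <-> tvh x.
Proof.
split; last first.
  apply: lspan_mono => _ [m1 [g [m2 [-> ->]]]]; rewrite bas_tw_mono.
  apply/lspanZ/lspan_gen; exists (eword v m1).
  exists (gelt k ((word_prod s m1)^-1 * (g * (word_prod t [::])^-1))%g).
  by rewrite /mono big_nil mulr1 talg_ext_tword big_map.
apply: lspan_mono => _ [u [h ->]].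
apply: (lspan_image (F := fun u => talg_ext tw_V u * tw_H h) _ _ (eword_span bv u)).
  exact: linear_comp (mulr_linear _) (talg_ext_linear _).
move=> _ [m ->]; rewrite talg_ext_tword; apply: tvhM.
  elim: m => [|i m IH]; first by rewrite big_nil; exact: (tvh_g _ 1%g).
  by rewrite big_cons; apply: tvhM IH; exact: tw_V_tvh.
exact: tw_H_bspan.
Qed.

Lemma tw_HTFP x : in_HTF tw_H tw_F x <-> htf x.
Proof.
split; last first.
  apply: lspan_mono => _ [m1 [g [m2 [-> ->]]]]; rewrite bas_tw_mono.
  apply/lspanZ/lspan_gen.
  exists (gelt k ((word_prod s [::])^-1 * (g * (word_prod t m2)^-1))%g), (eword f m2).
  by rewrite /mono big_nil mul1r talg_ext_tword big_map.
apply: lspan_mono => _ [h [w ->]].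
apply: (lspan_image (F := fun w => tw_H h * talg_ext tw_F w) _ _ (eword_span bf w)).
  exact: linear_comp (mull_linear _) (talg_ext_linear _).
move=> _ [m ->]; rewrite talg_ext_tword; apply: htfM; first exact: tw_H_bspan.
elim: m => [|i m IH]; first by rewrite big_nil; exact: (htf_g _ 1%g).
by rewrite big_cons; apply: htfM IH; exact: tw_F_htf.
Qed.

Local Notation Delta := (@dDelta k G n D).
Local Notation eps := (@deps k G n D).
Local Notation S := (@dS k G n D).

Lemma tens_sub_mono (P Q : A -> Prop) : (forall x, P x -> Q x) ->
  forall z, tens_sub P P z -> tens_sub Q Q z.
Proof.
move=> PQ; apply: lspan_mono => _ [a [b [pa pb ->]]].
by apply: lspan_gen; exists a, b; split; [exact: PQ|exact: PQ|].
Qed.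

Lemma tw_triangular_hopf :
  triangular_hopf act tw_beta tw_V tw_H tw_F Delta eps S.
Proof.
split.
- exact: tw_free.
- exact: dbl_hopf.
- move=> g; have e := tw_HE g; have := dDelta_gg D g; rewrite -e spureE; exact.
- move=> x /tw_TVHP/dDelta_tvh; apply: tens_sub_mono => y; exact: (tw_TVHP y).2.
- move=> x /tw_HTFP/dDelta_htf; apply: tens_sub_mono => y; exact: (tw_HTFP y).2.
- move=> d x /tw_homogP/dDelta_graded.
  apply: lspan_mono => _ [d1 [d2 [a [b [-> ha hb ->]]]]].
  by apply: lspan_gen; exists d1, d2, a, b; split=> //; apply/tw_homogP.
- by move=> d x /tw_homogP; exact: deps_graded.
- by move=> d x /tw_homogP/dS_graded; exact: (tw_homogP d _).2.
- by move=> x /tw_TVHP/dS_tvh; exact: (tw_TVHP _).2.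
- by move=> x /tw_HTFP/dS_htf; exact: (tw_HTFP _).2.
Qed.

End TwistedGenerators.

(** * Weak separability and the converse *)

Lemma basis_degrees (k : fieldType) (G : groupType) (W : vectType k) (n : nat)
    (e : n.-tuple W) (d : 'I_n -> G) (deg : W -> G -> Prop) :
  basis_of {:W} e -> (forall i, deg (tnth e i) (d i)) -> injective d ->
  distinct_degrees deg.
Proof.
move=> be ed di; have en : n = \dim {:W} by rewrite (size_basis be).
exists (tcast en e), (fun i => d (cast_ord (esym en) i)); split.
- by rewrite val_tcast.
- by move=> i; rewrite tcastE.
- by move=> i j /di /cast_ord_inj.
Qed.

Section TwistedDegrees.
Variables (k : fieldType) (G : groupType) (V : vectType k) (n : nat).
Variables (v : n.-tuple V) (f : n.-tuple (dual V)) (D : double_data k G n).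
Variables (s t : 'I_n -> G).
Hypotheses (bv : basis_of {:V} v) (bf : basis_of {:dual V} f).
Local Notation A := (dbl D).
Local Notation jV := (tw_V v D s).
Local Notation jF := (tw_F f D t).
Local Notation jH := (@tw_H k G n D).
Local Notation Delta := (@dDelta k G n D).

Lemma Delta_tw_V i : Delta (jV (tnth v i)) =
  jV (tnth v i) ⊠ jH (gelt k (s i * dkk D i)%g) + jH (gelt k (s i)) ⊠ jV (tnth v i).
Proof.
rewrite tw_VE // !tw_HE dDeltaM dDelta_gg dDelta_gx tprodDr !tprod_pure mulr1.
by rewrite ggMg.
Qed.

Lemma Delta_tw_F j : Delta (jF (tnth f j)) =
  jF (tnth f j) ⊠ jH (gelt k (t j)) + jH (gelt k (t j * dll D j)%g) ⊠ jF (tnth f j).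
Proof.
rewrite tw_FE // !tw_HE dDeltaM dDelta_gg dDelta_gy tprodDr !tprod_pure mulr1.
by rewrite ggMg.
Qed.

Lemma tw_weakly_separable : injective s -> injective (fun i => s i * dkk D i)%g ->
  injective t -> injective (fun i => t i * dll D i)%g ->
  weakly_separable jV jH jF Delta.
Proof.
move=> si ski ti tli; split.
- apply: (basis_degrees bv _ ski) => i.
  suff: tens_sub (in_H jH) (in_im jV) (Delta (jV (tnth v i)) -
    jV (tnth v i) ⊗ jH (gelt k (s i * dkk D i)%g)) by [].
  rewrite Delta_tw_V -spureE addrC addKr; apply: tens_sub_pure.
    by exists (gelt k (s i)).
  by exists (tnth v i).
- apply: (basis_degrees bv _ si) => i.
  suff: tens_sub (in_im jV) (in_H jH) (Delta (jV (tnth v i)) -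
    jH (gelt k (s i)) ⊗ jV (tnth v i)) by [].
  rewrite Delta_tw_V -spureE addrK; apply: tens_sub_pure.
    by exists (tnth v i).
  by exists (gelt k (s i * dkk D i)%g).
- apply: (basis_degrees bf _ ti) => i.
  suff: tens_sub (in_H jH) (in_im jF) (Delta (jF (tnth f i)) -
    jF (tnth f i) ⊗ jH (gelt k (t i))) by [].
  rewrite Delta_tw_F -spureE addrC addKr; apply: tens_sub_pure.
    by exists (gelt k (t i * dll D i)%g).
  by exists (tnth f i).
- apply: (basis_degrees bf _ tli) => i.
  suff: tens_sub (in_im jF) (in_H jH) (Delta (jF (tnth f i)) -
    jH (gelt k (t i * dll D i)%g) ⊗ jF (tnth f i)) by [].
  rewrite Delta_tw_F -spureE addrK; apply: tens_sub_pure.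
    by exists (tnth f i).
  by exists (gelt k (t i)).
Qed.

End TwistedDegrees.

Section Converse.
Variables (k : fieldType) (G : groupType) (V : vectType k).
Variables (act : G -> 'End(V)) (n : nat).
Variables (v : n.-tuple V) (f : n.-tuple (dual V)) (kk ll : 'I_n -> G).
Variables (p : G -> 'I_n -> 'I_n) (lam mu : 'I_n -> G -> k).
Hypothesis rep : is_rep act.
Hypothesis gd : generator_data act v f kk ll p lam mu.
Hypothesis dd : degree_data kk ll p lam mu.
Variable gamma : 'M[k]_n.
Hypothesis gamma_lam : forall i j : 'I_n, ~ (lam i =1 lam j) -> gamma i j = 0.

Lemma dd_index g i : p g i = i.
Proof.
apply: (index_trivial gd) => [i' j|i' j]; first exact: dd_fix_v dd i' j.
exact: dd_fix_f dd i' j.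
Qed.

Lemma dd_abelian (g h : G) : (g * h = h * g)%g.
Proof.
apply: (abelian_of_generators gd) => {}g i.
  by rewrite /commute (dd_yd_k dd) dd_index.
by rewrite /commute (dd_yd_l dd) dd_index.
Qed.

Lemma dd_mu i g : mu i g = lam i g. Proof. exact: mu_lam gd dd_index i g. Qed.

Lemma dd_act_v g i : act g (tnth v i) = lam i g *: tnth v i.
Proof. by rewrite (gd_act_v gd) dd_index. Qed.
Lemma dd_act_f g i : ract act (tnth f i) g = lam i g *: tnth f i.
Proof. by rewrite (gd_act_f gd) dd_index dd_mu. Qed.

Lemma scale_tnth_inj i : injective (fun c : k => c *: tnth v i).
Proof.
move=> c d /eqP; rewrite -subr_eq0 -scalerBl scaler_eq0 subr_eq0.
by rewrite (negPf (tnth_basis_neq0 i (gd_basis_v gd))) orbF => /eqP.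
Qed.

Lemma dd_lam1 i : lam i 1%g = 1.
Proof.
by apply: (@scale_tnth_inj i); rewrite /= -dd_act_v rep.1 id_lfunE scale1r.
Qed.

Lemma dd_lamM i g h : lam i (g * h)%g = lam i g * lam i h.
Proof.
apply: (@scale_tnth_inj i); rewrite /= -dd_act_v rep.2 comp_lfunE dd_act_v.
by rewrite linearZ /= dd_act_v scalerA mulrC.
Qed.

Lemma dd_char i j : lam j (kk i) * lam i (ll j) = 1.
Proof. by rewrite -dd_mu (gd_char gd) mulVf // (lam_neq0 rep gd). Qed.

Lemma dd_gamma i j g : gamma i j * lam i g = gamma i j * lam j g.
Proof.
have [e|/gamma_lam ->] := pselect (lam i =1 lam j); first by rewrite e.
by rewrite !mul0r.
Qed.

Definition dd_double : double_data k G n :=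
  DoubleData dd_lam1 dd_lamM dd_abelian dd_char dd_gamma.

Local Notation D := dd_double.
Local Notation one := (fun _ : 'I_n => 1%g : G).

Lemma one_twist i j : dlam D i (one j) * dlam D j (one i) = 1.
Proof. by rewrite !dlam1 mulr1. Qed.

Lemma converse_ws : ws_hopf_algebra act v f kk ll p lam mu
  (tw_beta v f D one one) (tw_V v D one) (@tw_H k G n D) (tw_F f D one)
  (@dDelta k G n D) (@deps k G n D) (@dS k G n D).
Proof.
have bv := gd_basis_v gd; have bf := gd_basis_f gd.
split.
- exact: (@tw_triangular_hopf k G V n v f D one one bv bf act rep
    dd_act_v dd_act_f one_twist).
- by apply: dbl_indecomposable; exact: gd_gen gd.
- have [s [t [si ski ti tli st]]] := dd_ws dd.
  exists s, t, (tw_beta v f D s t), (tw_V v D s), (tw_F f D t); split.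
  + move=> i; suff: tw_V v D s (tnth v i) = tw_H D (gelt k (s i)) * tw_V v D one (tnth v i) by [].
    by rewrite !tw_VE // tw_HE gg1 mul1r.
  + move=> i; suff: tw_F f D t (tnth f i) = tw_H D (gelt k (t i)) * tw_F f D one (tnth f i) by [].
    by rewrite !tw_FE // tw_HE gg1 mul1r.
  + apply: (@tw_triangular_hopf k G V n v f D s t bv bf act rep
      dd_act_v dd_act_f) => i j /=.
    by rewrite -dd_mu st mulVf // (lam_neq0 rep gd).
  + exact: tw_weakly_separable.
- exact: gd.
- move=> i; set x := tnth v i.
  suff: dDelta (tw_V v D one x) =
    tw_V v D one x ⊗ tw_H D (gelt k (kk i)) + 1 ⊗ tw_V v D one x by [].
  by rewrite Delta_tw_V // mul1g [tw_H D (gelt k 1%g)]tw_HE gg1 !spureE.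
- move=> i; set y := tnth f i.
  suff: dDelta (tw_F f D one y) =
    tw_F f D one y ⊗ 1 + tw_H D (gelt k (ll i)) ⊗ tw_F f D one y by [].
  by rewrite Delta_tw_F // mul1g [tw_H D (gelt k 1%g)]tw_HE gg1 !spureE.
Qed.

Lemma converse_commutators : commutator_relations v f kk ll
  (tw_V v D one) (@tw_H k G n D) (tw_F f D one) gamma.
Proof.
move=> i j; suff: tw_F f D one (tnth f i) * tw_V v D one (tnth v j) -
    tw_V v D one (tnth v j) * tw_F f D one (tnth f i) =
    gamma i j *: (tw_H D (gelt k (kk j)) - tw_H D (gelt k (ll i))) by [].
rewrite tw_FE ?(gd_basis_f gd) // tw_VE ?(gd_basis_v gd) // gg1 !mul1r gy_gx.
by rewrite addrC addKr !tw_HE.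
Qed.

End Converse.

Theorem theorem3 (k : fieldType) (G : groupType) (V : vectType k)
    (act : G -> 'End(V)) (n : nat) (v : n.-tuple V) (f : n.-tuple (dual V))
    (kk ll : 'I_n -> G) (p : G -> 'I_n -> 'I_n) (lam mu : 'I_n -> G -> k) :
  (forall (A : algType k) (beta : {linear tens (dual V) V -> grpalg k G})
      (iV : {linear V -> A}) (iH : {lrmorphism grpalg k G -> A})
      (iF : {linear dual V -> A}) (Delta : {linear A -> tens A A})
      (eps : {lrmorphism A -> k^o}) (S : {linear A -> A}),
    ws_hopf_algebra act v f kk ll p lam mu beta iV iH iF Delta eps S ->
    exists gamma : 'M[k]_n,
      commutator_relations v f kk ll iV iH iF gamma /\
      (forall i j : 'I_n, ~ (lam i =1 lam j) ->
         gamma i j = 0 /\ tnth f i (tnth v j) = 0) /\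
      (forall i j : 'I_n, ~ central (ll i) \/ ~ central (kk j) ->
         gamma i j = 0))
  /\
  (is_rep act ->
   generator_data act v f kk ll p lam mu ->
   degree_data kk ll p lam mu ->
   forall gamma : 'M[k]_n,
     (forall i j : 'I_n, ~ (lam i =1 lam j) -> gamma i j = 0) ->
     (forall i j : 'I_n, ~ central (ll i) \/ ~ central (kk j) ->
        gamma i j = 0) ->
     exists (A : algType k) (beta : {linear tens (dual V) V -> grpalg k G})
       (iV : {linear V -> A}) (iH : {lrmorphism grpalg k G -> A})
       (iF : {linear dual V -> A}) (Delta : {linear A -> tens A A})
       (eps : {lrmorphism A -> k^o}) (S : {linear A -> A}),
       [/\ ws_hopf_algebra act v f kk ll p lam mu beta iV iH iF Delta eps S,
           pointed Delta &
           commutator_relations v f kk ll iV iH iF gamma]).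
Proof.
split=> [A beta iV iH iF Delta eps S wh|rep gd dd gamma glam _].
  exact: forward_direction wh.
pose D := dd_double rep gd dd glam; pose one (_ : 'I_n) : G := 1%g.
exists (dbl D), (tw_beta v f D one one), (tw_V v D one), (@tw_H k G n D).
exists (tw_F f D one), (@dDelta k G n D), (@deps k G n D), (@dS k G n D).
split; [exact: converse_ws|exact: dbl_pointed|exact: converse_commutators].
Qed.
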